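(* Let $B=2^{k_1}C_1\perp\cdots\perp2^{k_r}C_r\in\mathcal H_n(\mathfrak o)$ be a pre-optimal form, and write $\mathrm{GK}(B)=(\underbrace{m_1,\ldots,m_1}_{n_1},\ldots,\underbrace{m_s,\ldots,m_s}_{n_s})$ with $m_1<\cdots<m_s$ and $n=n_1+\cdots+n_s$; put $n_j^*=n_1+\cdots+n_j$. Then: (1) for every $1\le j\le s$ there is an integer $1\le l_j\le r$ such that $B^{(n_j^* )}=B^{[l_j]}$ (i.e. $n_j^*=\deg C_1+\cdots+\deg C_{l_j}$); (2) defining $\zeta_j=\eta_{B^{[l_j]}}$ if $n_j^*$ is odd and $\zeta_j=\xi_{B^{[l_j]}}$ if $n_j^*$ is even, we have $\mathrm{EGK}(B)=(n_1,\ldots,n_s;m_1,\ldots,m_s;\zeta_1,\ldots,\zeta_s)$.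
   Context: Let $F$ be a finite unramified extension of $\mathbb Q_2$ with ring of integers $\mathfrak o$, $\mathrm{ord}$ the valuation with $\mathrm{ord}(2)=1$, $\mathrm{ord}(0)=+\infty$. $\mathcal H_n(\mathfrak o)$ is the set of symmetric $B=(b_{ij})\in M_n(F)$ with $b_{ii}\in\mathfrak o$, $2b_{ij}\in\mathfrak o$; nondegenerate means $\det B\ne0$. $B^{(m)}$ is the upper-left $m\times m$ submatrix; $\perp$ is block-diagonal sum; $B\sim B'$ means $B'={}^tUBU$ with $U\in GL_n(\mathfrak o)$. For nondegenerate $B$ of degree $n$: $D_B=(-4)^{[n/2]}\det B$; $\xi_B=1,-1,0$ according as $D_B\in F^{\times2}$, $F(\sqrt{D_B})/F$ is unramified quadratic, or ramified; if $B$ is $GL_n(F)$-equivalent to $\mathrm{diag}(b_1',\dots,b_n')$, $\eta_B=\langle-1,-1\rangle^{[(n+1)/4]}\langle-1,\det B\rangle^{[(n-1)/2]}\prod_{i<j}\langle b_i',b_j'\rangle$ (Hilbert symbols; this is the Clifford invariant). $S_2(\mathfrak o)_e$: symmetric $2\times2$ matrices over $\mathfrak o$ with diagonal in $2\mathfrak o$; unimodular diagonal: diagonal with unit entries. GK invariant: $S(B)$ is the set of non-decreasing $(a_i)\in\mathbb Z_{\ge0}^n$ with $\mathrm{ord}(b_{ii})\ge a_i$ and $\mathrm{ord}(2b_{ij})\ge(a_i+a_j)/2$ ($i\le j$); $\mathbf S(\{B\})=\bigcup_{U\in GL_n(\mathfrak o)}S({}^tUBU)$; $\mathrm{GK}(B)$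 is its lexicographically greatest element; $B$ is optimal if $\mathrm{GK}(B)\in S(B)$. Extended GK datum: for nondegenerate $B$, choose optimal $B'\sim B$, write $\mathrm{GK}(B')=(m_1^{(n_1)},\dots,m_t^{(n_t)})$ ($m_1<\dots<m_t$, multiplicities $n_i$), $n_u^*=n_1+\dots+n_u$, $\zeta_u=\xi_{B'^{(n_u^* )}}$ if $n_u^*$ even and $\eta_{B'^{(n_u^* )}}$ if odd; $\mathrm{EGK}(B)=(n_1,\dots,n_t;m_1,\dots,m_t;\zeta_1,\dots,\zeta_t)$ (independent of the choice of $B'$). Pre-optimal forms: $B=2^{k_1}C_1\perp\cdots\perp2^{k_r}C_r$ with $k_i\ge0$, each $C_i$ unimodular diagonal or in $\frac12(S_2(\mathfrak o)_e\cap GL_2(\mathfrak o))$; $B^{[j]}=2^{k_1}C_1\perp\cdots\perp2^{k_j}C_j$; $\mathcal D_m=\{j:k_j=m, C_j\text{ diagonal}\}$, $\mathcal E_m=\{j:k_j=m, C_j\text{ not diagonal}\}$. Pre-optimal means: (PO1) $\sum_{j\in\mathcal D_m}\deg C_j\le2$ and $\mathcal E_m$ is a (possibly empty) set of consecutive integers, for each $m$; (PO2) for $i<j$: $\mathcal D_{m_1}\ni i$, $\mathcal D_{m_2}\ni j\Rightarrow m_1\le m_2$; $\mathcal E_{m_1}\ni i,\mathcal E_{m_2}\ni j\Rightarrow m_1\le m_2$; $\mathcal D_{m_1}\ni i,\mathcal E_{m_2}\ni j\Rightarrow m_1\le m_2-1$; $\mathcal E_{m_1}\ni i,\mathcal D_{m_2}\ni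 j\Rightarrow m_1\le m_2+1$; (PO3) if $C_i$ is unimodular diagonal of degree 2 then $i\ge2$ and either ($\deg B^{[i]}$ even and $\xi_{B^{[i-1]}}=\xi_{B^{[i]}}=0$) or ($\deg B^{[i-1]}$ odd and $\mathrm{ord}\det B^{[i-1]}+k_i$ even); (PO4) if $k_i=k_{i-1}-1$, $C_i$ diagonal, $C_{i-1}$ not diagonal, then $\deg C_i=2$, or $\deg C_i=1$ and either ($\deg B^{[i]}$ and $\mathrm{ord}\det B^{[i]}$ even) or ($\deg B^{[i]}$ odd and $\xi_{B^{[i-1]}}=0$); (PO5) if $C_i$ diagonal, $C_{i+1}$ not diagonal, $k_i=k_{i+1}-1$, then $\deg C_i=1$ and either ($\deg B^{[i]}$ even and $\mathrm{ord}\det B^{[i]}$ odd) or ($\deg B^{[i]}$ odd and $\xi_{B^{[i-1]}}\ne0$ if $i\ge2$); (PO6) if $\deg B^{[i]}$ even, $C_i,C_{i+1}$ unimodular diagonal and $k_{i+1}=k_i+1$, then $\xi_{B^{[i]}}=0$. *)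

(* Defs.v *)
From HB Require Import structures.
From mathcomp Require Import all_boot all_order all_algebra.
From mathcomp Require Import boolp.
From mathcomp Require classical_sets.

Set Implicit Arguments.
Unset Strict Implicit.
Unset Printing Implicit Defensive.

Import Order.TTheory GRing.Theory Num.Theory.
Local Open Scope ring_scope.

(* The base field.  A valuation v : F -> int (its value at 0 is       *)
(* irrelevant; ord(0) = +oo is encoded by vge below).                 *)

Definition vge (F : fieldType) (v : F -> int) (x : F) (k : int) : bool :=
  (x == 0) || (k <= v x).

Definition integral (F : fieldType) (v : F -> int) (x : F) : bool := vge v x 0.

Definition unit_o (F : fieldType) (v : F -> int) (x : F) : bool :=
  (x != 0) && (v x == 0).

(* (F, v) is a finite unramified extension of Q_2 with its normalized
   valuation: a complete discretely valued field with v(2) = 1 (so 2 is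
   a uniformizer), 2 != 0, and finite residue field o/2o. *)
Record unram2 (F : fieldType) (v : F -> int) : Prop := {
  v_mul : forall x y : F, x != 0 -> y != 0 -> v (x * y) = v x + v y;
  v_add : forall x y : F, x != 0 -> y != 0 -> x + y != 0 ->
            v x <= v (x + y) \/ v y <= v (x + y);
  two_nz : (2 : F) != 0;
  v_two : v 2 = 1;
  res_fin : exists s : seq F, all (integral v) s /\
            forall x, integral v x -> exists2 y, y \in s & vge v (x - y) 1;
  v_complete : forall u : nat -> F,
     (forall N : int, exists M : nat, forall p, (M <= p)%N -> vge v (u p.+1 - u p) N) ->
     exists l : F, forall N : int, exists M : nat, forall p, (M <= p)%N -> vge v (u p - l) N
}.

Definition hilb (F : fieldType) (a b : F) : int :=
  if `[< exists x y z : F, [|| x != 0, y != 0 | z != 0] /\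
                          z ^+ 2 = a * x ^+ 2 + b * y ^+ 2 >] then 1 else -1.

(* entry (i,j) of M addressed by natural numbers (0 outside the range) *)
Definition mxe (F : fieldType) (n : nat) (M : 'M[F]_n) (i j : nat) : F :=
  match (insub i : option 'I_n), (insub j : option 'I_n) with
  | Some i', Some j' => M i' j'
  | _, _ => 0
  end.

Definition ulsub (F : fieldType) (n : nat) (m : nat) (M : 'M[F]_n) : 'M[F]_m :=
  \matrix_(i < m, j < m) mxe M i j.

Definition in_Hn (F : fieldType) (v : F -> int) (n : nat) (M : 'M[F]_n) : bool :=
  [&& M^T == M, [forall i, integral v (M i i)] &
      [forall i, forall j, integral v (2 * M i j)]].

Definition GLo (F : fieldType) (v : F -> int) (n : nat) (U : 'M[F]_n) : bool :=
  [forall i, forall j, integral v (U i j)] && unit_o v (\det U).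

Definition sim (F : fieldType) (v : F -> int) (n : nat) (B B' : 'M[F]_n) : Prop :=
  exists U : 'M[F]_n, GLo v U /\ B' = U^T *m B *m U.

(* lexicographic order on sequences of naturals (of equal length) *)
Fixpoint lexle (s t : seq nat) : bool :=
  match s, t with
  | x :: s', y :: t' => (x < y)%N || ((x == y) && lexle s' t')
  | _, _ => true
  end.

Definition inS (F : fieldType) (v : F -> int) (n : nat) (M : 'M[F]_n) (a : seq nat) : Prop :=
  [/\ size a = n, sorted leq a,
      (forall i : 'I_n, vge v (M i i) (nth 0%N a i)%:Z) &
      (forall i j : 'I_n, (i <= j)%N ->
          (2 * M i j == 0) || ((nth 0%N a i + nth 0%N a j)%:Z <= 2 * v (2 * M i j)))].

Definition inSU (F : fieldType) (v : F -> int) (n : nat) (M : 'M[F]_n) (a : seq nat) : Prop :=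
  exists U : 'M[F]_n, GLo v U /\ inS v (U^T *m M *m U) a.

Definition GK (F : fieldType) (v : F -> int) (n : nat) (M : 'M[F]_n) : seq nat :=
  classical_sets.xget [::] (fun a => inSU v M a /\ forall a', inSU v M a' -> lexle a' a).

Definition optimal (F : fieldType) (v : F -> int) (n : nat) (M : 'M[F]_n) : Prop :=
  inS v M (GK v M).

(* xi of a discriminant D: 1 if square, -1 if F(sqrt D)/F unramified
   quadratic, 0 if ramified.  Unramifiedness of F(sqrt D) (D not a square)
   means ramification index 1, i.e. the extended valuation
   w = v o N / 2 takes only integer values: v(a^2 - D b^2) is always even. *)
Definition disc_xi (F : fieldType) (v : F -> int) (D : F) : int :=
  if `[< exists y : F, D = y ^+ 2 >] then 1
  else if `[< forall a b : F, (a != 0) || (b != 0) ->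
                 ~~ odd (absz (v (a ^+ 2 - D * b ^+ 2))) >] then -1
  else 0.

Definition xi (F : fieldType) (v : F -> int) (m : nat) (M : 'M[F]_m) : int :=
  disc_xi v ((-4) ^+ (m./2) * \det M).

Definition eta_diag (F : fieldType) (m : nat) (detM : F) (d : 'rV[F]_m) : int :=
  hilb (-1 : F) (-1) ^+ (m.+1 %/ 4) * hilb (-1 : F) detM ^+ (m.-1 %/ 2) *
  \prod_(i < m) \prod_(j < m | (i < j)%N) hilb (d 0 i) (d 0 j).

Definition eta (F : fieldType) (m : nat) (M : 'M[F]_m) : int :=
  eta_diag (\det M)
    (classical_sets.xget 0 (fun d : 'rV[F]_m => exists U : 'M[F]_m,
                U \in unitmx /\ U^T *m M *m U = diag_mx d)).

Definition zeta (F : fieldType) (v : F -> int) (m : nat) (M : 'M[F]_m) : int :=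
  if odd m then eta M else xi v M.

Fixpoint runs (s : seq nat) : seq (nat * nat) :=
  match s with
  | [::] => [::]
  | x :: t =>
      match runs t with
      | (k, y) :: r => if x == y then (k.+1, y) :: r else (1%N, x) :: (k, y) :: r
      | [::] => [:: (1%N, x)]
      end
  end.

Definition EGK (F : fieldType) (v : F -> int) (n : nat) (M : 'M[F]_n)
  : seq nat * seq nat * seq int :=
  let M' := classical_sets.xget M (fun M' => sim v M M' /\ optimal v M') in
  let rs := runs (GK v M') in
  let ns := map fst rs in
  (ns, map snd rs,
   [seq zeta v (ulsub (sumn (take j ns)) M') | j <- iota 1 (size ns)]).

(* BD s : diagonal matrix diag(s);  BE x y z : the 2x2 matrix [[x,y],[y,z]] *)
Inductive blk (F : Type) := BD of seq F | BE of F & F & F.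

Definition isD (F : Type) (b : blk F) : bool :=
  if b is BD _ then true else false.

Definition deg (F : Type) (b : blk F) : nat :=
  match b with BD s => size s | BE _ _ _ => 2 end.

Definition blk_entry (F : fieldType) (b : blk F) (i j : nat) : F :=
  match b with
  | BD s => if i == j then nth 0 s i else 0
  | BE x y z =>
      if (i == 0%N) && (j == 0%N) then x
      else if (i == 1%N) && (j == 1%N) then z
      else if ((i == 0%N) && (j == 1%N)) || ((i == 1%N) && (j == 0%N)) then y
      else 0
  end.

(* C unimodular diagonal (of positive degree), or
   C in (1/2)(S_2(o)_e \cap GL_2(o)) *)
Definition blk_ok (F : fieldType) (v : F -> int) (b : blk F) : bool :=
  match b with
  | BD s => (0 < size s)%N && all (unit_o v) s
  | BE x y z => [&& vge v (2 * x) 1, vge v (2 * z) 1, integral v (2 * y) &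
                    unit_o v ((2 * x) * (2 * z) - (2 * y) ^+ 2)]
  end.

Definition degs (F : Type) (bl : seq (nat * blk F)) : nat :=
  sumn (map (fun p => deg p.2) bl).

Fixpoint ent (F : fieldType) (bl : seq (nat * blk F)) (i j : nat) : F :=
  match bl with
  | [::] => 0
  | (k, b) :: t =>
      let d := deg b in
      if (i < d)%N && (j < d)%N then 2 ^+ k * blk_entry b i j
      else if (d <= i)%N && (d <= j)%N then ent t (i - d) (j - d)
      else 0
  end.

Definition assemble (F : fieldType) (bl : seq (nat * blk F)) : 'M[F]_(degs bl) :=
  \matrix_(i, j) ent bl i j.

(* 1-based accessors k_i, C_i, and B^{[j]} *)
Definition kb (F : Type) (bl : seq (nat * blk F)) (i : nat) : nat :=
  (nth (0%N, BD [::]) bl i.-1).1.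
Definition Cb (F : Type) (bl : seq (nat * blk F)) (i : nat) : blk F :=
  (nth (0%N, BD [::]) bl i.-1).2.
Definition Bpre (F : fieldType) (bl : seq (nat * blk F)) (j : nat) :=
  assemble (take j bl).

Definition ord_det_odd (F : fieldType) (v : F -> int) (m : nat) (M : 'M[F]_m) : bool :=
  odd (absz (v (\det M))).

Definition pre_optimal (F : fieldType) (v : F -> int) (bl : seq (nat * blk F)) : Prop :=
  let r := size bl in
  (forall m : nat,
     (\sum_(1 <= j < r.+1 | (kb bl j == m) && isD (Cb bl j)) deg (Cb bl j) <= 2)%N) /\
  (forall m i l j : nat, (1 <= i)%N -> (i < l)%N -> (l < j)%N -> (j <= r)%N ->
     kb bl i = m -> kb bl j = m -> ~~ isD (Cb bl i) -> ~~ isD (Cb bl j) ->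
     kb bl l = m /\ ~~ isD (Cb bl l)) /\
  (forall i j : nat, (1 <= i)%N -> (i < j)%N -> (j <= r)%N ->
     [/\ isD (Cb bl i) -> isD (Cb bl j) -> (kb bl i <= kb bl j)%N,
         ~~ isD (Cb bl i) -> ~~ isD (Cb bl j) -> (kb bl i <= kb bl j)%N,
         isD (Cb bl i) -> ~~ isD (Cb bl j) -> (kb bl i + 1 <= kb bl j)%N &
         ~~ isD (Cb bl i) -> isD (Cb bl j) -> (kb bl i <= kb bl j + 1)%N]) /\
  (forall i : nat, (1 <= i <= r)%N -> isD (Cb bl i) -> deg (Cb bl i) = 2%N ->
     (2 <= i)%N /\
     ((~~ odd (degs (take i bl)) /\ xi v (Bpre bl i.-1) = 0 /\ xi v (Bpre bl i) = 0) \/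
      (odd (degs (take i.-1 bl)) /\ ~~ odd (absz (v (\det (Bpre bl i.-1))) + kb bl i)%N))) /\
  (forall i : nat, (2 <= i <= r)%N -> (kb bl i + 1 = kb bl i.-1)%N ->
     isD (Cb bl i) -> ~~ isD (Cb bl i.-1) ->
     deg (Cb bl i) = 2%N \/
     (deg (Cb bl i) = 1%N /\
      ((~~ odd (degs (take i bl)) /\ ~~ ord_det_odd v (Bpre bl i)) \/
       (odd (degs (take i bl)) /\ xi v (Bpre bl i.-1) = 0)))) /\
  (forall i : nat, (1 <= i)%N -> (i < r)%N ->
     isD (Cb bl i) -> ~~ isD (Cb bl i.+1) -> (kb bl i + 1 = kb bl i.+1)%N ->
     deg (Cb bl i) = 1%N /\
     ((~~ odd (degs (take i bl)) /\ ord_det_odd v (Bpre bl i)) \/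
      (odd (degs (take i bl)) /\ ((2 <= i)%N -> xi v (Bpre bl i.-1) != 0)))) /\
  (forall i : nat, (1 <= i)%N -> (i < r)%N -> ~~ odd (degs (take i bl)) ->
     isD (Cb bl i) -> isD (Cb bl i.+1) -> (kb bl i.+1 = kb bl i + 1)%N ->
     xi v (Bpre bl i) = 0).

(* Main.v *)
Require Import Defs.
From HB Require Import structures.
From mathcomp Require Import all_boot all_order all_algebra.
From mathcomp Require Import boolp.
From mathcomp Require Import zify ring.
From mathcomp Require classical_sets.

(* For integral A and exponents a with A in S(a), filter the lattice by the vectors whose i-th
   coordinate has valuation at least (m - a_i)/2.  If the quadratic form induced on every graded
   piece has trivial radical, the filtration is intrinsic: a is then lexicographically greatest, and
   any two bases in which a is attained differ by a matrix respecting the filtration.  At a jump of a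
   the corresponding upper-left blocks have the same graded form, and the graded form determines the
   value zeta: its hyperbolic or anisotropic planes have unramified discriminant, and Hilbert symbols
   of such a discriminant with units are trivial.

   For a pre-optimal form such exponents are built block by block.  A new vector of scale K is
   corrected by an integral combination of the earlier ones, so that it either stays single or forms
   a plane with an earlier single vector or with its neighbour; (PO1)-(PO6) ensure that the exponents
   stay non-decreasing.  The base change is unitriangular, hence does not affect zeta of the leading
   blocks, and jumps of a only occur at block boundaries. *)

Set Implicit Arguments.
Unset Strict Implicit.
Unset Printing Implicit Defensive.

Import Order.TTheory GRing.Theory Num.Theory.
Local Open Scope ring_scope.

Local Notation bilinE :=
  (linearDl, linearDr, linearBl, linearBr, linearNl, linearNr, linearZl_LR, linearZr_LR).

(** * Finite sets and sequences *)

Lemma leq_card_imset_fibers (S T : finType) (f : S -> T) (k : nat) :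
  (forall x, #|[set y | f y == f x]| <= k)%N -> (#|S| <= k * #|f @: S|)%N.
Proof.
move=> fiber_le; rewrite -[leqLHS]sum1_card (partition_big_imset f) /= mulnC -sum_nat_const.
apply: leq_sum => _ /imsetP[x _ ->]; rewrite sum1dep_card.
by apply: leq_trans (fiber_le x); rewrite cardsE.
Qed.

Lemma perm_eq_invariant (T : eqType) (A : Type) (f : seq T -> A) :
  (forall x s t, f (s ++ x :: t) = f (x :: s ++ t)) ->
  (forall x s t, perm_eq s t -> f s = f t -> f (x :: s) = f (x :: t)) ->
  forall s t, perm_eq s t -> f s = f t.
Proof.
move=> f_move f_cons; elim=> [|x s IH] t; first by rewrite perm_sym => /perm_nilP->.
move=> st; have x_t : x \in t by rewrite -(perm_mem st) mem_head.
case/splitPr: x_t st => t1 t2; rewrite perm_sym perm_catC cat_cons perm_cons perm_catC perm_sym => st.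
by rewrite f_move; apply: f_cons => //; apply: IH.
Qed.

Lemma perm_pairwise (T : eqType) (r : rel T) s t :
  symmetric r -> perm_eq s t -> pairwise r s = pairwise r t.
Proof.
move=> r_sym; apply: perm_eq_invariant => [x {}s {}t|x {}s {}t st /= ->].
  rewrite pairwise_cat /= allrel_consr all_cat pairwise_cat.
  rewrite (eq_all (a2 := r x) (fun y => r_sym y x)).
  by case: (all _ s); case: (all _ t); case: (allrel _ _ _); case: (pairwise r s).
by rewrite (perm_all _ st).
Qed.

Lemma nth_sorted_leq (s : seq nat) i j :
  sorted leq s -> (i <= j)%N -> (j < size s)%N -> (nth 0%N s i <= nth 0%N s j)%N.
Proof.
move=> s_sorted ij js; apply: (sorted_leq_nth leq_trans leqnn 0%N s_sorted) => //.
by rewrite inE (leq_ltn_trans ij).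
Qed.

Lemma lexle_first_diff s t : size s = size t -> lexle s t -> s = t \/
  exists p, [/\ (p < size s)%N, forall i, (i < p)%N -> nth 0%N s i = nth 0%N t i &
                (nth 0%N s p < nth 0%N t p)%N].
Proof.
elim: s t => [|x s IH] [|y t] //=; first by left.
move=> [sz] /orP[xy|/andP[/eqP-> st]]; first by right; exists 0%N.
case: (IH _ sz st) => [->|[p [ps eq_before lt_p]]]; first by left.
by right; exists p.+1; split=> // -[|i] //; rewrite ltnS; apply: eq_before.
Qed.

Lemma lexle_total s t : lexle s t || lexle t s.
Proof. by elim: s t => [|x s IH] [|y t] //=; case: (ltngtP x y) => //= _; apply: IH. Qed.

Lemma lexle_anti s t : size s = size t -> lexle s t -> lexle t s -> s = t.
Proof.
elim: s t => [|x s IH] [|y t] //= [sz]; case: (ltngtP x y) => //= -> st ts.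
by rewrite (IH t).
Qed.
(* The indices of a reduced system are the singles [ss] and the members of the pairs [ps]. *)
Definition pair_indices (ps : seq (nat * nat)) : seq nat := flatten [seq [:: p.1; p.2] | p <- ps].
Definition indices (ps : seq (nat * nat)) (ss : seq nat) : seq nat := ss ++ pair_indices ps.
Definition paired (ps : seq (nat * nat)) (i j : nat) : bool := ((i, j) \in ps) || ((j, i) \in ps).

Section PairedIndices.

Implicit Types (ps : seq (nat * nat)) (ss : seq nat) (p q : nat * nat) (i j k l : nat).

Lemma pairedC ps i j : paired ps i j = paired ps j i.
Proof. exact: orbC. Qed.

Lemma pair_indicesP ps i : reflect (exists2 p, p \in ps & i \in [:: p.1; p.2]) (i \in pair_indices ps).
Proof.
apply: (iffP flattenP) => [[_ /mapP[p p_ps ->] i_p]|[p p_ps i_p]]; first by exists p.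
by exists [:: p.1; p.2]; rewrite // (map_f (fun p : nat * nat => [:: p.1; p.2])).
Qed.

Lemma mem_pair_indices ps p : p \in ps -> (p.1 \in pair_indices ps) && (p.2 \in pair_indices ps).
Proof. by move=> p_ps; apply/andP; split; apply/pair_indicesP; exists p; rewrite ?inE ?eqxx ?orbT. Qed.

Lemma paired_indices ps i j : paired ps i j -> (i \in pair_indices ps) && (j \in pair_indices ps).
Proof. by case/orP => /mem_pair_indices //; rewrite andbC. Qed.

Lemma pair_indices_paired ps i : i \in pair_indices ps -> exists j, paired ps i j.
Proof.
case/pair_indicesP => -[i1 i2] p_ps; rewrite !inE => /orP[] /eqP->; [exists i2 | exists i1];
  by rewrite /paired p_ps ?orbT.
Qed.

Lemma size_pair_indices ps : size (pair_indices ps) = (size ps).*2.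
Proof. by elim: ps => //= p ps ->. Qed.

Lemma pair_indices_inj ps p q i : uniq (pair_indices ps) -> p \in ps -> q \in ps ->
  i \in [:: p.1; p.2] -> i \in [:: q.1; q.2] -> p = q.
Proof.
elim: ps => // r ps IH uniq_rps.
have not_r p' : p' \in ps -> i \in [:: p'.1; p'.2] -> i \notin [:: r.1; r.2].
  move=> p'_ps i_p'; have i_ps : i \in pair_indices ps by apply/pair_indicesP; exists p'.
  move: uniq_rps; rewrite -[pair_indices _]/([:: r.1; r.2] ++ pair_indices ps) cat_uniq.
  by case/and3P => _ /hasPn/(_ i i_ps).
have uniq_ps : uniq (pair_indices ps) by move: uniq_rps => /= /and3P[].
rewrite !in_cons => /orP[/eqP->|p_ps] /orP[/eqP->|q_ps] // i_p i_q; last exact: IH.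
- by case/negP: (not_r q q_ps i_q).
- by case/negP: (not_r p p_ps i_p).
Qed.

Lemma pair_indices_neq ps p : uniq (pair_indices ps) -> p \in ps -> p.1 != p.2.
Proof.
elim: ps => //= q ps IH; rewrite !inE negb_or => /and3P[/andP[q12 _] _ uniq_ps].
by case/predU1P => [->//|]; apply: IH.
Qed.

Lemma paired_neq ps i j : uniq (pair_indices ps) -> paired ps i j -> i != j.
Proof. by move=> uniq_ps /orP[] /(pair_indices_neq uniq_ps) //; rewrite eq_sym. Qed.

Lemma paired_inj ps i j k : uniq (pair_indices ps) -> paired ps i j -> paired ps k j -> k = i.
Proof.
move=> uniq_ps ij kj; have ij_neq := paired_neq uniq_ps ij.
have same p q := @pair_indices_inj ps p q j uniq_ps.
have mem1 x : j \in [:: j; x] by rewrite mem_head.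
have mem2 x : j \in [:: x; j] by rewrite !inE eqxx orbT.
move: ij kj => /orP[] ij /orP[] kj.
- by have [->] := same _ _ ij kj (mem2 _) (mem2 _).
- by have [ij_eq _] := same _ _ ij kj (mem2 _) (mem1 _); rewrite ij_eq eqxx in ij_neq.
- by have [_ kj_eq] := same _ _ ij kj (mem1 _) (mem2 _); rewrite kj_eq eqxx in ij_neq.
by have [->] := same _ _ ij kj (mem1 _) (mem1 _).
Qed.

Lemma paired_mem ps p i j : uniq (pair_indices ps) -> p \in ps -> i \in [:: p.1; p.2] ->
  paired ps i j -> j \in [:: p.1; p.2].
Proof.
move=> uniq_ps p_ps i_p /orP[] ij.
  by rewrite (pair_indices_inj uniq_ps p_ps ij i_p) ?inE ?eqxx ?orbT.
by rewrite (pair_indices_inj uniq_ps p_ps ij i_p) ?inE ?eqxx ?orbT.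
Qed.

Lemma indices_single ps ss i : i \in ss -> i \in indices ps ss.
Proof. by rewrite mem_cat => ->. Qed.

Lemma indices_pair ps ss i : i \in pair_indices ps -> i \in indices ps ss.
Proof. by rewrite mem_cat orbC => ->. Qed.

Lemma uniq_indices_pairs ps ss : uniq (indices ps ss) -> uniq (pair_indices ps).
Proof. by rewrite cat_uniq => /and3P[]. Qed.

Lemma single_not_pair ps ss i : uniq (indices ps ss) -> i \in ss -> i \notin pair_indices ps.
Proof.
rewrite cat_uniq => /and3P[_ /hasPn no_common _] i_ss; apply/negP => /no_common /=.
by rewrite i_ss.
Qed.

Lemma single_not_paired ps ss i j : uniq (indices ps ss) -> i \in ss -> ~~ paired ps i j.
Proof.
move=> uniq_I /(single_not_pair uniq_I); apply: contra => /paired_indices.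
by case/andP.
Qed.

Lemma perm_indices_cons ps ss p : perm_eq (indices (p :: ps) ss) [:: p.1, p.2 & indices ps ss].
Proof. by apply/permPl; apply: (perm_catCA ss [:: p.1; p.2] (pair_indices ps)). Qed.

Lemma perm_indices_single ps ss ss' : perm_eq ss ss' -> perm_eq (indices ps ss) (indices ps ss').
Proof. by rewrite perm_cat2r. Qed.

Lemma perm_indices_partner ps ss ss' i k : perm_eq ss (i :: ss') ->
  perm_eq (indices ((i, k) :: ps) ss') (k :: indices ps ss).
Proof.
move=> ssE; apply: perm_trans (perm_indices_cons _ _ _) _.
apply: perm_trans (permEl (perm_catCA [:: i] [:: k] _)) _; rewrite /= perm_cons perm_sym.
exact: perm_indices_single ssE.
Qed.

Lemma size_indices ps ss k : perm_eq (indices ps ss) (iota 0 k) -> k = (size ss + (size ps).*2)%N.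
Proof. by move/perm_size; rewrite size_cat size_pair_indices size_iota. Qed.

Lemma mem_indices_iota ps ss k l : perm_eq (indices ps ss) (iota 0 k) -> (l < k)%N = (l \in indices ps ss).
Proof. by move/perm_mem ->; rewrite mem_iota. Qed.

Lemma perm_iotaS (I J : seq nat) k :
  perm_eq J (k :: I) -> perm_eq I (iota 0 k) -> perm_eq J (iota 0 k.+1).
Proof.
move=> JI Ik; apply: (perm_trans JI); rewrite -addn1 iotaD cats1 perm_sym perm_rcons perm_cons.
by rewrite perm_sym.
Qed.

End PairedIndices.

Definition update (T : Type) (f : nat -> T) k x : nat -> T := fun l => if l == k then x else f l.

Lemma update_eq T (f : nat -> T) k x : update f k x k = x.
Proof. by rewrite /update eqxx. Qed.

Lemma update_neq T (f : nat -> T) k x l : l != k -> update f k x l = f l.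
Proof. by rewrite /update => /negPf ->. Qed.

Definition expand_runs (ns ms : seq nat) : seq nat := flatten [seq nseq p.1 p.2 | p <- zip ns ms].

Lemma runs_nseq_cat m k r : (if runs r is p :: _ then p.2 != k else true) ->
  runs (nseq m.+1 k ++ r) = (m.+1, k) :: runs r.
Proof.
move=> head_neq; elim: m => [|m IH] /=; last by move: IH => /= ->; rewrite eqxx.
by case: (runs r) head_neq => [|[c y] l] //= head_neq; rewrite eq_sym (negPf head_neq).
Qed.

Lemma runs_expand_runs ns ms : size ns = size ms -> all (fun x => 0 < x)%N ns -> sorted ltn ms ->
  runs (expand_runs ns ms) = zip ns ms.
Proof.
elim: ns ms => [|[|c] ns IH] [|m ms] // [sz] ns_gt0 ms_sorted.
have runsE : runs (expand_runs ns ms) = zip ns ms by apply: IH => //; apply: path_sorted ms_sorted.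
rewrite -[expand_runs _ _]/(nseq c.+1 m ++ expand_runs ns ms) runs_nseq_cat runsE //.
by case: ns ms ms_sorted {IH runsE ns_gt0 sz} => [|d ns] [|m' ms] //= /andP[lt_m _]; rewrite gtn_eqF.
Qed.

Lemma mem_expand_runs ns ms x : x \in expand_runs ns ms -> x \in ms.
Proof.
case/flattenP => _ /mapP[[c m] cm ->]; rewrite mem_nseq /= => /andP[_ /eqP ->].
by elim: ns ms cm => [|d ns IH] [|m' ms] //=; rewrite !inE => /predU1P[[_ ->]|/IH->]; rewrite ?eqxx ?orbT.
Qed.

Lemma size_expand_runs ns ms : size ns = size ms -> size (expand_runs ns ms) = sumn ns.
Proof. by elim: ns ms => [|c ns IH] [|m ms] //= [/IH sz]; rewrite size_cat size_nseq -sz. Qed.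

Lemma expand_runs_jump ns ms j i l : size ns = size ms -> sorted ltn ms ->
  (i < sumn (take j ns))%N -> (sumn (take j ns) <= l)%N -> (l < size (expand_runs ns ms))%N ->
  (nth 0 (expand_runs ns ms) i < nth 0 (expand_runs ns ms) l)%N.
Proof.
move=> sz ms_sorted lt_i le_l; pose left := expand_runs (take j ns) (take j ms).
have expandE : expand_runs ns ms = left ++ expand_runs (drop j ns) (drop j ms).
  by rewrite /left /expand_runs -flatten_cat -map_cat -zip_cat ?cat_take_drop // !size_take sz.
have size_left : size left = sumn (take j ns) by apply: size_expand_runs; rewrite !size_take sz.
rewrite expandE size_cat size_left => lt_l; rewrite !nth_cat size_left lt_i (ltnNge l (sumn _)) le_l /=.
have left_i : nth 0%N left i \in take j ms.
  by apply: (@mem_expand_runs (take j ns)); rewrite mem_nth // size_left.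
have right_l : nth 0%N (expand_runs (drop j ns) (drop j ms)) (l - sumn (take j ns)) \in drop j ms.
  by apply: (@mem_expand_runs (drop j ns)); rewrite mem_nth // -(ltn_add2l (sumn (take j ns))) subnKC.
move: ms_sorted; rewrite -{1}(cat_take_drop j ms) (sorted_pairwise ltn_trans) pairwise_cat.
by case/andP => /allrelP lt_left_right _; apply: lt_left_right.
Qed.

Lemma sumn_take_gt0 ns j : all (fun x => 0 < x)%N ns -> (1 <= j <= size ns)%N ->
  (0 < sumn (take j ns) <= sumn ns)%N.
Proof.
move=> ns_gt0 /andP[j_gt0 j_le]; apply/andP; split; last first.
  by rewrite -[in leqRHS](cat_take_drop j ns) sumn_cat leq_addr.
by case: ns j j_gt0 j_le ns_gt0 => [|c ns] [|j] //= _ _ /andP[c_gt0 _]; rewrite addn_gt0 c_gt0.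
Qed.
Section DyadicField.

Variables (F : fieldType) (v : F -> int).
Hypothesis F_dyadic : unram2 v.

(** * Valuations and square roots *)

(* Half-integral bounds (a_i + a_j) / 2 are doubled, so that all bounds are integers. *)
Definition dval_ge (x : F) (k : int) : bool := (x == 0) || (k <= 2 * v x).
Definition dval_eq (x : F) (k : int) : bool := (x != 0) && (2 * v x == k).

Local Notation integers := (integral v).

Section Valuation.

Implicit Types (x y : F) (k l m : int).

Lemma vM x y : x != 0 -> y != 0 -> v (x * y) = v x + v y.
Proof. exact: v_mul. Qed.

Lemma v1 : v 1 = 0.
Proof.
have : v (1 * 1) = v 1 + v 1 by apply: vM; apply: oner_neq0.
by rewrite mulr1; lia.
Qed.

Lemma two_neq0 : (2 : F) != 0. Proof. exact: two_nz F_dyadic. Qed.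

Lemma vN x : v (- x) = v x.
Proof.
have [->|x_neq0] := eqVneq x 0; first by rewrite oppr0.
have N1_neq0 : (-1 : F) != 0 by rewrite oppr_eq0 oner_eq0.
have := vM N1_neq0 N1_neq0; rewrite mulN1r opprK v1 => vN1.
by rewrite -mulN1r vM //; lia.
Qed.

Lemma vV x : x != 0 -> v x^-1 = - v x.
Proof.
move=> x_neq0; have := @vM x x^-1 x_neq0; rewrite invr_eq0 => /(_ x_neq0).
by rewrite divff // v1; lia.
Qed.

Lemma vX x n : x != 0 -> v (x ^+ n) = n%:Z * v x.
Proof.
move=> x_neq0; elim: n => [|n IH]; first by rewrite expr0 v1 mul0r.
by rewrite exprS vM ?expf_neq0 // IH; lia.
Qed.

Lemma v2X n : v (2 ^+ n) = n%:Z.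
Proof. by rewrite vX ?two_neq0 // (v_two F_dyadic) mulr1. Qed.

Lemma val_surjective m : exists2 t, t != 0 & v t = m.
Proof.
case: m => m; first by exists (2 ^+ m); rewrite ?expf_neq0 ?two_neq0 // v2X.
by exists (2 ^+ m.+1)^-1; rewrite ?invr_eq0 ?vV ?expf_neq0 ?two_neq0 // v2X.
Qed.

Lemma dval_geP x k : reflect (x != 0 -> k <= 2 * v x) (dval_ge x k).
Proof.
rewrite /dval_ge; apply: (iffP idP) => [/orP[/eqP->|//]|]; first by rewrite eqxx.
by case: (eqVneq x 0) => //= x_neq0 /(_ isT).
Qed.

Lemma dval_eqP x k : reflect (x != 0 /\ 2 * v x = k) (dval_eq x k).
Proof. by apply: (iffP andP) => -[? /eqP]. Qed.

Lemma dval_ge0 k : dval_ge 0 k. Proof. by rewrite /dval_ge eqxx. Qed.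

Lemma dval_ge_le x k l : dval_ge x k -> l <= k -> dval_ge x l.
Proof. by move=> /dval_geP xk lk; apply/dval_geP => /xk; lia. Qed.

(* Sharpens a bound by the evenness of [2 * v x]. *)
Lemma dval_ge_even x k l :
  dval_ge x k -> (forall z : int, k <= 2 * z -> l <= 2 * z) -> dval_ge x l.
Proof. by move=> /dval_geP xk kl; apply/dval_geP => /xk /kl. Qed.

Lemma dval_geN x k : dval_ge (- x) k = dval_ge x k.
Proof. by rewrite /dval_ge oppr_eq0 vN. Qed.

Lemma dval_geD x y k : dval_ge x k -> dval_ge y k -> dval_ge (x + y) k.
Proof.
move=> /dval_geP xk /dval_geP yk; apply/dval_geP => xy.
have [x0|x0] := eqVneq x 0; first by move: xy; rewrite x0 add0r.
have [y0|y0] := eqVneq y 0; first by move: xy; rewrite y0 addr0.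
by have := xk x0; have := yk y0; case: (v_add F_dyadic x0 y0 xy); lia.
Qed.

Lemma dval_geB x y k : dval_ge x k -> dval_ge y k -> dval_ge (x - y) k.
Proof. by move=> xk yk; apply: dval_geD => //; rewrite dval_geN. Qed.

Lemma dval_geM x y k l : dval_ge x k -> dval_ge y l -> dval_ge (x * y) (k + l).
Proof.
move=> /dval_geP xk /dval_geP yl; apply/dval_geP.
rewrite mulf_eq0 negb_or => /andP[x0 y0].
by rewrite vM //; have := xk x0; have := yl y0; lia.
Qed.

Lemma dval_geM_le x y k l m :
  dval_ge x k -> dval_ge y l -> m <= k + l -> dval_ge (x * y) m.
Proof. by move=> xk yl; apply: dval_ge_le; apply: dval_geM. Qed.

Lemma dval_ge_sum (I : Type) (r : seq I) (P : pred I) (f : I -> F) k :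
  (forall i, P i -> dval_ge (f i) k) -> dval_ge (\sum_(i <- r | P i) f i) k.
Proof.
move=> f_k; apply: (big_ind (fun x => dval_ge x k)) => //; first exact: dval_ge0.
by move=> x y; apply: dval_geD.
Qed.

Lemma dval_ge1 k : k <= 0 -> dval_ge 1 k.
Proof. by move=> k_le0; apply/dval_geP; rewrite v1; lia. Qed.

Lemma vgeE x k : vge v x k = dval_ge x (2 * k).
Proof. by rewrite /vge /dval_ge; case: (x == 0) => //=; apply/idP/idP; lia. Qed.

Lemma integersE x : (x \in integers) = dval_ge x 0.
Proof. by rewrite -topredE /= /integral vgeE mulr0. Qed.

Lemma unit_oE x : unit_o v x = dval_eq x 0.
Proof. by rewrite /unit_o /dval_eq; congr andb; apply/eqP/eqP; lia. Qed.

Lemma dval_eq_neq0 x k : dval_eq x k -> x != 0. Proof. by case/andP. Qed.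

Lemma dval_eqW x k : dval_eq x k -> dval_ge x k.
Proof. by move=> /dval_eqP[_ <-]; apply/dval_geP. Qed.

Lemma dval_eq_ge x k l : dval_eq x k -> l <= k -> dval_ge x l.
Proof. by move/dval_eqW; apply: dval_ge_le. Qed.

Lemma dval_eq_even x k : dval_eq x k -> exists z : int, k = 2 * z.
Proof. by move=> /dval_eqP[_ <-]; exists (v x). Qed.

Lemma dval_eq_cast x y k l : dval_eq x k -> y = x -> l = k -> dval_eq y l.
Proof. by move=> xk -> ->. Qed.

Lemma dval_eqM x y k l : dval_eq x k -> dval_eq y l -> dval_eq (x * y) (k + l).
Proof.
move=> /dval_eqP[x0 xk] /dval_eqP[y0 yl]; apply/dval_eqP.
by split; [rewrite mulf_neq0 | rewrite vM //; lia].
Qed.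

Lemma dval_eqM_tight x y k l :
  dval_ge x k -> dval_ge y l -> dval_eq (x * y) (k + l) -> dval_eq x k.
Proof.
move=> /dval_geP xk /dval_geP yl /dval_eqP[]; rewrite mulf_eq0 negb_or => /andP[x0 y0] xy.
by apply/dval_eqP; split=> //; move: xy; rewrite vM //; have := xk x0; have := yl y0; lia.
Qed.

Lemma dval_eqV x k : dval_eq x k -> dval_eq x^-1 (- k).
Proof.
move=> /dval_eqP[x0 xk]; apply/dval_eqP; rewrite invr_eq0 vV //; split=> //; lia.
Qed.

Lemma dval_eqN x k : dval_eq (- x) k = dval_eq x k.
Proof. by rewrite /dval_eq oppr_eq0 vN. Qed.

Lemma dval_eqX x k n : dval_eq x k -> dval_eq (x ^+ n) (n%:Z * k).
Proof.
move=> /dval_eqP[x0 xk]; apply/dval_eqP; rewrite expf_neq0 // vX //; split=> //; lia.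
Qed.

Lemma dval_eq_sqr x k : dval_eq (x ^+ 2) (2 * k) -> dval_eq x k.
Proof.
move=> /dval_eqP[x2_neq0 xk]; have x0 : x != 0 by apply: contraNneq x2_neq0 => ->; rewrite expr0n.
by apply/dval_eqP; split=> //; move: xk; rewrite vX //; lia.
Qed.

Lemma dval_eqD x y k : dval_eq x k -> dval_ge y (k + 1) -> dval_eq (x + y) k.
Proof.
move=> /dval_eqP[x0 xk] y_k1.
have not_x_k1 : ~~ dval_ge x (k + 1) by apply/negP => /dval_geP/(_ x0); lia.
have xy0 : x + y != 0.
  apply: contraNneq not_x_k1 => xy0; suff -> : x = - y by rewrite dval_geN.
  by apply/eqP; rewrite -addr_eq0 xy0.
apply/dval_eqP; split=> //.
have /dval_geP/(_ xy0) : dval_ge (x + y) k.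
  by apply: dval_geD; [apply/dval_geP; lia | apply: dval_ge_le y_k1 _; lia].
have : ~~ dval_ge (x + y) (k + 1).
  by apply: contra not_x_k1 => /dval_geB/(_ y_k1); rewrite addrK.
by rewrite /dval_ge negb_or -ltNge => /andP[_]; lia.
Qed.

Lemma dval_eq_near x y k : dval_eq x k -> dval_ge (y - x) (k + 1) -> dval_eq y k.
Proof. by move=> xk /(dval_eqD xk); rewrite addrC subrK. Qed.

Lemma dval_ge_near x y k l : dval_ge x k -> dval_ge (y - x) l -> k <= l -> dval_ge y k.
Proof. by move=> xk yx kl; rewrite -[y](subrK x); apply: dval_geD (dval_ge_le yx kl) xk. Qed.

Lemma dval_ge_div x y k l m : dval_ge x k -> dval_eq y l -> m <= k - l -> dval_ge (x / y) m.
Proof. by move=> xk /dval_eqV/dval_eqW yl mkl; apply: dval_geM_le xk yl mkl. Qed.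

Lemma dval_ge_eq x k : dval_ge x (2 * k) -> ~~ dval_ge x (2 * k + 2) -> dval_eq x (2 * k).
Proof.
move=> /dval_geP xk; rewrite /dval_ge negb_or -ltNge => /andP[x0 xk2].
by apply/dval_eqP; split=> //; have := xk x0; lia.
Qed.

Lemma dval_eq1 : dval_eq 1 0. Proof. by rewrite /dval_eq oner_eq0 v1. Qed.

Lemma dval_eq_2X n : dval_eq (2 ^+ n) (2 * n%:Z).
Proof. by rewrite /dval_eq expf_neq0 ?two_neq0 //= v2X. Qed.

Lemma dval_eq2 : dval_eq 2 2. Proof. by have := dval_eq_2X 1; rewrite expr1. Qed.

Lemma dval_eq4 : dval_eq 4 4.
Proof. by have -> : 4 = 2 ^+ 2 :> F by [ring]; exact: (dval_eq_2X 2). Qed.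

Lemma dval_eq8 : dval_eq 8 6.
Proof. by have -> : 8 = 2 ^+ 3 :> F by [ring]; exact: (dval_eq_2X 3). Qed.

Lemma dval_ge2M x k l : dval_ge x k -> l <= k + 2 -> dval_ge (2 * x) l.
Proof. by move=> xk lk; apply: (dval_geM_le (dval_eqW dval_eq2) xk); lia. Qed.

Lemma dval_ge2M_inv x k : dval_ge (2 * x) k -> dval_ge x (k - 2).
Proof.
by move=> /dval_ge_div/(_ dval_eq2 (lexx _)); rewrite mulrC mulKf // two_neq0.
Qed.

Fact integers_subring : subring_closed integers.
Proof.
split=> [|x y|x y]; rewrite !integersE; first exact: dval_ge1.
  exact: dval_geB.
exact: dval_geM.
Qed.

HB.instance Definition _ := GRing.isSubringClosed.Build F integers integers_subring.

Lemma integers2M x : x \in integers -> dval_ge (2 * x) 2.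
Proof. by rewrite integersE => x_int; apply: dval_ge2M x_int _. Qed.

Lemma integers4M x : x \in integers -> dval_ge (4 * x) 4.
Proof. by rewrite integersE => x_int; apply: dval_geM (dval_eqW dval_eq4) x_int. Qed.

Lemma unit_integers x : dval_eq x 0 -> x \in integers.
Proof. by move/dval_eqW; rewrite integersE. Qed.

Lemma integers_unit x : x \in integers -> ~~ dval_ge x 2 -> dval_eq x 0.
Proof. by rewrite integersE => x_int; apply: (dval_ge_eq (k := 0)). Qed.

Lemma unitV_integers x : dval_eq x 0 -> x^-1 \in integers.
Proof. by move/dval_eqV; apply: unit_integers. Qed.

Lemma half_integers x : dval_ge x 2 -> x / 2 \in integers.
Proof. by move=> x2; rewrite integersE; apply: dval_ge_div x2 dval_eq2 _. Qed.

Lemma unit_1D2M x : x \in integers -> dval_eq (1 + 2 * x) 0.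
Proof. by move=> /integers2M x2; apply: dval_eqD dval_eq1 (dval_ge_le x2 _). Qed.

Lemma unit_1D4M x : x \in integers -> dval_eq (1 + 4 * x) 0.
Proof. by move=> /integers4M x4; apply: dval_eqD dval_eq1 (dval_ge_le x4 _). Qed.

End Valuation.

Section SquareRoots.

Implicit Types (x y z t : F).

Lemma dval_eq_ltF x k l : dval_eq x k -> k < l -> dval_ge x l = false.
Proof. by move=> /dval_eqP[x0 <-] lt_l; apply/negP => /dval_geP/(_ x0); lia. Qed.

Lemma dval_ge_separated x : (forall n : nat, dval_ge x (2 * n%:Z)) -> x = 0.
Proof.
move=> x_ge; apply/eqP; apply: contraT => x0.
by have /dval_geP/(_ x0) := x_ge `|v x|.+1; lia.
Qed.

Lemma dval_ge_complete (u : nat -> F) :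
  (forall n, dval_ge (u n.+1 - u n) (2 * n%:Z)) ->
  exists l, forall n, dval_ge (u n - l) (2 * n%:Z).
Proof.
move=> u_step.
have u_cauchy n d : dval_ge (u (n + d)%N - u n) (2 * n%:Z).
  elim: d => [|d IH]; first by rewrite addn0 subrr dval_ge0.
  have -> : u (n + d.+1)%N - u n = (u (n + d).+1 - u (n + d)%N) + (u (n + d)%N - u n).
    by rewrite addnS; ring.
  by apply: dval_geD IH; apply: dval_ge_le (u_step _) _; lia.
have [|l u_l] := @v_complete _ _ F_dyadic u.
  by move=> N; exists `|N|%N => p Np; rewrite vgeE; apply: dval_ge_le (u_step p) _; lia.
exists l => n; have [M /(_ (n + M)%N (leq_addl _ _))] := u_l n; rewrite vgeE => near_l.
have -> : u n - l = (u (n + M)%N - l) - (u (n + M)%N - u n) by ring.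
exact: dval_geB near_l (u_cauchy n M).
Qed.

(* The root is the limit of the iteration y |-> 2t - y^2. *)
Lemma artin_schreier_root t : t \in integers -> exists y, y ^+ 2 + y = 2 * t.
Proof.
move=> t_int; pose u n := iter n (fun y => 2 * t - y ^+ 2) 0.
have u_even n : dval_ge (u n) 2.
  elim: n => [|n IH]; first exact: dval_ge0.
  by apply: dval_geB; [exact: integers2M | rewrite expr2; apply: (dval_geM_le IH IH)].
have [|l u_l] := @dval_ge_complete u.
  elim=> [|n IH]; first by rewrite subr0; apply: dval_ge_le (u_even _) _.
  have -> : u n.+2 - u n.+1 = - ((u n.+1 - u n) * (u n.+1 + u n)).
    by rewrite /u !iterS; ring.
  by rewrite dval_geN; apply: dval_geM_le IH (dval_geD (u_even _) (u_even _)) _; lia.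
exists l; apply: subr0_eq; apply: dval_ge_separated => n.
have -> : l ^+ 2 + l - 2 * t = - (u n.+1 - l) - (u n - l) * (u n + l).
  by rewrite /u iterS; ring.
have l_int : dval_ge l 0 by have := u_l 0%N; rewrite sub0r dval_geN.
apply: dval_geB; first by rewrite dval_geN; apply: dval_ge_le (u_l n.+1) _; lia.
by apply: dval_geM_le (u_l n) (dval_geD (dval_ge_le (u_even n) _) l_int) _; lia.
Qed.

Definition sq_equiv (x y : F) : Prop := exists2 c, c != 0 & x = y * c ^+ 2.

Lemma sq_equiv_refl x : sq_equiv x x.
Proof. by exists 1; rewrite ?oner_eq0 // expr1n mulr1. Qed.

Lemma sq_equiv_sym x y : sq_equiv x y -> sq_equiv y x.
Proof.
move=> [c c0 ->]; exists c^-1; rewrite ?invr_eq0 //.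
by rewrite exprVn mulfK // expf_neq0.
Qed.

Lemma sq_equiv_trans y x z : sq_equiv x y -> sq_equiv y z -> sq_equiv x z.
Proof.
by move=> [c c0 ->] [d d0 ->]; exists (d * c); rewrite ?mulf_neq0 // exprMn; ring.
Qed.

Lemma sq_equivM x y z t : sq_equiv x y -> sq_equiv z t -> sq_equiv (x * z) (y * t).
Proof.
by move=> [c c0 ->] [d d0 ->]; exists (c * d); rewrite ?mulf_neq0 // exprMn; ring.
Qed.

Lemma sq_equiv_sqr x c : c != 0 -> sq_equiv (x * c ^+ 2) x.
Proof. by exists c. Qed.

Lemma sq_equiv_neq0 x y : sq_equiv x y -> (x != 0) = (y != 0).
Proof. by move=> [c c0 ->]; rewrite mulf_eq0 expf_eq0 /= (negPf c0) orbF. Qed.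

Lemma sq_equiv_odd x y : x != 0 -> sq_equiv x y -> odd `|v x| = odd `|v y|.
Proof.
move=> x0 xy; have := sq_equiv_neq0 xy; rewrite x0 => /esym y0; case: xy => c c0 ->.
by rewrite vM ?expf_neq0 // vX //; lia.
Qed.

Lemma sq_equiv1_near x : dval_ge (x - 1) 6 -> exists y, x = y ^+ 2.
Proof.
move=> x_near1; pose t := (x - 1) / 8.
have t_int : t \in integers by rewrite integersE; apply: dval_ge_div x_near1 dval_eq8 _.
have [y yE] := artin_schreier_root t_int; exists (1 + 2 * y).
have -> : (1 + 2 * y) ^+ 2 = 1 + 4 * (y ^+ 2 + y) by ring.
have neq0_8 := dval_eq_neq0 dval_eq8.
by rewrite yE /t; field.
Qed.

Lemma sq_equiv_near x y : dval_eq y 0 -> dval_ge (x - y) 6 -> sq_equiv x y.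
Proof.
move=> y_unit near; have y0 := dval_eq_neq0 y_unit.
have x0 : x != 0 by apply: dval_eq_neq0 (dval_eq_near y_unit (dval_ge_le near _)).
have [|t xyE] := @sq_equiv1_near (x / y).
  have -> : x / y - 1 = (x - y) / y by rewrite mulrBl divff.
  exact: dval_ge_div near y_unit _.
exists t; last by rewrite -xyE mulrC divfK.
by apply: contraNneq (mulf_neq0 x0 (invr_neq0 y0)) => t0; rewrite xyE t0 expr0n.
Qed.

Lemma even_val_sq_equiv x : x != 0 -> ~~ odd `|v x| -> exists2 u, dval_eq u 0 & sq_equiv x u.
Proof.
move=> x0 v_even; have [t t0 vt] := val_surjective (v x %/ 2)%Z.
exists (x / t ^+ 2); last by exists t; rewrite ?divfK ?expf_neq0.
apply/dval_eqP; split; first by rewrite mulf_neq0 ?invr_eq0 ?expf_neq0.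
by rewrite vM ?invr_eq0 ?vV ?expf_neq0 // vX // vt; lia.
Qed.

End SquareRoots.

(** * The residue field *)

Definition congr2 (x y : F) : bool := dval_ge (x - y) 2.

Section Residues.

Implicit Types (x y z : F).

Lemma congr2_refl x : congr2 x x.
Proof. by rewrite /congr2 subrr dval_ge0. Qed.

Lemma congr2_sym x y : congr2 x y -> congr2 y x.
Proof. by rewrite /congr2 -dval_geN opprB. Qed.

Lemma congr2_trans y x z : congr2 x y -> congr2 y z -> congr2 x z.
Proof. by move=> xy yz; have := dval_geD xy yz; rewrite addrA subrK. Qed.

Lemma congr2_2M x y : y \in integers -> congr2 (x + 2 * y) x.
Proof. by move/integers2M; rewrite /congr2 addrAC subrr add0r. Qed.

Lemma congr2B x y z t : congr2 x y -> congr2 z t -> congr2 (x - z) (y - t).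
Proof.
move=> xy zt; rewrite /congr2; have -> : x - z - (y - t) = (x - y) - (z - t) by ring.
exact: dval_geB.
Qed.

Lemma congr2M x y z t : x \in integers -> t \in integers ->
  congr2 x y -> congr2 z t -> congr2 (x * z) (y * t).
Proof.
rewrite !integersE => x_int t_int xy zt; rewrite /congr2.
have -> : x * z - y * t = x * (z - t) + (x - y) * t by ring.
by apply: dval_geD; [apply: dval_geM_le x_int zt _ | apply: dval_geM_le xy t_int _].
Qed.

Lemma not_congr2 x y : x \in integers -> y \in integers -> ~~ congr2 x y -> dval_eq (x - y) 0.
Proof.
by move=> x_int y_int; apply: integers_unit; rewrite rpredB.
Qed.

Lemma congr2_sqr_inj x y : x \in integers -> y \in integers ->
  congr2 (x ^+ 2) (y ^+ 2) -> congr2 x y.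
Proof.
move=> x_int y_int sqr_eq; apply: contraT => /(not_congr2 x_int y_int)/(dval_eqX 2) xy_unit.
have : congr2 (x ^+ 2 - y ^+ 2) ((x - y) ^+ 2).
  have -> : x ^+ 2 - y ^+ 2 = (x - y) ^+ 2 + 2 * (y * (x - y)) by ring.
  by apply: congr2_2M; rewrite rpredM ?rpredB.
by move=> /congr2_sym/dval_geD/(_ sqr_eq); rewrite subrK (dval_eq_ltF xy_unit).
Qed.

Lemma residue_system : exists (T : finType) (rep : T -> F) (cls : F -> T),
  [/\ forall i, rep i \in integers, cancel rep cls,
      forall x, x \in integers -> congr2 (rep (cls x)) x &
      forall x y, x \in integers -> y \in integers -> cls x = cls y <-> congr2 x y].
Proof.
have [r [/allP r_int r_all]] := res_fin F_dyadic.
pose idx x : 'I_(size r).+1 := inord (find (congr2 x) r).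
pose rep0 (i : 'I_(size r).+1) := nth 0 r i.
have rep0_int i : rep0 i \in integers.
  by have [/(mem_nth 0)/r_int|/(nth_default 0)] := ltnP i (size r); rewrite /rep0 => // ->; apply: rpred0.
have rep0K x : x \in integers -> congr2 (rep0 (idx x)) x.
  move=> /r_all[y y_r xy]; rewrite /rep0 inordK ?ltnS ?find_size //.
  apply/congr2_sym/(nth_find 0); apply/hasP; exists y => //.
  by move: xy; rewrite vgeE.
have idx_congr x y : congr2 x y -> idx x = idx y.
  move=> xy; congr inord; apply: eq_find => z.
  by apply/idP/idP; apply: congr2_trans => //; apply: congr2_sym.
have idxK x : x \in integers -> idx (rep0 (idx x)) == idx x by move/rep0K/idx_congr/eqP.
pose T := {i | idx (rep0 i) == i}; pose i0 : T := exist _ (idx 0) (idxK 0 (rpred0 _)).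
have clsE x : x \in integers -> val (insubd i0 (idx x)) = idx x.
  by move=> /idxK x_ok; rewrite insubdK.
exists T, (rep0 \o val), (fun x => insubd i0 (idx x)).
split=> [i|i|x x_int|x y x_int y_int] /=; first exact: rep0_int.
- by apply: val_inj; rewrite clsE //; apply/eqP/(valP i).
- by rewrite clsE //; apply: rep0K.
split=> [xy|/idx_congr xy]; last by apply: val_inj; rewrite !clsE.
apply: congr2_trans (rep0K y y_int); rewrite -(clsE y) // -xy clsE //.
exact/congr2_sym/rep0K.
Qed.

Lemma sqrt_congr2 x : x \in integers -> exists2 s, s \in integers & congr2 (s ^+ 2) x.
Proof.
move=> x_int; have [T [rep [cls [rep_int repK clsK cls_eq]]]] := residue_system.
have sqr_int i : rep i ^+ 2 \in integers by rewrite rpredX.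
have sqr_inj : injective (fun i => cls (rep i ^+ 2)).
  move=> i j /(cls_eq _ _ (sqr_int i) (sqr_int j))/(congr2_sqr_inj (rep_int i) (rep_int j)).
  by move/(cls_eq _ _ (rep_int i) (rep_int j)); rewrite !repK.
have /codomP[i xE] := injF_onto sqr_inj (cls x).
by exists (rep i) => //; apply/cls_eq.
Qed.

Lemma artin_schreier_congr2B x y : x \in integers -> y \in integers ->
  congr2 (x ^+ 2 + x - (y ^+ 2 + y)) ((x - y) ^+ 2 + (x - y)).
Proof.
move=> x_int y_int.
have -> : x ^+ 2 + x - (y ^+ 2 + y) = (x - y) ^+ 2 + (x - y) + 2 * (y * (x - y)) by ring.
by apply: congr2_2M; rewrite rpredM ?rpredB.
Qed.

Lemma artin_schreier_fiber x y : x \in integers -> y \in integers ->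
  congr2 (x ^+ 2 + x) (y ^+ 2 + y) -> congr2 x y \/ congr2 x (y + 1).
Proof.
move=> x_int y_int xy_eq; have [xy|/(not_congr2 x_int y_int) xy_unit] := boolP (congr2 x y); first by left.
have : congr2 ((x - y) ^+ 2 + (x - y)) 0.
  apply: congr2_trans (congr2_sym (artin_schreier_congr2B x_int y_int)) _.
  by rewrite /congr2 subr0.
rewrite /congr2 subr0 => /dval_ge_div/(_ xy_unit (lexx _)).
have -> : ((x - y) ^+ 2 + (x - y)) / (x - y) = x - y + 1.
  by field; apply: dval_eq_neq0 xy_unit.
rewrite subr0 => xy1; right; apply: congr2_trans (_ : congr2 (y - 1) (y + 1)).
  by rewrite /congr2; have -> : x - (y - 1) = x - y + 1 by ring.
by have -> : y - 1 = y + 1 + 2 * (-1) by [ring]; apply: congr2_2M; rewrite rpredN rpred1.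
Qed.

(* The additive map z |-> z^2 + z is two-to-one on the residue field, so its image [P] and any
   other coset [x + P] cover the residue field. *)
Lemma artin_schreier_index x y : x \in integers -> y \in integers -> exists2 z, z \in integers &
  [\/ congr2 (z ^+ 2 + z) x, congr2 (z ^+ 2 + z) y | congr2 (z ^+ 2 + z) (x + y)].
Proof.
move=> x_int y_int; have [T [rep [cls [rep_int repK clsK cls_eq]]]] := residue_system.
pose w z : F := z ^+ 2 + z; have w_int i : w (rep i) \in integers by rewrite rpredD ?rpredX.
pose P := [set cls (w (rep i)) | i : T]; pose shift i := cls (rep i + x).
have shift_inj : injective shift.
  move=> i j; have repDx k : rep k + x \in integers by rewrite rpredD.
  move/(cls_eq _ _ (repDx i) (repDx j)); rewrite /congr2 opprD addrACA subrr addr0.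
  by move/(cls_eq _ _ (rep_int i) (rep_int j)); rewrite !repK.
have card_P : (#|T| <= 2 * #|P|)%N.
  apply: leq_card_imset_fibers => i.
  apply: (@leq_trans #|[set i; cls (rep i + 1)]|); last by rewrite cards2; case: (_ != _).
  apply/subset_leq_card/subsetP => j; rewrite !inE => /eqP/(cls_eq _ _ (w_int j) (w_int i)).
  case/(artin_schreier_fiber (rep_int j) (rep_int i)) => /(cls_eq _ _ _ _).
    by rewrite !repK => ->; rewrite ?eqxx.
  by rewrite repK => ->; rewrite ?eqxx ?orbT // rpredD ?rpred1.
have [[z z_int zx]|no_root] := pselect (exists2 z, z \in integers & congr2 (w z) x).
  by exists z => //; apply: Or31.
have P_shift_disjoint : [disjoint P & shift @: P].
  apply/pred0P => c /=; apply/negP => /andP[/imsetP[i _ ->] /imsetP[_ /imsetP[j _ ->]]].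
  move/(cls_eq _ _ (w_int i)); rewrite rpredD // => /(_ isT) wi.
  apply: no_root; exists (rep i - rep j); first by rewrite rpredB.
  apply: congr2_trans (congr2_sym (artin_schreier_congr2B (rep_int i) (rep_int j))) _.
  have -> : x = rep (cls (w (rep j))) + x - rep (cls (w (rep j))) by rewrite addrC addKr.
  by apply: congr2B wi _; apply/congr2_sym/clsK.
have cover : P :|: shift @: P = [set: T].
  apply/eqP; rewrite eqEcard subsetT cardsT cardsU disjoint_setI0 // cards0 subn0.
  by rewrite card_imset // addnn -mul2n.
have : cls y \in P :|: shift @: P by rewrite cover.
rewrite inE => /orP[/imsetP[i _]|/imsetP[_ /imsetP[i _ ->]]].
  by move/(cls_eq _ _ y_int (w_int i))/congr2_sym=> iy; exists (rep i) => //; apply: Or32.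
move/(cls_eq _ _ y_int); rewrite rpredD // => /(_ isT) yx.
exists (rep i) => //; apply: Or33.
have : congr2 (y - x) (w (rep i)).
  apply: congr2_trans (clsK _ (w_int i)).
  by have := congr2B yx (congr2_refl x); rewrite addrK.
move=> /congr2_sym/congr2_trans; apply.
by have -> : x + y = y - x + 2 * x by [ring]; apply/congr2_sym/congr2_2M.
Qed.

End Residues.

(** * Unramified and ramified discriminants *)

Section Discriminants.

Implicit Types (x y w t u D : F).

(* The unramified quadratic algebra is generated by a root of X^2 - X + w. *)
Definition unramified_disc D : Prop := exists2 w, w \in integers & sq_equiv D (1 - 4 * w).

Definition ramified_disc D : Prop :=
  exists2 u, dval_eq u 0 & sq_equiv D (2 * u) \/ sq_equiv D (1 + 2 * u).

Lemma unit_1B4M w : w \in integers -> dval_eq (1 - 4 * w) 0.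
Proof. by move=> w_int; rewrite -mulrN; apply: unit_1D4M; rewrite rpredN. Qed.

Lemma unramified_disc1 : unramified_disc 1.
Proof. by exists 0; [apply: rpred0 | rewrite mulr0 subr0; apply: sq_equiv_refl]. Qed.

Lemma unramified_disc_sq_equiv x y : sq_equiv x y -> unramified_disc y -> unramified_disc x.
Proof. by move=> xy [w w_int yw]; exists w => //; apply: sq_equiv_trans xy yw. Qed.

Lemma unramified_discM x y : unramified_disc x -> unramified_disc y -> unramified_disc (x * y).
Proof.
move=> [w w_int xw] [w' w'_int yw']; exists (w + w' - 4 * (w * w')).
  by rewrite rpredB ?rpredD ?rpredM ?rpred_nat.
have -> : 1 - 4 * (w + w' - 4 * (w * w')) = (1 - 4 * w) * (1 - 4 * w') by ring.
exact: sq_equivM.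
Qed.

Lemma unramified_disc_neq0 x : unramified_disc x -> x != 0.
Proof. by move=> [w /unit_1B4M/dval_eq_neq0 w0 /sq_equiv_neq0 ->]. Qed.

Lemma unramified_disc_even x : unramified_disc x -> ~~ odd `|v x|.
Proof.
move=> x_unram; have x0 := unramified_disc_neq0 x_unram.
by case: x_unram => w /unit_1B4M/dval_eqP[_ vw] /(sq_equiv_odd x0) ->; lia.
Qed.

Lemma unit_sq_equiv u : dval_eq u 0 -> exists2 x, x \in integers & sq_equiv u (1 + 2 * x).
Proof.
move=> u_unit; have [s s_int su] := sqrt_congr2 (unit_integers u_unit).
have s2_unit : dval_eq (s ^+ 2) 0 by apply: dval_eq_near u_unit (dval_ge_le su _).
have s0 := dval_eq_neq0 (dval_eq_sqr (k := 0) s2_unit).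
exists (- ((s ^+ 2 - u) / s ^+ 2 / 2)).
  rewrite rpredN; apply: half_integers; exact: dval_ge_div su s2_unit _.
by exists s => //; field; rewrite s0 two_neq0.
Qed.

Lemma odd_val_ramified_disc D : D != 0 -> odd `|v D| -> ramified_disc D.
Proof.
move=> D0 v_odd; have D2_neq0 : D / 2 != 0 by rewrite mulf_neq0 ?invr_eq0 ?two_neq0.
have [|u u_unit [t t0 DE]] := even_val_sq_equiv D2_neq0.
  by move: v_odd; rewrite vM ?invr_eq0 ?vV ?two_neq0 // (v_two F_dyadic); lia.
exists u => //; left; exists t => //.
by rewrite -mulrA -DE mulrC divfK ?two_neq0.
Qed.

Lemma disc_dichotomy D : D != 0 -> unramified_disc D \/ ramified_disc D.
Proof.
move=> D0; have [v_odd|v_even] := boolP (odd `|v D|).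
  by right; apply: odd_val_ramified_disc.
have [u u_unit Du] := even_val_sq_equiv D0 v_even.
have [x x_int ux] := unit_sq_equiv u_unit; have Dx := sq_equiv_trans Du ux.
have [x_even|/(integers_unit x_int) x_unit] := boolP (dval_ge x 2); last by right; exists x; last right.
left; exists (- (x / 2)); first by rewrite rpredN half_integers.
by have -> : 1 - 4 * - (x / 2) = 1 + 2 * x by field; rewrite two_neq0.
Qed.

Lemma ramified_disc_neq0 D : ramified_disc D -> D != 0.
Proof.
move=> [u u_unit [] /sq_equiv_neq0 ->].
  by rewrite mulf_neq0 ?two_neq0 ?(dval_eq_neq0 u_unit).
exact: dval_eq_neq0 (unit_1D2M (unit_integers u_unit)).
Qed.

Lemma unramified_ramified_discM x y :
  unramified_disc x -> ramified_disc y -> ramified_disc (x * y).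
Proof.
move=> [w w_int xw] [u u_unit yu]; have u_int := unit_integers u_unit.
have u'_unit : dval_eq (u - 2 * (w * (1 + 2 * u))) 0.
  apply: dval_eqD u_unit _; rewrite dval_geN; apply: dval_ge_le (integers2M _) _ => //.
  by rewrite rpredM ?rpredD ?rpred1 ?rpredM ?rpred_nat.
case: yu => yu; last first.
  exists (u - 2 * (w * (1 + 2 * u))) => //; right.
  have -> : 1 + 2 * (u - 2 * (w * (1 + 2 * u))) = (1 - 4 * w) * (1 + 2 * u) by ring.
  exact: sq_equivM.
exists ((1 - 4 * w) * u); first exact: dval_eqM (unit_1B4M w_int) u_unit.
by left; rewrite mulrCA; apply: sq_equivM.
Qed.

Lemma ramified_binary_disc x y z (A B : int) : dval_eq x (2 * A) -> dval_eq y (2 * B) ->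
  odd `|A + B| -> dval_ge (2 * z) (A + B + 1) -> ramified_disc (z ^+ 2 - x * y).
Proof.
move=> xA yB odd_AB z_ge; have xyAB := dval_eqM xA yB; have [m mE] : exists m, A + B + 1 = 2 * m.
  by exists ((A + B + 1) %/ 2)%Z; clear -odd_AB; lia.
have [z_ge3|z_small] := boolP (dval_ge (2 * z) (A + B + 3)).
  have : dval_eq (4 * (z ^+ 2 - x * y)) (2 * (A + B + 2)).
    have -> : 4 * (z ^+ 2 - x * y) = - (4 * (x * y)) + 2 * z * (2 * z) by ring.
    apply: dval_eqD; last by apply: (dval_geM_le z_ge3 z_ge3); clear; lia.
    by rewrite dval_eqN; apply: dval_eq_cast (dval_eqM dval_eq4 xyAB) _ _ => //; clear; lia.
  case/dval_eqP; rewrite mulf_eq0 negb_or => /andP[_ D0] vD; apply: odd_val_ramified_disc => //.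
  move: vD; rewrite vM // ?(dval_eq_neq0 dval_eq4) //; have /dval_eqP[_ v4] := dval_eq4.
  by move: v4 mE; clear; move: (v 4) (v _) => n4 n; lia.
have z_exact : dval_eq (2 * z) (A + B + 1).
  rewrite mE; apply: dval_ge_eq; first by rewrite -mE.
  by apply: contra z_small => /dval_ge_le; apply; clear -mE; lia.
have z0 : z != 0 by apply: contraNneq (dval_eq_neq0 z_exact) => ->; rewrite mulr0.
exists (- (2 * (x * y) / (2 * z) ^+ 2)); last first.
  by right; exists z => //; field; rewrite z0 two_neq0.
have denom := dval_eqV (dval_eqX 2 z_exact).
rewrite dval_eqN; apply: dval_eq_cast (dval_eqM (dval_eqM dval_eq2 xyAB) denom) _ _ => //.
by clear; lia.
Qed.

Lemma unramified_norm_form_unit w p q : w \in integers -> p \in integers -> q \in integers ->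
  (forall z, z \in integers -> ~~ congr2 (z ^+ 2 + z) (- w)) ->
  ~~ (dval_ge p 2 && dval_ge q 2) -> dval_eq (p ^+ 2 + p * q + w * q ^+ 2) 0.
Proof.
move=> w_int p_int q_int no_root; have [q_even|q_unit _] := boolP (dval_ge q 2).
  rewrite andbT => /(integers_unit p_int) p_unit.
  have -> : p ^+ 2 + p * q + w * q ^+ 2 = p ^+ 2 + 2 * (q / 2 * (p + w * q)).
    by field; rewrite two_neq0.
  apply: dval_eqD (dval_eqX 2 p_unit) _; apply: dval_ge_le (integers2M _) _ => //.
  by apply: rpredM; [apply: half_integers | rewrite rpredD ?rpredM].
have {}q_unit := integers_unit q_int q_unit; have q0 := dval_eq_neq0 q_unit.
have pq_int : p / q \in integers by rewrite rpredM // unitV_integers.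
have -> : p ^+ 2 + p * q + w * q ^+ 2 = ((p / q) ^+ 2 + p / q - - w) * q ^+ 2 by field.
apply: (dval_eqM (k := 0) (l := 0)); last exact: (dval_eqX 2 q_unit).
by apply: not_congr2; rewrite ?rpredN ?rpredD ?rpredX ?no_root.
Qed.

Lemma primitive_multiple p q : (p != 0) || (q != 0) -> exists2 t, t != 0 &
  [/\ p / t \in integers, q / t \in integers & ~~ (dval_ge (p / t) 2 && dval_ge (q / t) 2)].
Proof.
move=> pq0; wlog /andP[p0 q_ge]: p q pq0 / (p != 0) && dval_ge q (2 * v p).
  move=> wlog_p; have [|] := boolP ((p != 0) && dval_ge q (2 * v p)); first exact: wlog_p.
  rewrite negb_and negbK => q_small.
  have q0 : q != 0.
    case/orP: q_small => [/eqP p0|]; first by rewrite p0 eqxx in pq0.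
    by apply: contraNneq => ->; apply: dval_ge0.
  have [|| t t0 [q_t p_t prim]] := wlog_p q p; rewrite ?q0 //; last by exists t; rewrite // andbC.
  case/orP: q_small => [/eqP->|]; first exact: dval_ge0.
  by rewrite /dval_ge negb_or => /andP[_ lt_qp]; apply/orP; right; lia.
exists p => //; rewrite divff // rpred1 (dval_eq_ltF dval_eq1) //; split=> //.
rewrite integersE; apply: (dval_ge_div q_ge (l := 2 * v p)); last by rewrite subrr.
exact/dval_eqP.
Qed.

Lemma unramified_norm_form_even w p q : w \in integers ->
  (forall z, z \in integers -> ~~ congr2 (z ^+ 2 + z) (- w)) ->
  (p != 0) || (q != 0) -> ~~ odd `|v (p ^+ 2 + p * q + w * q ^+ 2)|.
Proof.
move=> w_int no_root pq0; have [t t0 [p_t q_t t_min]] := primitive_multiple pq0.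
have -> : p ^+ 2 + p * q + w * q ^+ 2 =
    ((p / t) ^+ 2 + p / t * (q / t) + w * (q / t) ^+ 2) * t ^+ 2 by field.
have /dval_eqP[n0 vn] := unramified_norm_form_unit w_int p_t q_t no_root t_min.
by rewrite vM ?expf_neq0 // vX //; move: vn; move: (v _) (v t) => m n; clear; lia.
Qed.

Lemma sqr_1D4M x z : z \in integers -> x \in integers -> congr2 (z ^+ 2 + z) x ->
  sq_equiv (1 + 4 * x) 1.
Proof.
move=> z_int x_int zx; have z_unit := unit_1D2M z_int.
apply: sq_equiv_trans (_ : sq_equiv ((1 + 2 * z) ^+ 2) 1); last first.
  by exists (1 + 2 * z); rewrite ?mul1r ?(dval_eq_neq0 z_unit).
apply: sq_equiv_near; first exact: (dval_eqX 2 z_unit).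
have -> : 1 + 4 * x - (1 + 2 * z) ^+ 2 = - (4 * (z ^+ 2 + z - x)) by ring.
by rewrite dval_geN; apply: dval_geM (dval_eqW dval_eq4) zx.
Qed.

Lemma disc_xi_sq_equiv x y : sq_equiv x y -> disc_xi v x = disc_xi v y.
Proof.
have sub a b : sq_equiv a b -> (forall c d, (c != 0) || (d != 0) -> ~~ odd `|v (c ^+ 2 - a * d ^+ 2)|) ->
    forall c d, (c != 0) || (d != 0) -> ~~ odd `|v (c ^+ 2 - b * d ^+ 2)|.
  move=> /sq_equiv_sym[t t0 ->] a_even c d cd.
  have := a_even c (t * d); rewrite mulf_eq0 (negPf t0) /= => /(_ cd).
  by rewrite exprMn mulrA.
have sub_sqr a b : sq_equiv a b -> (exists z, a = z ^+ 2) -> exists z, b = z ^+ 2.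
  by move=> /sq_equiv_sym[t _ ->] [z ->]; exists (z * t); rewrite exprMn.
move=> xy; have yx := sq_equiv_sym xy; rewrite /disc_xi.
have -> : `[< exists z, x = z ^+ 2 >] = `[< exists z, y = z ^+ 2 >].
  by apply/asboolP/asboolP; apply: sub_sqr.
by case: asboolP => // _; congr (if _ then _ else _); apply/asboolP/asboolP; apply: sub.
Qed.

Lemma disc_xi_unramified D : unramified_disc D -> disc_xi v D != 0.
Proof.
move=> [w w_int /disc_xi_sq_equiv ->]; rewrite /disc_xi.
case: asboolP => // not_sqr; case: asboolP => // -[] a b ab0.
have -> : a ^+ 2 - (1 - 4 * w) * b ^+ 2 = (a - b) ^+ 2 + (a - b) * (2 * b) + w * (2 * b) ^+ 2 by ring.
apply: unramified_norm_form_even => // [z z_int|].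
  apply: contra_notN not_sqr => /(sqr_1D4M z_int)[|t _]; first by rewrite rpredN.
  by rewrite mulrN mul1r => ->; exists t.
apply: contraLR ab0; rewrite !negb_or !negbK mulf_eq0 (negPf two_neq0) /= subr_eq0.
by move=> /andP[/eqP-> /eqP->]; rewrite eqxx.
Qed.

Lemma disc_xi_ramified D : ramified_disc D -> disc_xi v D = 0.
Proof.
move=> [u u_unit Du]; have /dval_eqP[u2_neq0 v2u] := dval_eqM dval_eq2 u_unit.
have odd_2u : odd `|v (2 * u)| by move: v2u; move: (v _) => n; lia.
case: Du => /disc_xi_sq_equiv ->; rewrite /disc_xi.
  case: asboolP => [[y uE]|_].
    have y0 : y != 0 by apply: contraNneq u2_neq0 => y0; rewrite uE y0 expr0n.
    by move: odd_2u; rewrite uE vX //; move: (v y) => n; lia.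
  case: asboolP => // /(_ 0 1); rewrite oner_eq0 orbT expr0n expr1n mulr1 sub0r vN odd_2u.
  by move=> /(_ isT).
case: asboolP => [[y uE]|_]; last first.
  case: asboolP => // /(_ 1 1); rewrite oner_eq0 expr1n mulr1 opprD addrA subrr sub0r vN odd_2u.
  by move=> /(_ isT).
have u1_unit := unit_1D2M (unit_integers u_unit); rewrite uE in u1_unit.
have y_int := unit_integers (dval_eq_sqr (k := 0) u1_unit).
have : congr2 y 1.
  apply: congr2_sqr_inj; rewrite ?rpred1 // -uE expr1n.
  by apply: congr2_2M; apply: unit_integers.
rewrite /congr2 => y1.
have : dval_ge (2 * u) 4.
  have -> : 2 * u = (y - 1) * (y - 1 + 2) by apply: (addrI 1); rewrite uE; ring.
  exact: dval_geM y1 (dval_geD y1 (dval_eqW dval_eq2)).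
by move/dval_geP/(_ u2_neq0); rewrite v2u.
Qed.

End Discriminants.

(** * Bimultiplicativity of the Hilbert symbol *)

Section HilbertSymbol.

Implicit Types (a b c u x y z : F).

Definition is_norm a b : Prop := exists s t, b = s ^+ 2 - a * t ^+ 2.

Lemma is_normM a b c : is_norm a b -> is_norm a c -> is_norm a (b * c).
Proof.
by move=> [s [t ->]] [s' [t' ->]]; exists (s * s' + a * t * t'), (s * t' + t * s'); ring.
Qed.

Lemma is_norm_sqr a t : is_norm a (t ^+ 2).
Proof. by exists t, 0; ring. Qed.

Lemma is_norm_opp a : is_norm a (- a).
Proof. by exists 0, 1; ring. Qed.

Lemma is_norm_1B a : is_norm a (1 - a).
Proof. by exists 1, 1; ring. Qed.

Lemma is_norm_equivl a a' b : sq_equiv a a' -> is_norm a b -> is_norm a' b.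
Proof. by move=> [c _ ->] [s [t ->]]; exists s, (c * t); ring. Qed.

Lemma is_norm_equivr a b b' : sq_equiv b' b -> is_norm a b -> is_norm a b'.
Proof. by move=> [c _ ->] b_norm; apply: is_normM b_norm (is_norm_sqr a c). Qed.

Lemma is_norm_div a b c : c != 0 -> is_norm a (b * c) -> is_norm a c -> is_norm a b.
Proof.
move=> c0 bc_norm c_norm; apply: is_norm_equivr (is_normM bc_norm c_norm).
by apply: sq_equiv_sym; exists c; rewrite // -mulrA expr2.
Qed.

Lemma is_norm_near a x y : dval_eq y 0 -> dval_ge (x - y) 6 -> is_norm a y -> is_norm a x.
Proof. by move=> y_unit xy; apply: is_norm_equivr (sq_equiv_near y_unit xy). Qed.

Lemma is_norm_of_sqr a b : a != 0 -> is_norm (a ^+ 2) b.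
Proof.
by move=> a0; exists ((b + 1) / 2), ((b - 1) / (2 * a)); field; rewrite a0 two_neq0.
Qed.

Lemma hilbP a b : a != 0 -> b != 0 -> hilb a b = 1 <-> is_norm a b.
Proof.
move=> a0 b0; rewrite /hilb; case: asboolP => [[x [y [z [xyz0 zE]]]]|no_zero]; split=> //.
  move=> _; have [y0|y0] := eqVneq y 0; last first.
    exists (z / y), (x / y); have -> : b = (z ^+ 2 - a * x ^+ 2) / y ^+ 2.
      by rewrite zE [_ + b * _]addrC addrK mulfK ?expf_neq0.
    by field.
  move: zE xyz0; rewrite y0 expr0n mulr0 addr0 eqxx /= => zE xz0.
  have x0 : x != 0.
    apply: contraTneq xz0 => x0; move: zE; rewrite x0 expr0n mulr0 => /eqP.
    by rewrite expf_eq0 /= => /eqP->; rewrite !eqxx.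
  have aE : a = (z / x) ^+ 2 by rewrite expr_div_n zE mulfK // expf_neq0.
  by rewrite aE; apply: is_norm_of_sqr; apply: contraNneq a0 => z0; rewrite aE z0 expr0n.
move=> [s [t bE]]; case: no_zero; exists t, 1, s; rewrite oner_eq0 orbT.
by split=> //; rewrite bE; ring.
Qed.

Lemma hilb_sign a b : hilb a b = 1 \/ hilb a b = -1.
Proof. by rewrite /hilb; case: ifP; [left | right]. Qed.

Lemma hilbC a b : hilb a b = hilb b a.
Proof.
rewrite /hilb; congr (if _ then _ else _); apply/asboolP/asboolP => -[x [y [z [xyz0 zE]]]];
  by exists y, x, z; rewrite orbCA addrC.
Qed.

Lemma hilb_eq a b c d : a != 0 -> b != 0 -> c != 0 -> d != 0 ->
  (is_norm a b <-> is_norm c d) -> hilb a b = hilb c d.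
Proof.
move=> a0 b0 c0 d0 ab_cd.
case: (hilb_sign a b) => ab; case: (hilb_sign c d) => cd; rewrite ab cd //.
  by move/(hilbP a0 b0)/ab_cd/(hilbP c0 d0): ab; rewrite cd.
by move/(hilbP c0 d0)/ab_cd/(hilbP a0 b0): cd; rewrite ab.
Qed.

Lemma hilb_equivr a b b' : a != 0 -> b != 0 -> sq_equiv b b' -> hilb a b = hilb a b'.
Proof.
move=> a0 b0 bb'; apply: hilb_eq; rewrite // -?(sq_equiv_neq0 bb') //.
by split; apply: is_norm_equivr => //; apply: sq_equiv_sym.
Qed.

Lemma hilb_equivl a a' b : a != 0 -> b != 0 -> sq_equiv a a' -> hilb a b = hilb a' b.
Proof. by move=> a0 b0; rewrite ![hilb _ b]hilbC; apply: hilb_equivr. Qed.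

Lemma is_norm_unramified_form w p q : is_norm (1 - 4 * w) (p ^+ 2 + p * q + w * q ^+ 2).
Proof. by exists (p + q / 2), (q / 2); field; rewrite two_neq0. Qed.

Lemma is_norm_unramified_1D4M w z : w \in integers -> z \in integers ->
  is_norm (1 - 4 * w) (1 + 4 * z).
Proof.
move=> w_int z_int; apply: is_norm_near (is_norm_unramified_form w 1 (4 * z)).
  have -> : 1 ^+ 2 + 1 * (4 * z) + w * (4 * z) ^+ 2 = 1 + 4 * (z + w * z ^+ 2 * 4) by ring.
  by apply: unit_1D4M; rewrite rpredD ?rpredM ?rpredX ?rpred_nat.
have -> : 1 + 4 * z - (1 ^+ 2 + 1 * (4 * z) + w * (4 * z) ^+ 2) = - (4 * (4 * (w * z ^+ 2))) by ring.
have wz_int : w * z ^+ 2 \in integers by rewrite rpredM ?rpredX.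
by rewrite dval_geN; apply: dval_geM_le (dval_eqW dval_eq4) (integers4M wz_int) _.
Qed.

Lemma is_norm_unramified_unit D u : unramified_disc D -> dval_eq u 0 -> is_norm D u.
Proof.
move=> [w w_int /sq_equiv_sym Dw] /unit_sq_equiv[x x_int ux].
apply: is_norm_equivl Dw _; apply: is_norm_equivr ux _.
have y_norm := is_norm_unramified_form w 1 (2 * x); set y := _ + _ + _ in y_norm.
have yE : y = 1 + 2 * (x + w * x ^+ 2 * 2) by rewrite /y; ring.
have y0 : y != 0.
  rewrite yE; apply: dval_eq_neq0 (unit_1D2M _).
  by rewrite rpredD ?rpredM ?rpredX ?rpred_nat.
apply: is_norm_div y0 _ y_norm.
have -> : (1 + 2 * x) * y = 1 + 4 * (x + x ^+ 2 + w * x ^+ 2 * (1 + 2 * x)) by rewrite yE; ring.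
apply: is_norm_unramified_1D4M => //.
by rewrite !rpredD ?rpredX // !rpredM ?rpredX // rpredD ?rpred1 ?rpredM ?rpred_nat.
Qed.

Lemma hilb_unramified_unit D u : unramified_disc D -> dval_eq u 0 -> hilb D u = 1.
Proof.
move=> D_unram u_unit; apply/(hilbP (unramified_disc_neq0 D_unram) (dval_eq_neq0 u_unit)).
exact: is_norm_unramified_unit.
Qed.

(* If modulo norms every unit is some 1 + d x, and such a value is a norm as soon as kappa x lies in
   the image of z |-> z^2 + z, then the norms have index at most 2. *)
Lemma is_norm_index_reduction a d kappa p b c :
  p != 0 -> odd `|v p| -> is_norm a p -> dval_ge d 2 -> kappa \in integers ->
  (forall u, dval_eq u 0 -> exists2 x, x \in integers & is_norm a (u * (1 + d * x))) ->
  (forall x z, x \in integers -> z \in integers -> congr2 (z ^+ 2 + z) (kappa * x) ->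
     is_norm a (1 + d * x)) ->
  b != 0 -> c != 0 -> [\/ is_norm a b, is_norm a c | is_norm a (b * c)].
Proof.
move=> p0 p_odd p_norm d_even kappa_int unit_red as_norm b0 c0.
have d_int : d \in integers by rewrite integersE; apply: dval_ge_le d_even _.
have d1_neq0 x : x \in integers -> 1 + d * x != 0.
  rewrite integersE => x_int; apply: (@dval_eq_neq0 _ 0); apply: dval_eqD dval_eq1 _.
  by apply: dval_geM_le d_even x_int _.
have red y : y != 0 -> exists2 x, x \in integers & is_norm a (y * (1 + d * x)).
  move=> y0; have [y_odd|y_even] := boolP (odd `|v y|); last first.
    have [u u_unit yu] := even_val_sq_equiv y0 y_even; have [x x_int ux] := unit_red u u_unit.
    by exists x => //; apply: is_norm_equivr (sq_equivM yu (sq_equiv_refl _)) ux.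
  have [|u u_unit ypu] := even_val_sq_equiv (mulf_neq0 y0 p0).
    by rewrite vM //; lia.
  have [x x_int ux] := unit_red u u_unit; exists x => //; apply: (is_norm_div p0) p_norm.
  by rewrite mulrAC; apply: is_norm_equivr (sq_equivM ypu (sq_equiv_refl _)) ux.
have [x x_int bx] := red b b0; have [y y_int cy] := red c c0.
have [z z_int] := artin_schreier_index (rpredM kappa_int x_int) (rpredM kappa_int y_int).
case=> z_eq.
- by apply: Or31; apply: is_norm_div (d1_neq0 x x_int) bx (as_norm _ _ _ _ z_eq).
- by apply: Or32; apply: is_norm_div (d1_neq0 y y_int) cy (as_norm _ _ _ _ z_eq).
apply: Or33; apply: (@is_norm_div _ _ ((1 + d * x) * (1 + d * y))).
- by rewrite mulf_neq0 ?d1_neq0.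
- by rewrite mulrACA; apply: is_normM.
have -> : (1 + d * x) * (1 + d * y) = 1 + d * (x + y + d * (x * y)) by ring.
apply: as_norm z_int _; first by rewrite !rpredD ?rpredM.
apply: congr2_trans z_eq _; apply: congr2_sym; rewrite /congr2.
have -> : kappa * (x + y + d * (x * y)) - (kappa * x + kappa * y) = d * (kappa * (x * y)) by ring.
have kxy : kappa * (x * y) \in integers by rewrite !rpredM.
by rewrite integersE in kxy; apply: dval_geM_le d_even kxy _.
Qed.

Lemma is_norm_index_odd_disc u b c : dval_eq u 0 -> b != 0 -> c != 0 ->
  [\/ is_norm (2 * u) b, is_norm (2 * u) c | is_norm (2 * u) (b * c)].
Proof.
move=> u_unit; have u_int := unit_integers u_unit; have u0 := dval_eq_neq0 u_unit.
have /dval_eqP[a0 va] : dval_eq (- (2 * u)) 2.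
  by rewrite dval_eqN; apply: dval_eq_cast (dval_eqM dval_eq2 u_unit) _ _.
apply: (is_norm_index_reduction (d := 4) (kappa := 1) a0 _ (is_norm_opp _)).
- by move: va; move: (v _) => n; lia.
- exact: dval_eq_ge dval_eq4 _.
- exact: rpred1.
- move=> y y_unit; have [x x_int yx] := unit_sq_equiv y_unit.
  have [r r_int rx] := sqrt_congr2 (rpredM x_int (unitV_integers u_unit)).
  have diff_int : (x - u * r ^+ 2) / 2 \in integers.
    apply: half_integers; have -> : x - u * r ^+ 2 = - (u * (r ^+ 2 - x * u^-1)) by field.
    by rewrite dval_geN; apply: dval_geM_le (dval_eqW u_unit) rx _.
  exists ((x - u * r ^+ 2) / 2 - x * (u * r ^+ 2)).
    by rewrite rpredB // !rpredM ?rpredX.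
  apply: is_norm_equivr (sq_equivM yx (sq_equiv_refl _)) _.
  have -> : (1 + 2 * x) * (1 + 4 * ((x - u * r ^+ 2) / 2 - x * (u * r ^+ 2))) =
      (1 + 2 * x) ^+ 2 * (1 - 2 * u * r ^+ 2) by field; rewrite two_neq0.
  by apply: is_normM (is_norm_sqr _ _) _; exists 1, r; ring.
move=> x z x_int z_int; rewrite mul1r => /(sqr_1D4M z_int x_int) x1.
by apply: is_norm_equivr x1 _; have := is_norm_sqr (2 * u) 1; rewrite expr1n.
Qed.

Lemma is_norm_index_unit_disc e b c : dval_eq e 0 -> b != 0 -> c != 0 ->
  [\/ is_norm (1 + 2 * e) b, is_norm (1 + 2 * e) c | is_norm (1 + 2 * e) (b * c)].
Proof.
move=> e_unit; have e0 := dval_eq_neq0 e_unit; have e_int := unit_integers e_unit.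
have eV_int := unitV_integers e_unit; set a := 1 + 2 * e.
have norm2 y : is_norm a (1 + 2 * (y - e * y ^+ 2)) by exists (1 + y), y; rewrite /a; ring.
have norm4 z : z \in integers -> is_norm a (1 + 4 * z).
  move=> z_int; have := norm2 (e^-1 - 2 * z).
  have -> : 1 + 2 * (e^-1 - 2 * z - e * (e^-1 - 2 * z) ^+ 2) = 1 + 4 * (z * (1 - 2 * (e * z))) by field.
  apply: is_norm_near.
    by apply: unit_1D4M; rewrite rpredM // rpredB ?rpred1 // !rpredM ?rpred_nat.
  have -> : 1 + 4 * z - (1 + 4 * (z * (1 - 2 * (e * z)))) = 4 * (2 * (z * (e * z))) by ring.
  by apply: dval_geM (dval_eqW dval_eq4) (integers2M _); rewrite !rpredM.
have /dval_eqP[p0 vp] : dval_eq (1 - a) 2.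
  have -> : 1 - a = - (2 * e) by rewrite /a; ring.
  by rewrite dval_eqN; apply: dval_eq_cast (dval_eqM dval_eq2 e_unit) _ _.
apply: (is_norm_index_reduction (d := 2) (kappa := - e) p0 _ (is_norm_1B a)).
- by move: vp; move: (v _) => n; lia.
- exact: dval_eqW dval_eq2.
- by rewrite rpredN.
- move=> u /unit_sq_equiv[x x_int ux]; exists x => //.
  by apply: is_norm_equivr (sq_equivM ux (sq_equiv_refl _)) _; rewrite -expr2; apply: is_norm_sqr.
move=> x z x_int z_int zx; pose w := - z / e - e * (- z / e) ^+ 2.
have ze_int : - z / e \in integers by rewrite rpredM ?rpredN.
have w_int : w \in integers by rewrite rpredB // rpredM // rpredX.
apply: (is_norm_div _ _ (norm2 (- z / e))); rewrite -/w; first exact: dval_eq_neq0 (unit_1D2M w_int).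
have xw_int : (x - w) / 2 \in integers.
  apply: half_integers; have -> : x - w = e^-1 * (z ^+ 2 + z - - e * x) by rewrite /w; field.
  by rewrite integersE in eV_int; apply: dval_geM_le eV_int zx _.
have -> : (1 + 2 * x) * (1 + 2 * w) = 1 + 4 * (w + (x - w) / 2 + x * w) by field; rewrite two_neq0.
by apply: norm4; apply: rpredD; [apply: rpredD | apply: rpredM].
Qed.

Lemma is_norm_index a b c : a != 0 -> b != 0 -> c != 0 ->
  [\/ is_norm a b, is_norm a c | is_norm a (b * c)].
Proof.
move=> a0 b0 c0; have [a_unram|[u u_unit a_ram]] := disc_dichotomy a0; last first.
  case: a_ram => /sq_equiv_sym a_u.
    case: (is_norm_index_odd_disc u_unit b0 c0) => /(is_norm_equivl a_u);
      [exact: Or31 | exact: Or32 | exact: Or33].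
  case: (is_norm_index_unit_disc u_unit b0 c0) => /(is_norm_equivl a_u);
    [exact: Or31 | exact: Or32 | exact: Or33].
have even_norm y : y != 0 -> ~~ odd `|v y| -> is_norm a y.
  move=> y0 /(even_val_sq_equiv y0)[y' y'_unit yy'].
  exact: is_norm_equivr yy' (is_norm_unramified_unit a_unram y'_unit).
have [b_odd|b_even] := boolP (odd `|v b|); last by apply: Or31; apply: even_norm.
have [c_odd|c_even] := boolP (odd `|v c|); last by apply: Or32; apply: even_norm.
by apply: Or33; apply: even_norm; rewrite ?mulf_neq0 ?vM //; lia.
Qed.

Lemma hilbMr a b c : a != 0 -> b != 0 -> c != 0 -> hilb a (b * c) = hilb a b * hilb a c.
Proof.
move=> a0 b0 c0; have bc0 : b * c != 0 by rewrite mulf_neq0.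
have norm_bc := is_norm_index a0 b0 c0.
move: (hilbP a0 b0) (hilbP a0 c0) (hilbP a0 bc0).
case: (hilb_sign a b) => ->; case: (hilb_sign a c) => ->; case: (hilb_sign a (b * c)) => -> //.
- by move=> [/(_ erefl) b_norm _] [/(_ erefl) c_norm _] [_ ->] //; apply: is_normM.
- move=> [/(_ erefl) b_norm _] [_ no_c] [/(_ erefl) bc_norm _].
  by suff /no_c : is_norm a c by []; apply: is_norm_div b0 _ b_norm; rewrite mulrC.
- move=> [_ no_b] [/(_ erefl) c_norm _] [/(_ erefl) bc_norm _].
  by suff /no_b : is_norm a b by []; apply: is_norm_div c0 bc_norm c_norm.
move=> [_ no_b] [_ no_c] [_ no_bc].
by case: norm_bc => [/no_b|/no_c|/no_bc].
Qed.

Lemma hilbMl a b c : a != 0 -> b != 0 -> c != 0 -> hilb (a * b) c = hilb a c * hilb b c.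
Proof. by move=> *; rewrite ![hilb _ c]hilbC hilbMr. Qed.

Lemma hilb_same_val x y D :
  x != 0 -> y != 0 -> v x = v y -> unramified_disc D -> hilb x D = hilb y D.
Proof.
move=> x0 y0 vxy D_unram; have D0 := unramified_disc_neq0 D_unram.
have yx0 : y / x != 0 by rewrite mulf_neq0 ?invr_eq0.
have -> : y = x * (y / x) by rewrite mulrC divfK.
rewrite hilbMl // [hilb (y / x) D]hilbC (hilb_unramified_unit D_unram) ?mulr1 //.
by apply/dval_eqP; split; rewrite // vM ?invr_eq0 // vV // vxy subrr mulr0.
Qed.

End HilbertSymbol.

(** * The Hasse invariant *)

Section HasseInvariant.

Implicit Types (x y A B : F) (s t : seq F).

Fixpoint hasse s : int := if s is x :: r then (\prod_(y <- r) hilb x y) * hasse r else 1.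

Lemma hasse_perm s t : perm_eq s t -> hasse s = hasse t.
Proof.
apply: perm_eq_invariant => [x {}s {}t|x {}s {}t st /= ->]; last by rewrite (perm_big _ st).
elim: s => //= y s ->; rewrite /= !big_cat /= !big_cons !big_cat /= (hilbC y x).
by ring.
Qed.

Lemma hilb_prod x s : x != 0 -> all (predC1 0) s ->
  \prod_(y <- s) hilb x y = hilb x (\prod_(y <- s) y).
Proof.
move=> x0; elim: s => [_|y s IH /= /andP[y0 s0]].
  rewrite !big_nil; apply/esym/(hilbP x0 (oner_neq0 F)).
  by have := is_norm_sqr x 1; rewrite expr1n.
by rewrite !big_cons IH // hilbMr // prodf_seq_neq0.
Qed.

Lemma hasse_cons x s : x != 0 -> all (predC1 0) s ->
  hasse (x :: s) = hilb x (\prod_(y <- s) y) * hasse s.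
Proof. by move=> x0 s0; rewrite /= hilb_prod. Qed.

Lemma hilb_represented A B : A != 0 -> B != 0 -> A + B != 0 ->
  hilb (A + B) (A * B * (A + B)) = hilb A B.
Proof.
move=> A0 B0 N0; have AN0 : A * (A + B) != 0 by rewrite mulf_neq0.
have BN0 : B * (A + B) != 0 by rewrite mulf_neq0.
have : hilb (A * (A + B)) (B * (A + B)) = 1.
  by apply/(hilbP AN0 BN0); exists (A + B), 1; ring.
rewrite hilbMl // !hilbMr ?mulf_neq0 // [hilb A (A + B)]hilbC.
move: (hilb_sign A B) (hilb_sign (A + B) A) (hilb_sign (A + B) B) (hilb_sign (A + B) (A + B)).
by do 4![case=> ->].
Qed.

Lemma hasse_represented q1 q2 c1 c2 s (N := c1 ^+ 2 * q1 + c2 ^+ 2 * q2) :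
  q1 != 0 -> q2 != 0 -> c1 != 0 -> c2 != 0 -> N != 0 -> all (predC1 0) s ->
  hasse [:: N, q1 * q2 * N & s] = hasse [:: q1, q2 & s].
Proof.
move=> q1_0 q2_0 c1_0 c2_0 N0 s0.
have prod_s0 : \prod_(y <- s) y != 0 by rewrite prodf_seq_neq0.
have qN0 : q1 * q2 * N != 0 by rewrite !mulf_neq0.
rewrite !hasse_cons //=; try by rewrite ?qN0 ?q2_0.
rewrite !big_cons !(hilbMr _ _ prod_s0) //.
have -> : hilb N (q1 * q2 * N) = hilb q1 q2.
  have q1c : sq_equiv (c1 ^+ 2 * q1) q1 by exists c1; rewrite // mulrC.
  have q2c : sq_equiv (c2 ^+ 2 * q2) q2 by exists c2; rewrite // mulrC.
  have [A0 B0] : c1 ^+ 2 * q1 != 0 /\ c2 ^+ 2 * q2 != 0 by rewrite !mulf_neq0 ?expf_neq0.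
  rewrite -(hilb_equivr N0 _ (sq_equivM (sq_equivM q1c q2c) (sq_equiv_refl N))) ?mulf_neq0 //.
  by rewrite hilb_represented // (hilb_equivl A0 B0 q1c) (hilb_equivr q1_0 B0 q2c).
rewrite -!mulrA; congr (_ * _); rewrite !mulrA; congr (_ * _).
rewrite -!hilbMl //; apply: hilb_equivl; rewrite ?mulf_neq0 //.
by exists N => //; ring.
Qed.

End HasseInvariant.

Section OrthogonalSystems.

Variables (V : lmodType F) (b : {biscalar V}).
Hypothesis bC : forall x y, b x y = b y x.
Implicit Types (X Y Z : seq V) (u w x y z : V).

Definition norms X := [seq b x x | x <- X].

Definition orthogonal_sys X :=
  pairwise (fun x y => b x y == 0) X && all (fun x => b x x != 0) X.

(* For an orthogonal system this is membership in the linear span. *)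
Definition in_span X u : Prop := u = \sum_(y <- X) (b u y / b y y) *: y.

Definition basis_equiv X Y : Prop :=
  [/\ size Y = size X, orthogonal_sys Y, hasse (norms Y) = hasse (norms X),
      sq_equiv (\prod_(q <- norms Y) q) (\prod_(q <- norms X) q) &
      forall u, in_span X u -> in_span Y u].

Lemma orthogonal_sys_cons x X : orthogonal_sys (x :: X) =
  [&& b x x != 0, all (fun y => b x y == 0) X & orthogonal_sys X].
Proof. by rewrite /orthogonal_sys /= andbCA -!andbA. Qed.

Lemma orthogonal_sys_norms X : orthogonal_sys X -> all (predC1 0) (norms X).
Proof. by case/andP; rewrite all_map. Qed.

Lemma orthogonal_sys_perm X Y : perm_eq X Y -> orthogonal_sys X -> orthogonal_sys Y.
Proof.
move=> XY; rewrite /orthogonal_sys (perm_all _ XY) (perm_pairwise _ XY) //.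
by move=> x y; rewrite bC.
Qed.

Lemma in_span_norm X u : in_span X u -> b u u = \sum_(y <- X) b u y ^+ 2 / b y y.
Proof.
move=> uE; rewrite {1}uE linear_sumlz; apply: eq_bigr => y _.
by rewrite linearZl_LR [b y u]bC expr2 mulrAC.
Qed.

Lemma basis_equiv_trans Y X Z : basis_equiv X Y -> basis_equiv Y Z -> basis_equiv X Z.
Proof.
move=> [size_Y _ hasse_Y det_Y span_Y] [size_Z oZ hasse_Z det_Z span_Z].
split=> //; rewrite ?size_Z ?hasse_Z //; first exact: sq_equiv_trans det_Z det_Y.
by move=> u /span_Y/span_Z.
Qed.

Lemma basis_equiv_perm X Y : orthogonal_sys X -> perm_eq X Y -> basis_equiv X Y.
Proof.
move=> oX XY; have nXY := perm_map (fun x => b x x) XY; split.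
- by rewrite (perm_size XY).
- exact: orthogonal_sys_perm XY oX.
- by rewrite (hasse_perm nXY).
- by rewrite (perm_big _ nXY); apply: sq_equiv_refl.
by move=> u; rewrite /in_span => {1}->; apply: perm_big.
Qed.

Lemma basis_equiv_scale (c : F) x X :
  c != 0 -> orthogonal_sys (x :: X) -> basis_equiv (x :: X) (c *: x :: X).
Proof.
move=> c0 oxX; move: (oxX); rewrite orthogonal_sys_cons => /and3P[x0 xX oX].
have nE : b (c *: x) (c *: x) = b x x * c ^+ 2 by rewrite linearZl_LR linearZr_LR; ring.
have nx : sq_equiv (b (c *: x) (c *: x)) (b x x) by exists c.
have cx0 : b (c *: x) (c *: x) != 0 by rewrite (sq_equiv_neq0 nx).
have nX := orthogonal_sys_norms oX; split=> //.
- rewrite orthogonal_sys_cons oX andbT cx0; apply/allP => y /(allP xX)/eqP xy0.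
  by rewrite linearZl_LR xy0 mulr0.
- by rewrite /norms ![[seq _ | _ <- _ :: _]]/= !hasse_cons // (hilb_equivl _ _ nx) // prodf_seq_neq0.
- by rewrite /norms /= !big_cons; apply: sq_equivM (sq_equiv_refl _).
move=> u uE; rewrite /in_span {1}uE !big_cons; congr (_ + _).
rewrite nE linearZr_LR scalerA; congr (_ *: _).
by field; rewrite c0 x0.
Qed.

(* The line through the projection of [u] to the plane of [y1] and [y2], and its complement *)
Lemma basis_equiv_rotate u y1 y2 X : orthogonal_sys [:: y1, y2 & X] ->
  b u y1 != 0 -> b u y2 != 0 -> b u y1 ^+ 2 / b y1 y1 + b u y2 ^+ 2 / b y2 y2 != 0 ->
  exists z1 z2, b u z2 = 0 /\ basis_equiv [:: y1, y2 & X] [:: z1, z2 & X].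
Proof.
rewrite !orthogonal_sys_cons => /and3P[q1_0 /andP[/eqP y12 y1X] /and3P[q2_0 y2X oX]] uy1 uy2.
set q1 := b y1 y1 in q1_0 *; set q2 := b y2 y2 in q2_0 *.
pose c1 := b u y1 / q1; pose c2 := b u y2 / q2; pose N := c1 ^+ 2 * q1 + c2 ^+ 2 * q2.
have -> : b u y1 ^+ 2 / q1 + b u y2 ^+ 2 / q2 = N by rewrite /N /c1 /c2; field; rewrite q1_0 q2_0.
have [c1_0 c2_0] : c1 != 0 /\ c2 != 0 by rewrite !mulf_neq0 ?invr_eq0.
move=> N0; pose z1 := c1 *: y1 + c2 *: y2; pose z2 := (c2 * q2) *: y1 - (c1 * q1) *: y2.
have n1 : b z1 z1 = N by rewrite /z1 !bilinE [b y2 y1]bC y12 /N -/q1 -/q2; ring.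
have n2 : b z2 z2 = q1 * q2 * N by rewrite /z2 !bilinE [b y2 y1]bC y12 /N -/q1 -/q2; ring.
have z12 : b z1 z2 = 0 by rewrite /z1 /z2 !bilinE [b y2 y1]bC y12 -/q1 -/q2; ring.
have zX y : y \in X -> b z1 y == 0 /\ b z2 y == 0.
  move=> yX; rewrite /z1 /z2 !bilinE (eqP (allP y1X y yX)) (eqP (allP y2X y yX)).
  by rewrite !mulr0 addr0 subrr.
have nX := orthogonal_sys_norms oX.
exists z1, z2; split; first by rewrite /z2 !bilinE /c1 /c2; field; rewrite q1_0 q2_0.
split=> //.
- rewrite !orthogonal_sys_cons oX n1 n2 N0 !mulf_neq0 //= z12 eqxx andbT.
  by apply/andP; split; apply/allP => y /zX[].
- by rewrite /norms /= n1 n2; apply: hasse_represented.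
- by rewrite /norms /= n1 n2 !big_cons -/q1 -/q2; exists N => //; ring.
move=> w wE; rewrite /in_span {1}wE !big_cons !addrA; congr (_ + _).
rewrite n1 n2 -/q1 -/q2 {2}/z1 {2}/z2 scalerDr scalerBr !scalerA addrACA -scalerDl -scalerBl.
by rewrite /z1 /z2 !bilinE; congr (_ *: _ + _ *: _); move: N0; rewrite /N => N0; field;
  rewrite q1_0 q2_0 N0.
Qed.

Lemma anisotropic_pair u X : orthogonal_sys X -> in_span X u -> b u u != 0 ->
  (1 < count (fun y => b u y != 0%R) X)%N ->
  exists y1 y2 Y, [/\ perm_eq X [:: y1, y2 & Y], b u y1 != 0, b u y2 != 0 &
    b u y1 ^+ 2 / b y1 y1 + b u y2 ^+ 2 / b y2 y2 != 0].
Proof.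
pose Q y := b u y ^+ 2 / b y y; pose nonorth y := b u y != 0.
have extract Y : has nonorth Y -> exists y Y', nonorth y /\ perm_eq Y (y :: Y').
  by move=> /hasP[y yY uy]; exists y, (rem y Y); split=> //; apply: perm_to_rem.
move=> oX uX u0 two_nonorth.
have [|y1 [X1 [uy1 XE1]]] := extract X; first by rewrite has_count ltnW.
have [|y2 [X2 [uy2 XE2]]] := extract X1.
  by move: two_nonorth; rewrite has_count (permP XE1) /= -/(nonorth y1) uy1.
have XE : perm_eq X [:: y1, y2 & X2] by apply: perm_trans XE1 _; rewrite perm_cons.
have [Q12|] := eqVneq (Q y1 + Q y2) 0; last by exists y1, y2, X2.
have [|y3 [X3 [uy3 XE3]]] := extract X2.
  apply: contraNT u0 => /hasPn orth_X2.
  rewrite (in_span_norm uX) (perm_big _ XE) /= !big_cons addrA -/(Q y1) -/(Q y2) Q12 add0r.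
  by rewrite big_seq big1 // => y /orth_X2; rewrite negbK => /eqP->; rewrite expr0n mul0r.
have {}XE : perm_eq X [:: y1, y2, y3 & X3] by apply: perm_trans XE _; rewrite !perm_cons.
have [Q13|] := eqVneq (Q y1 + Q y3) 0; last first.
  exists y1, y3, (y2 :: X3); split=> //; apply: perm_trans XE _; rewrite perm_cons.
  exact/permPl/(perm_catCA [:: y2] [:: y3]).
exists y2, y3, (y1 :: X3); split=> //; first exact/(perm_trans XE)/permPl/(perm_catCA [:: y1] [:: y2; y3]).
apply/eqP => Q23; have : 2 * Q y1 == 0.
  have -> : 2 * Q y1 = (Q y1 + Q y2) + (Q y1 + Q y3) - (Q y2 + Q y3) by ring.
  by rewrite Q12 Q13 [Q y2 + Q y3]Q23 subr0 addr0.
have y1_0 : b y1 y1 != 0.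
  by have := orthogonal_sys_perm XE oX; rewrite orthogonal_sys_cons => /and3P[].
by rewrite /Q !mulf_eq0 invr_eq0 (negPf two_neq0) (negPf y1_0) (negPf uy1).
Qed.

Lemma basis_equiv_extend u X : orthogonal_sys X -> in_span X u -> b u u != 0 ->
  exists Y, basis_equiv X (u :: Y).
Proof.
have [n] := ubnP (count (fun y => b u y != 0%R) X); elim: n X => // n IH X cnt oX uX u0.
have [many|few] := ltnP 1 (count (fun y => b u y != 0%R) X).
  have [y1 [y2 [Y [XE uy1 uy2 N0]]]] := anisotropic_pair oX uX u0 many.
  have eqX := basis_equiv_perm oX XE; have [_ oY _ _ spanY] := eqX.
  have [z1 [z2 [uz2 eqZ]]] := basis_equiv_rotate oY uy1 uy2 N0.
  have [_ oZ _ _ spanZ] := eqZ; have eqXZ := basis_equiv_trans eqX eqZ.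
  have [|Z eqU] := IH [:: z1, z2 & Y] _ oZ (spanZ _ (spanY _ uX)) u0.
    by move: cnt; rewrite (permP XE) /= uz2 eqxx uy1 uy2; case: (b u z1 != 0) => /=; clear; lia.
  by exists Z; apply: basis_equiv_trans eqXZ eqU.
have [y y_X uy] : exists2 y, y \in X & b u y != 0.
  apply/hasP; apply: contraNT u0 => /hasPn orth_X; rewrite (in_span_norm uX) big_seq big1 // => y.
  by move/orth_X; rewrite negbK => /eqP->; rewrite expr0n mul0r.
have XE := perm_to_rem y_X; set Y := rem y X in XE; have eqX := basis_equiv_perm oX XE.
have [_ oY _ _ spanY] := eqX.
have uE : u = (b u y / b y y) *: y.
  rewrite {1}(spanY u uX) big_cons big_seq big1 ?addr0 // => z zY.
  have /eqP-> : b u z == 0; last by rewrite mul0r scale0r.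
  apply: contraTT few => uz; rewrite -ltnNge (permP XE) /= uy add1n ltnS -has_count.
  by apply/hasP; exists z.
have c0 : b u y / b y y != 0.
  move: oY; rewrite orthogonal_sys_cons => /and3P[y0 _ _].
  by rewrite mulf_neq0 ?invr_eq0.
by exists Y; rewrite uE; apply: basis_equiv_trans eqX (basis_equiv_scale c0 oY).
Qed.

Lemma hasse_basis X Y : size X = size Y -> orthogonal_sys X -> orthogonal_sys Y ->
  (forall y, y \in Y -> in_span X y) -> hasse (norms X) = hasse (norms Y) /\
  sq_equiv (\prod_(q <- norms X) q) (\prod_(q <- norms Y) q).
Proof.
elim: Y X => [|y Y IH] X szX oX; first by rewrite (size0nil szX); split=> //; apply: sq_equiv_refl.
rewrite orthogonal_sys_cons => /and3P[y0 yY oY] spanXY.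
have [X' [szX' oyX' hasse_yX' det_yX' spanX']] := basis_equiv_extend oX (spanXY y (mem_head _ _)) y0.
move: (oyX'); rewrite orthogonal_sys_cons => /and3P[_ yX' oX'].
have [hasse_X'Y det_X'Y] : hasse (norms X') = hasse (norms Y) /\
    sq_equiv (\prod_(q <- norms X') q) (\prod_(q <- norms Y) q).
  apply: IH => // [|z zY]; first by move: szX'; rewrite szX /= => -[].
  have := spanX' z (spanXY z _); rewrite inE zY orbT => /(_ isT).
  by rewrite /in_span big_cons bC (eqP (allP yY z zY)) mul0r scale0r add0r.
have [nX' nY] := (orthogonal_sys_norms oX', orthogonal_sys_norms oY).
split.
  rewrite -hasse_yX' /norms ![[seq _ | _ <- _ :: _]]/= !hasse_cons // -/(norms _) -/(norms Y) hasse_X'Y.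
  by rewrite (hilb_equivr y0 _ det_X'Y) // prodf_seq_neq0.
apply: sq_equiv_trans (sq_equiv_sym det_yX') _.
by rewrite /norms /= !big_cons; apply: sq_equivM (sq_equiv_refl _) det_X'Y.
Qed.

End OrthogonalSystems.

Section MatrixForms.

Variable m : nat.
Implicit Types (M X : 'M[F]_m) (d : 'rV[F]_m).

Definition matrix_form M (x y : 'cV[F]_m) : F := (x^T *m M *m y) 0 0.

Fact matrix_form_bilinear M : bilinear_for *%R *%R (matrix_form M).
Proof.
split=> [y c x z|x c y z]; rewrite /matrix_form.
  by rewrite linearP /= !mulmxDl -!scalemxAl !mxE.
by rewrite mulmxDr -scalemxAr !mxE.
Qed.

HB.instance Definition _ M :=
  bilinear_isBilinear.Build F _ _ _ _ _ (matrix_form M) (matrix_form_bilinear M).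

Lemma matrix_formC M : M^T = M -> forall x y, matrix_form M x y = matrix_form M y x.
Proof.
move=> symM x y; rewrite /matrix_form -[in LHS](trmxK (x^T *m M *m y)) [LHS]mxE.
by rewrite !trmx_mul symM trmxK mulmxA.
Qed.

Lemma matrix_form_col M X i j : matrix_form M (col i X) (col j X) = (X^T *m M *m X) i j.
Proof.
rewrite /matrix_form !colE trmx_mul trmx_delta !mulmxA -[_ *m X *m _]mulmxA.
by rewrite -!mulmxA -rowE !mulmxA -colE !mxE.
Qed.

Lemma congruent_sym M X N : X \in unitmx -> X^T *m M *m X = N -> N^T = N -> M^T = M.
Proof.
move=> X_unit NE symN; have XT_unit : X^T \in unitmx by rewrite unitmx_tr.
have -> : M = invmx X^T *m N *m invmx X by rewrite -NE !mulmxA mulVmx // mul1mx mulmxK.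
by rewrite !trmx_mul symN !trmx_inv trmxK mulmxA.
Qed.

Lemma det_congruent M X : \det (X^T *m M *m X) = \det X ^+ 2 * \det M.
Proof. by rewrite !det_mulmx det_tr; ring. Qed.

Lemma congruent_det_sq_equiv M N X : X^T *m M *m X = N -> \det N != 0 ->
  \det X != 0 /\ sq_equiv (\det N) (\det M).
Proof.
move=> <-; rewrite det_congruent mulf_eq0 negb_or expf_eq0 /= => /andP[X0 _].
by split=> //; exists (\det X); rewrite // mulrC.
Qed.

Lemma hasse_pairwise (g : 'I_m -> F) s : pairwise (fun i j : 'I_m => (i < j)%N) s ->
  hasse (map g s) = \prod_(i <- s) \prod_(j <- s | (i < j)%N) hilb (g i) (g j).
Proof.
elim: s => [|x s IH]; first by rewrite big_nil.
rewrite pairwise_cons => /andP[/allP x_min lt_s]; rewrite /= IH // !big_cons ltnn; congr (_ * _).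
  rewrite big_map big_seq [RHS]big_seq_cond; apply: eq_bigl => j.
  by case: (boolP (j \in s)) => // /x_min ->.
rewrite big_seq [RHS]big_seq; apply: eq_bigr => i /x_min lt_xi.
by rewrite big_cons ltnNge (ltnW lt_xi).
Qed.

Lemma hasse_row d : hasse [seq d 0 i | i <- enum 'I_m] =
  \prod_(i < m) \prod_(j < m | (i < j)%N) hilb (d 0 i) (d 0 j).
Proof.
rewrite hasse_pairwise; last first.
  have := iota_ltn_sorted 0 m; rewrite (sorted_pairwise ltn_trans) -val_enum_ord pairwise_map.
  by [].
by rewrite big_enum; apply: eq_bigr => i _; apply: big_enum_cond.
Qed.

Definition cols X := [seq col i X | i <- enum 'I_m].

Lemma norms_cols M X d : X^T *m M *m X = diag_mx d ->
  norms (matrix_form M) (cols X) = [seq d 0 i | i <- enum 'I_m].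
Proof.
move=> diagX; rewrite /norms -map_comp; apply: eq_map => i /=.
by rewrite matrix_form_col diagX mxE eqxx mulr1n.
Qed.

Lemma orthogonal_cols M X d : X^T *m M *m X = diag_mx d -> (forall i, d 0 i != 0) ->
  orthogonal_sys (matrix_form M) (cols X).
Proof.
move=> diagX d0; have gramE i j : matrix_form M (col i X) (col j X) = d 0 i *+ (i == j).
  by rewrite matrix_form_col diagX mxE.
apply/andP; split; last by apply/allP => _ /mapP[i _ ->]; rewrite /= gramE eqxx mulr1n.
rewrite pairwise_map; apply: sub_pairwise (_ : pairwise [rel i j | i != j] (enum 'I_m)).
  by move=> i j /= /negPf ij; rewrite gramE ij mulr0n.
by rewrite -uniq_pairwise enum_uniq.
Qed.

Lemma in_span_cols M X d x : X \in unitmx -> X^T *m M *m X = diag_mx d ->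
  (forall i, d 0 i != 0) -> in_span (matrix_form M) (cols X) x.
Proof.
move=> X_unit diagX d0; rewrite /in_span big_map big_enum /=.
pose y := invmx X *m x; have xE : x = \sum_i y i 0 *: col i X.
  apply/colP => k; rewrite -{1}(mulKVmx X_unit x) mxE summxE; apply: eq_bigr => i _.
  by rewrite !mxE mulrC.
have gramE i j : matrix_form M (col i X) (col j X) = d 0 i *+ (i == j).
  by rewrite matrix_form_col diagX mxE.
rewrite {1}xE; apply: eq_bigr => i _; congr (_ *: _).
rewrite xE linear_sumlz (bigD1 i) //= big1 => [|j /negPf ji].
  by rewrite linearZl_LR /= !gramE eqxx mulr1n addr0 mulfK.
by rewrite linearZl_LR /= gramE ji mulr0n mulr0.
Qed.

Lemma eta_diagonalized M X d : X \in unitmx -> X^T *m M *m X = diag_mx d ->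
  (forall i, d 0 i != 0) -> Defs.eta M = eta_diag (\det M) d.
Proof.
move=> X_unit diagX d0; have symM := congruent_sym X_unit diagX (tr_diag_mx d).
rewrite /Defs.eta; set is_diag := fun _ => _; set d' := classical_sets.xget _ _.
have [Y [Y_unit diagY]] : is_diag d'.
  exact: (@classical_sets.xgetPex _ 0 is_diag (ex_intro _ d (ex_intro _ X (conj X_unit diagX)))).
have detE (Z : 'M[F]_m) (e : 'rV[F]_m) :
    Z^T *m M *m Z = diag_mx e -> \prod_i e 0 i = \det Z ^+ 2 * \det M.
  by move=> diagZ; rewrite -det_diag -diagZ det_congruent.
have d'0 i : d' 0 i != 0.
  suff /prodf_neq0/(_ i isT) : \prod_i d' 0 i != 0 by [].
  have /prodf_neq0 : forall i, true -> d 0 i != 0 by [].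
  rewrite (detE X d diagX) (detE Y d' diagY) !mulf_eq0 !negb_or => /andP[_ ->].
  by rewrite -unitfE -unitmxE Y_unit.
rewrite /eta_diag; congr (_ * _); rewrite -!hasse_row -(norms_cols diagX) -(norms_cols diagY).
have [|||| -> _] // := @hasse_basis _ (matrix_form M) (matrix_formC symM) (cols Y) (cols X).
- by rewrite !size_map.
- exact: orthogonal_cols diagY d'0.
- exact: orthogonal_cols diagX d0.
by move=> x _; apply: in_span_cols Y_unit diagY d'0.
Qed.

End MatrixForms.

(** * Uniqueness of the Gross-Keating invariant *)

Lemma dval_ge_prod (I : Type) (r : seq I) (x : I -> F) (k : I -> int) :
  (forall i, dval_ge (x i) (k i)) -> dval_ge (\prod_(i <- r) x i) (\sum_(i <- r) k i).
Proof.
move=> x_ge; elim: r => [|i r IH]; first by rewrite !big_nil dval_ge1.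
by rewrite !big_cons; apply: dval_geM.
Qed.

Lemma dval_ge_sign k : dval_ge ((-1) ^+ k) 0.
Proof. by rewrite -signr_odd; case: (odd k); rewrite ?expr1 ?expr0 ?dval_geN; apply: dval_ge1. Qed.

Lemma dval_ge_det n (U : 'M[F]_n) (f g : 'I_n -> int) : (forall i j, dval_ge (U i j) (f i + g j)) ->
  dval_ge (\det U) (\sum_i f i + \sum_j g j).
Proof.
move=> U_ge; rewrite /determinant; apply: dval_ge_sum => // s _.
apply: (dval_geM_le (l := \sum_i (f i + g (perm.fun_of_perm s i)))) (dval_ge_sign _) _ _.
  exact: dval_ge_prod.
by rewrite add0r big_split /= lerD2l [leLHS](reindex_inj (@perm.perm_inj _ s)).
Qed.

Lemma dval_ge_invmx n (U : 'M[F]_n) (c : 'I_n -> int) : U \in unitmx -> dval_eq (\det U) 0 ->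
  (forall i j, dval_ge (U i j) (c j - c i)) -> forall i j, dval_ge (invmx U i j) (c j - c i).
Proof.
move=> U_unit detU U_ge i j; rewrite /invmx U_unit mxE [\adj U i j]mxE /cofactor.
have detV_ge : dval_ge (\det U)^-1 0 by apply: dval_eq_ge (dval_eqV detU) _; rewrite oppr0.
suff minor_ge : dval_ge (\det (row' j (col' i U))) (c j - c i).
  apply: dval_geM_le detV_ge (dval_geM_le (dval_ge_sign _) minor_ge (lexx _)) _.
  by rewrite !add0r.
have row_sum : \sum_k - c (lift j k) = c j - \sum_k c k.
  by rewrite sumrN [\sum_k c k](bigD1_ord j) //= opprD addrA subrr add0r.
have col_sum : \sum_k c (lift i k) = \sum_k c k - c i.
  by rewrite [in RHS](bigD1_ord i) //= addrAC subrr add0r.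
have -> : c j - c i = \sum_k - c (lift j k) + \sum_k c (lift i k).
  by rewrite row_sum col_sum addrA subrK.
by apply: dval_ge_det => k l; rewrite !mxE addrC; apply: U_ge.
Qed.

Lemma dval_ge_det_block n (U : 'M[F]_n) p : (p < n)%N -> (forall i j, dval_ge (U i j) 0) ->
  (forall i j : 'I_n, (i <= p)%N -> (p <= j)%N -> dval_ge (U i j) 2) -> dval_ge (\det U) 2.
Proof.
move=> pn U_int U_block.
have sum_const c q : (q <= n)%N -> \sum_(i < n) (if (i < q)%N then c else 0 : int) = c * q%:Z.
  move=> qn; rewrite -big_mkcond -(big_ord_widen n (fun=> c)) // sumr_const card_ord.
  by rewrite -[LHS]mulr_natr; congr (_ * _); rewrite natz.
have -> : 2 = \sum_(i < n) (if (i < p.+1)%N then 2 else 0 : int) +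
              \sum_(j < n) (if (j < p)%N then -2 else 0 : int).
  by rewrite (sum_const 2 p.+1 pn) (sum_const (-2) p (ltnW pn)); clear; lia.
apply: dval_ge_det => i j; rewrite ltnS; case: leqP => ip; case: ltnP => jp.
- by rewrite subrr.
- by rewrite addr0; apply: U_block.
- exact: dval_ge_le (U_int i j) _.
exact: U_int.
Qed.

Lemma GLoP n (U : 'M[F]_n) :
  reflect (dval_eq (\det U) 0 /\ forall i j, dval_ge (U i j) 0) (GLo v U).
Proof.
apply: (iffP andP) => [[/forallP U_int]|[detU U_int]]; rewrite unit_oE.
  by move=> detU; split=> // i j; have /forallP/(_ j) := U_int i; rewrite -integersE.
by split=> //; apply/forallP => i; apply/forallP => j; have := U_int i j; rewrite -integersE.
Qed.

Lemma GLo_unitmx n (U : 'M[F]_n) : GLo v U -> U \in unitmx.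
Proof. by case/GLoP => detU _; rewrite unitmxE unitfE (dval_eq_neq0 detU). Qed.

Lemma GLo1 n : GLo v (1%:M : 'M[F]_n).
Proof.
apply/GLoP; split=> [|i j]; first by rewrite det1 dval_eq1.
by rewrite mxE; case: (i == j); rewrite ?mulr1n ?mulr0n ?dval_ge0 ?dval_ge1.
Qed.

Lemma GLo_mul n (U W : 'M[F]_n) : GLo v U -> GLo v W -> GLo v (U *m W).
Proof.
move=> /GLoP[detU U_int] /GLoP[detW W_int]; apply/GLoP; split.
  by rewrite det_mulmx; apply: (dval_eq_cast (dval_eqM detU detW)).
by move=> i j; rewrite mxE; apply: dval_ge_sum => k _; apply: (dval_geM_le (U_int _ _) (W_int _ _)).
Qed.

Lemma GLo_inv n (U : 'M[F]_n) : GLo v U -> GLo v (invmx U).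
Proof.
move=> U_GL; have /GLoP[detU U_int] := U_GL; apply/GLoP; split.
  by rewrite det_inv; have := dval_eqV detU; rewrite oppr0.
move=> i j; have := @dval_ge_invmx _ U (fun=> 0) (GLo_unitmx U_GL) detU; rewrite /= subrr.
exact.
Qed.

Lemma inSU_sim n (M N : 'M[F]_n) : sim v M N -> inSU v M = inSU v N.
Proof.
move=> [U [U_GL ->]]; have U_unit := GLo_unitmx U_GL.
apply/funext => a; apply/propext; split=> -[W [W_GL Wa]]; last first.
  by exists (U *m W); split; [apply: GLo_mul | rewrite trmx_mul !mulmxA in Wa *].
exists (invmx U *m W); split; first exact: GLo_mul (GLo_inv U_GL) W_GL.
rewrite trmx_mul trmx_inv; have -> // : W^T *m invmx U^T *m (U^T *m M *m U) *m (invmx U *m W) = W^T *m M *m W.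
by rewrite !mulmxA mulmxK // mulmxKV ?unitmx_tr.
Qed.

Lemma GK_sim n (M N : 'M[F]_n) : sim v M N -> GK v M = GK v N.
Proof. by move=> MN; rewrite /GK (inSU_sim MN). Qed.

Lemma inS_offdiag n (M : 'M[F]_n) a i j : M^T = M -> inS v M a ->
  dval_ge (2 * M i j) ((nth 0%N a i)%:Z + (nth 0%N a j)%:Z).
Proof.
move=> symM [_ _ _ off_ge]; case: (leqP i j) => ij; first by have := off_ge i j ij; rewrite PoszD.
have -> : M i j = M j i by rewrite -{1}symM mxE.
by have := off_ge j i (ltnW ij); rewrite PoszD addrC.
Qed.

(* The integral vectors whose [i]-th coordinate has valuation at least [(m - a_i) / 2] *)
Definition in_level n (a : seq nat) (m : nat) (x : 'cV[F]_n) : Prop :=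
  forall i : 'I_n, dval_ge (x i 0) (m%:Z - (nth 0%N a i)%:Z) && dval_ge (x i 0) 0.

(* The quadratic form induced on each graded piece [in_level a m / in_level a m.+1] has trivial
   radical; for a form in [inS v A a] this makes the filtration intrinsic. *)
Definition graded_nonsingular n (A : 'M[F]_n) (a : seq nat) : Prop :=
  forall (m : nat) x, in_level a m x -> dval_ge (matrix_form A x x) (2 * m%:Z + 2) ->
    (forall y, in_level a m y -> dval_ge (2 * matrix_form A x y) (2 * m%:Z + 2)) -> in_level a m.+1 x.

Section ChangeOfBasis.

Variables (n : nat) (A U : 'M[F]_n) (a a' : seq nat).
Hypotheses (symA : A^T = A) (A_nonsing : graded_nonsingular A a) (U_GL : GLo v U).
Hypothesis UAU_a' : inS v (U^T *m A *m U) a'.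

Local Notation trunc a m i := (minn (nth 0%N a i) m).
Local Notation truncs_agree m := (forall i, (i < n)%N -> trunc a m i = trunc a' m i).
Local Notation columns_in_level m :=
  (forall i j : 'I_n, dval_ge (U i j) ((trunc a m j)%:Z - (nth 0%N a i)%:Z)).

Lemma invmx_in_level m y : columns_in_level m -> in_level a m y ->
  forall l, dval_ge ((invmx U *m y) l 0) (m%:Z - (trunc a m l)%:Z).
Proof.
move=> U_level y_level l; have /GLoP[detU U_int] := U_GL.
have U_trunc i j : dval_ge (U i j) ((trunc a m j)%:Z - (trunc a m i)%:Z).
  case: (leqP (nth 0%N a i) m) => ai; first exact: U_level.
  apply: dval_ge_le (U_int i j) _.
  by have := geq_minr (nth 0%N a j) m; clear; lia.
have V_trunc := dval_ge_invmx (c := fun i => trunc a m i) (GLo_unitmx U_GL) detU U_trunc.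
rewrite mxE; apply: dval_ge_sum => // k _.
apply: (dval_geM_le (V_trunc l k) (l := m%:Z - (trunc a m k)%:Z)); last by clear; lia.
have /andP[yk yk_int] := y_level k.
case: (leqP (nth 0%N a k) m) => ak //.
by rewrite subrr.
Qed.

Lemma column_form_level m (j : 'I_n) y : truncs_agree m -> columns_in_level m ->
  (m < nth 0%N a' j)%N -> in_level a m y -> dval_ge (2 * matrix_form A (col j U) y) (2 * m%:Z + 2).
Proof.
move=> agree_m U_level lt_mj y_level; have U_unit := GLo_unitmx U_GL.
have symUAU : (U^T *m A *m U)^T = U^T *m A *m U by rewrite !trmx_mul trmxK symA mulmxA.
have -> : matrix_form A (col j U) y = \sum_l (U^T *m A *m U) j l * (invmx U *m y) l 0.
  transitivity ((row j (U^T *m A *m U) *m (invmx U *m y)) 0 0).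
    by rewrite mulmxA -row_mul mulmxK // row_mul -tr_col.
  by rewrite mxE; apply: eq_bigr => l _; rewrite mxE.
rewrite mulr_sumr; apply: dval_ge_sum => // l _; rewrite mulrA.
have y_l := invmx_in_level U_level y_level l.
apply: (dval_ge_even (dval_geM (inS_offdiag j l symUAU UAU_a') y_l)) => z.
have := agree_m l (ltn_ord l); have := geq_minl (nth 0%N a' l) m.
by move: (trunc a m l) (trunc a' m l) (nth _ _ _) (nth _ _ _) lt_mj; clear; lia.
Qed.

Lemma column_in_next_level m (j : 'I_n) : truncs_agree m -> columns_in_level m ->
  (m < nth 0%N a' j)%N -> in_level a m.+1 (col j U).
Proof.
move=> agree_m U_level lt_mj; have /GLoP[_ U_int] := U_GL.
apply: A_nonsing => [i||y].
- rewrite mxE U_int andbT; have := U_level i j.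
  by rewrite agree_m // (minn_idPr (ltnW lt_mj)).
- rewrite matrix_form_col; have [_ _ diag_ge _] := UAU_a'.
  by have := diag_ge j; rewrite vgeE => /dval_ge_le; apply; move: lt_mj; clear; lia.
exact: column_form_level.
Qed.

Lemma truncs_agree_columns m : (forall m', (m' <= m)%N -> truncs_agree m') -> columns_in_level m.
Proof.
elim: m => [|m IH] agree i j.
  by have /GLoP[_ U_int] := U_GL; apply: dval_ge_le (U_int i j) _; rewrite minn0; clear; lia.
have U_level := IH (fun m' le_m' => agree m' (leqW le_m')); have agree_m := agree m (leqnSn m).
case: (leqP (nth 0%N a' j) m) => lt_mj; last first.
  have /(_ i)/andP[] := column_in_next_level agree_m U_level lt_mj; rewrite mxE => U_ge _.
  by apply: dval_ge_le U_ge _; have := geq_minr (nth 0%N a j) m.+1; clear; lia.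
apply: dval_ge_le (U_level i j) _; move: lt_mj (agree_m j (ltn_ord j)) (agree m.+1 (leqnn _) j (ltn_ord j)).
by move: (nth 0%N a j) (nth 0%N a' j) (nth 0%N a i); clear; lia.
Qed.

Lemma inS_lexle_max : size a = n -> sorted leq a -> lexle a a' -> a' = a.
Proof.
move=> size_a a_sorted; have [size_a' a'_sorted _ _] := UAU_a'; have /GLoP[detU U_int] := U_GL.
case/lexle_first_diff => [|//|[p [pn eq_before lt_p]]]; first by rewrite size_a.
rewrite size_a in pn; set m := nth 0%N a p in lt_p.
have agree m' : (m' <= m)%N -> truncs_agree m'.
  move=> le_m' i i_n; case: (ltnP i p) => pi; first by rewrite eq_before.
  have a_i : (m <= nth 0%N a i)%N by apply: nth_sorted_leq; rewrite ?size_a.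
  have a'_i : (m < nth 0%N a' i)%N by apply: leq_trans lt_p _; apply: nth_sorted_leq; rewrite ?size_a'.
  by rewrite (minn_idPr (leq_trans le_m' a_i)) (minn_idPr (leq_trans le_m' (ltnW a'_i))).
have U_level := truncs_agree_columns agree.
have /negP[] : ~~ dval_ge (\det U) 2 by rewrite (dval_eq_ltF detU).
apply: (dval_ge_det_block pn U_int) => i j ip pj.
have lt_mj : (m < nth 0%N a' j)%N by apply: leq_trans lt_p (nth_sorted_leq _ pj _); rewrite ?size_a'.
have /(_ i)/andP[] := column_in_next_level (agree m (leqnn m)) U_level lt_mj; rewrite mxE => U_ge _.
have a_i : (nth 0%N a i <= m)%N by apply: nth_sorted_leq; rewrite ?size_a.
by apply: (dval_ge_even U_ge) => z; move: (nth 0%N a i) (m) a_i; clear; lia.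
Qed.

Lemma dval_ge_invmx_inS : size a = n -> a' = a ->
  forall i j, dval_ge (invmx U i j) ((nth 0%N a j)%:Z - (nth 0%N a i)%:Z).
Proof.
move=> size_a a'E; pose m := \max_(x <- a) x; have /GLoP[detU _] := U_GL.
have trunc_max i : (i < n)%N -> trunc a m i = nth 0%N a i.
  move=> i_n; apply/minn_idPl; apply: (@leq_bigmax_seq _ _ xpredT id) => //.
  by rewrite mem_nth // size_a.
apply: (dval_ge_invmx (GLo_unitmx U_GL) detU) => i j; have := @truncs_agree_columns m _ i j.
by rewrite trunc_max //; apply => m' _ k _; rewrite a'E.
Qed.

End ChangeOfBasis.

Lemma GK_eq n (A : 'M[F]_n) a : A^T = A -> inS v A a -> graded_nonsingular A a -> GK v A = a.
Proof.
move=> symA Aa A_nonsing; have [size_a a_sorted _ _] := Aa.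
have inSU_a : inSU v A a by exists 1%:M; rewrite trmx1 mul1mx mulmx1; split=> //; apply: GLo1.
have a_max a' : inSU v A a' -> lexle a' a.
  move=> [U [U_GL UAU_a']]; have [//|/negPf not_le] := boolP (lexle a' a).
  have := lexle_total a' a; rewrite not_le /= => le_aa'.
  have a'E := inS_lexle_max symA A_nonsing U_GL UAU_a' size_a a_sorted le_aa'.
  by move: not_le le_aa'; rewrite a'E => ->.
rewrite /GK; set P := (fun _ => _); have Pa : P a by split.
have [in_GK GK_max] := @classical_sets.xgetPex _ [::] P (ex_intro _ a Pa).
by apply: lexle_anti; [case: (in_GK) => U [_ [-> _ _ _]] | apply: a_max | apply: GK_max].
Qed.

(** * Unramified planes *)

Section UnramifiedPlanes.

Implicit Types (al be ga c r x y : F) (A B : int).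

Definition represents al be ga c : Prop :=
  exists x y, al * x ^+ 2 + 2 * be * x * y + ga * y ^+ 2 = c.

Lemma represents_norm al be ga c :
  al != 0 -> is_norm (be ^+ 2 - al * ga) (al * c) -> represents al be ga c.
Proof.
move=> al0 [s [t cE]]; exists ((s - be * t) / al), t; apply: (mulfI al0).
by rewrite cE; field.
Qed.

Lemma represents_hyperbolic al be ga r c :
  r != 0 -> be ^+ 2 - al * ga = r ^+ 2 -> represents al be ga c.
Proof.
move=> r0 discE; have [al0|al0] := eqVneq al 0; last first.
  by apply: represents_norm => //; rewrite discE; apply: is_norm_of_sqr.
have be0 : be != 0.
  apply: contraNneq r0 => be0; move: discE; rewrite al0 be0 mul0r subr0 expr0n => /esym/eqP.
  by rewrite expf_eq0.
by exists ((c - ga) / (2 * be)), 1; rewrite al0; field; rewrite be0 two_neq0.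
Qed.

Definition unramified_plane al be ga A B : Prop :=
  [/\ dval_ge al (2 * A), dval_ge ga (2 * B) & dval_eq (2 * be) (A + B)].

Lemma unramified_plane_neq0 al be ga A B : unramified_plane al be ga A B -> be != 0.
Proof. by case=> _ _ /dval_eq_neq0; apply: contraNneq => ->; rewrite mulr0. Qed.

Definition plane_modulus al be ga := al * ga / (2 * be) ^+ 2.

Lemma plane_modulus_integers al be ga A B :
  unramified_plane al be ga A B -> plane_modulus al be ga \in integers.
Proof.
case=> alA gaB beAB; rewrite integersE.
by apply: dval_ge_div (dval_geM alA gaB) (dval_eqX 2 beAB) _; clear; lia.
Qed.

Lemma plane_disc_equiv al be ga : be != 0 ->
  sq_equiv (be ^+ 2 - al * ga) (1 - 4 * plane_modulus al be ga).
Proof. by move=> be0; exists be => //; rewrite /plane_modulus; field; rewrite be0 two_neq0. Qed.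

Variables (al be ga al1 be1 ga1 : F) (A B : int).
Hypothesis plane : unramified_plane al be ga A B.
Hypotheses (al_near : dval_ge (al1 - al) (2 * A + 2)) (ga_near : dval_ge (ga1 - ga) (2 * B + 2)).
Hypothesis be_near : dval_ge (2 * be1 - 2 * be) (A + B + 1).

Lemma unramified_plane_near : unramified_plane al1 be1 ga1 A B.
Proof.
case: plane => alA gaB beAB; split.
- by apply: dval_ge_near alA al_near _; clear; lia.
- by apply: dval_ge_near gaB ga_near _; clear; lia.
exact: dval_eq_near beAB be_near.
Qed.

Lemma plane_modulus_near : congr2 (plane_modulus al1 be1 ga1) (plane_modulus al be ga).
Proof.
have [alA gaB beAB] := plane; have be0 := unramified_plane_neq0 plane.
have be1_0 := unramified_plane_neq0 unramified_plane_near.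
have [_ gaB1 be1AB] := unramified_plane_near; have [z zE] := dval_eq_even beAB.
have be_near2 : dval_ge (2 * be1 - 2 * be) (A + B + 2) by apply: dval_ge_even be_near _; clear -zE; lia.
have ratio_near : congr2 ((2 * be1 / (2 * be)) ^+ 2) 1.
  have ratio_1 : congr2 (2 * be1 / (2 * be)) 1.
    rewrite /congr2; have -> : 2 * be1 / (2 * be) - 1 = (2 * be1 - 2 * be) / (2 * be).
      by field; rewrite be0 two_neq0.
    by apply: dval_ge_div be_near2 beAB _; clear; lia.
  have ratio_int : 2 * be1 / (2 * be) \in integers.
    by rewrite integersE; apply: dval_ge_div (dval_eqW be1AB) beAB _; clear; lia.
  by have := congr2M ratio_int _ ratio_1 ratio_1; rewrite -expr2 mulr1 rpred1; apply.
have w1_int := plane_modulus_integers unramified_plane_near.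
have := congr2M w1_int _ (congr2_refl _) ratio_near; rewrite mulr1 rpred1 => /(_ isT).
move=> /congr2_sym/congr2_trans; apply; rewrite /congr2.
have -> : plane_modulus al1 be1 ga1 * (2 * be1 / (2 * be)) ^+ 2 - plane_modulus al be ga =
    ((al1 - al) * ga1 + al * (ga1 - ga)) / (2 * be) ^+ 2.
  by rewrite /plane_modulus; field; rewrite be0 be1_0 two_neq0.
apply: (dval_ge_div (k := 2 * (A + B) + 2) _ (dval_eqX 2 beAB)); last by clear; lia.
by apply: dval_geD; [apply: dval_geM_le al_near gaB1 _ | apply: dval_geM_le alA ga_near _]; clear; lia.
Qed.

Lemma plane_disc_unramified : unramified_disc (be ^+ 2 - al * ga).
Proof.
exists (plane_modulus al be ga); first exact: plane_modulus_integers plane.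
exact: plane_disc_equiv (unramified_plane_neq0 plane).
Qed.

Lemma plane_disc_near : sq_equiv (be1 ^+ 2 - al1 * ga1) (be ^+ 2 - al * ga).
Proof.
apply: sq_equiv_trans (plane_disc_equiv al1 ga1 (unramified_plane_neq0 unramified_plane_near)) _.
apply: sq_equiv_trans (sq_equiv_sym (plane_disc_equiv al ga (unramified_plane_neq0 plane))).
apply: sq_equiv_near; first exact: unit_1B4M (plane_modulus_integers plane).
have -> : 1 - 4 * plane_modulus al1 be1 ga1 - (1 - 4 * plane_modulus al be ga) =
    - (4 * (plane_modulus al1 be1 ga1 - plane_modulus al be ga)) by ring.
by rewrite dval_geN; apply: dval_geM (dval_eqW dval_eq4) plane_modulus_near.
Qed.

(* Hyperbolic planes represent 1; otherwise the modulus is a unit, and so is al / al1 which is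
   therefore a norm. *)
Lemma plane_common_value : exists c, [/\ c != 0, represents al be ga c & represents al1 be1 ga1 c].
Proof.
have disc_neq0 := unramified_disc_neq0 plane_disc_unramified; set D := _ - _ in disc_neq0.
have [[r discE]|not_sqr] := pselect (exists r, D = r ^+ 2).
  have r0 : r != 0 by apply: contraNneq disc_neq0 => r0; rewrite discE r0 expr0n.
  have [s s0 disc1E] := plane_disc_near; exists 1; rewrite oner_eq0; split=> //.
    exact: represents_hyperbolic r0 discE.
  by apply: (@represents_hyperbolic _ _ _ (r * s)); rewrite ?mulf_neq0 // disc1E -/D discE exprMn.
have [alA gaB beAB] := plane; have w_int := plane_modulus_integers plane.
have w_unit : dval_eq (plane_modulus al be ga) 0.
  apply: integers_unit => //; apply: contra_notN not_sqr => w_even.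
  have [s _] : sq_equiv D 1.
    apply: sq_equiv_trans (plane_disc_equiv al ga (unramified_plane_neq0 plane)) _.
    rewrite -mulrN; apply: (@sqr_1D4M _ 0); rewrite ?rpred0 ?rpredN //.
    by rewrite /congr2 expr0n addr0 opprK add0r.
  by rewrite mul1r => ->; exists s.
have al_exact : dval_eq al (2 * A).
  apply: dval_eqM_tight alA gaB _.
  have -> : al * ga = plane_modulus al be ga * (2 * be) ^+ 2.
    by rewrite divfK // expf_neq0 // (dval_eq_neq0 beAB).
  by apply: dval_eq_cast (dval_eqM w_unit (dval_eqX 2 beAB)) _ _ => //; clear; lia.
have al1_exact : dval_eq al1 (2 * A).
  by apply: dval_eq_near al_exact (dval_ge_le al_near _); clear; lia.
have [al0 al1_0] := (dval_eq_neq0 al_exact, dval_eq_neq0 al1_exact).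
exists al; split=> //; first by exists 1, 0; ring.
apply: represents_norm => //; apply: is_norm_equivl (sq_equiv_sym plane_disc_near) _.
apply: (@is_norm_equivr _ (al / al1)); first by exists al1 => //; field.
apply: is_norm_unramified_unit plane_disc_unramified _.
by apply: dval_eq_cast (dval_eqM al_exact (dval_eqV al1_exact)) _ _ => //; clear; lia.
Qed.

End UnramifiedPlanes.

(** * Reduced systems *)

Section CoefficientSpans.

Variable V : lmodType F.
Implicit Types (f : nat -> V) (I J : seq nat) (P : nat -> F -> bool) (c : F) (x y : V).

Inductive coef_span f I P : V -> Prop :=
| coef_span0 : coef_span f I P 0
| coef_spanS x i c : coef_span f I P x -> i \in I -> P i c -> coef_span f I P (x + c *: f i).

Lemma coef_span1 f I P i c : i \in I -> P i c -> coef_span f I P (c *: f i).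
Proof. by move=> iI Pc; rewrite -[_ *: _]add0r; apply: coef_spanS => //; apply: coef_span0. Qed.

Lemma coef_spanD f I P x y : coef_span f I P x -> coef_span f I P y -> coef_span f I P (x + y).
Proof.
move=> x_span; elim: y / => [|y i c _ IH iI Pc]; first by rewrite addr0.
by rewrite addrA; apply: coef_spanS.
Qed.

Lemma coef_span_bigsum (T : eqType) (r : seq T) (g : T -> V) f I P :
  (forall t, t \in r -> coef_span f I P (g t)) -> coef_span f I P (\sum_(t <- r) g t).
Proof.
move=> g_span; rewrite big_seq; apply: (big_ind (coef_span f I P)) => //.
  exact: coef_span0.
exact: coef_spanD.
Qed.

Lemma coef_spanZ f I P P' c x : coef_span f I P x -> (forall i d, P i d -> P' i (c * d)) ->
  coef_span f I P' (c *: x).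
Proof.
move=> x_span PP'; elim: x / x_span => [|x i d _ IH iI Pd]; first by rewrite scaler0; apply: coef_span0.
by rewrite scalerDr scalerA; apply: coef_spanS => //; apply: PP'.
Qed.

Lemma coef_span_sub f I J P P' x : coef_span f I P x -> {subset I <= J} ->
  (forall i c, i \in I -> P i c -> P' i c) -> coef_span f J P' x.
Proof.
move=> x_span IJ PP'; elim: x / x_span => [|x i c _ IH iI Pc]; first exact: coef_span0.
by apply: coef_spanS => //; [apply: IJ | apply: PP'].
Qed.

Lemma coef_span_orth (b : {biscalar V}) f I P x y :
  coef_span f I P x -> (forall i, i \in I -> b (f i) y = 0) -> b x y = 0.
Proof.
move=> x_span f_orth; elim: x / x_span => [|x i c _ IH iI _]; first by rewrite linear0l.
by rewrite linearDl linearZl_LR IH f_orth // mulr0 addr0.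
Qed.

Lemma coef_span_sum f I P x : uniq I -> coef_span f I P x ->
  exists c : nat -> F, x = \sum_(i <- I) c i *: f i.
Proof.
move=> uniq_I; elim: x / => [|x i c _ [d ->] iI _].
  by exists (fun=> 0); rewrite big1 // => i _; rewrite scale0r.
exists (fun j => d j + (if j == i then c else 0)).
under [RHS]eq_bigr => j _ do rewrite scalerDl.
rewrite big_split /=; congr (_ + _); rewrite (bigD1_seq i) //= eqxx big1 ?addr0 // => j /negPf ->.
by rewrite scale0r.
Qed.

Definition lin_span f I : V -> Prop := coef_span f I (fun _ _ => true).

Lemma lin_span_mem f I i : i \in I -> lin_span f I (f i).
Proof. by move=> iI; rewrite -[f i]scale1r; apply: coef_span1. Qed.

Lemma lin_spanZ f I c x : lin_span f I x -> lin_span f I (c *: x).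
Proof. by move=> x_span; apply: coef_spanZ x_span _. Qed.

Lemma lin_span_of f I P x : coef_span f I P x -> lin_span f I x.
Proof. by move=> x_span; apply: coef_span_sub x_span _ _. Qed.

Lemma lin_span_sub f I J x : {subset I <= J} -> lin_span f I x -> lin_span f J x.
Proof. by move=> IJ x_span; apply: coef_span_sub x_span IJ _. Qed.

Lemma lin_span_trans f g I J x : (forall i, i \in J -> lin_span f I (g i)) ->
  lin_span g J x -> lin_span f I x.
Proof.
move=> g_span; elim: x / => [|x i c _ IH iJ _]; first exact: coef_span0.
by apply: coef_spanD => //; apply: lin_spanZ; apply: g_span.
Qed.

End CoefficientSpans.

Section ReducedSystems.

Variables (V : lmodType F) (b : {biscalar V}).
Hypothesis bC : forall x y, b x y = b y x.
Implicit Types (f g : nat -> V) (a : nat -> nat) (ps : seq (nat * nat)) (ss I J : seq nat).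
Implicit Types (x y : V) (c : F) (s t : int).

(* The vectors of level [t / 2], when [f i] is assigned level [a i / 2] *)
Definition level_span f a I t : V -> Prop := coef_span f I (fun i c => dval_ge c (t - (a i)%:Z)).

Lemma level_span_le f a I J t t' x :
  level_span f a I t x -> {subset I <= J} -> t' <= t -> level_span f a J t' x.
Proof.
by move=> x_span IJ le_t; apply: coef_span_sub x_span IJ _ => i c _ /dval_ge_le; apply; lia.
Qed.

Lemma level_spanZ f a I t t' r c x :
  level_span f a I t x -> dval_ge c r -> t' <= t + r -> level_span f a I t' (c *: x).
Proof.
by move=> x_span c_r le_t'; apply: (coef_spanZ x_span) => i d d_t; apply: dval_geM_le c_r d_t _; lia.
Qed.

Lemma level_span_mem f a I i : i \in I -> level_span f a I (a i)%:Z (f i).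
Proof. by move=> iI; rewrite -[f i]scale1r; apply: coef_span1 => //; apply: dval_ge1; lia. Qed.

Lemma level_span_near f a I J t i g : i \in I -> {subset J <= I} -> (a i)%:Z <= t ->
  level_span f a J t (g i - f i) -> level_span f a I (a i)%:Z (g i).
Proof.
move=> iI JI le_t near; rewrite -[g i](subrK (f i)); apply: coef_spanD; last exact: level_span_mem.
exact: level_span_le near JI le_t.
Qed.

Lemma level_span_trans f g a I J t x : (forall i, i \in J -> level_span f a I (a i)%:Z (g i)) ->
  level_span g a J t x -> level_span f a I t x.
Proof.
move=> g_span; elim: x / => [|x i c _ IH iJ c_t]; first exact: coef_span0.
by apply: coef_spanD => //; apply: level_spanZ (g_span i iJ) c_t _; lia.
Qed.

Definition form_bounded f a I : Prop :=
  (forall i, i \in I -> dval_ge (b (f i) (f i)) (2 * (a i)%:Z)) /\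
  (forall i j, i \in I -> j \in I -> i != j -> dval_ge (2 * b (f i) (f j)) ((a i)%:Z + (a j)%:Z)).

Lemma level_span_form f a I s t x y : form_bounded f a I ->
  level_span f a I s x -> level_span f a I t y -> dval_ge (2 * b x y) (s + t).
Proof.
move=> [norm_ge form_ge] x_span y_span.
elim: x / x_span => [|x i c _ IHx iI c_s]; first by rewrite linear0l mulr0 dval_ge0.
rewrite linearDl mulrDr; apply: dval_geD => //; rewrite linearZl_LR mulrCA.
suff fi_y : dval_ge (2 * b (f i) y) ((a i)%:Z + t) by apply: dval_geM_le c_s fi_y _; lia.
elim: y / y_span {IHx} => [|y j d _ IHy jI d_t]; first by rewrite linear0r mulr0 dval_ge0.
rewrite linearDr mulrDr; apply: dval_geD => //; rewrite linearZr_LR mulrCA.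
apply: (dval_geM_le d_t (l := (a i)%:Z + (a j)%:Z)); last by lia.
have [->|ij] := eqVneq i j; last exact: form_ge.
by apply: dval_ge2M (norm_ge _ jI) _; lia.
Qed.

Lemma level_span_norm f a I s x : form_bounded f a I -> level_span f a I s x ->
  dval_ge (b x x) (2 * s).
Proof.
move=> bounded x_span; elim: x / x_span => [|x i c x_span IHx iI c_s].
  by rewrite linear0l dval_ge0.
have -> : b (x + c *: f i) (x + c *: f i) =
    b x x + c * (2 * b x (f i)) + c * c * b (f i) (f i).
  by rewrite !bilinE [b (f i) x]bC; ring.
apply: dval_geD; last by apply: dval_geM_le (dval_geM c_s c_s) (bounded.1 i iI) _; lia.
apply: dval_geD => //.
apply: (dval_geM_le c_s (level_span_form bounded x_span (level_span_mem f a iI))); lia.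
Qed.

Definition leading_congr f g a I : Prop :=
  (forall i, i \in I -> dval_ge (b (g i) (g i) - b (f i) (f i)) (2 * (a i)%:Z + 2)) /\
  (forall i j, i \in I -> j \in I -> i != j ->
     dval_ge (2 * b (g i) (g j) - 2 * b (f i) (f j)) ((a i)%:Z + (a j)%:Z + 1)).

Lemma leading_congr_refl f a I : leading_congr f f a I.
Proof. by split=> *; rewrite subrr dval_ge0. Qed.

Lemma leading_congr_sym f g a I : leading_congr f g a I -> leading_congr g f a I.
Proof.
by move=> [norm_fg form_fg]; split=> [i iI|i j iI jI ij];
  rewrite -dval_geN opprB; [apply: norm_fg | apply: form_fg].
Qed.

Lemma leading_congr_trans g f h a I :
  leading_congr f g a I -> leading_congr g h a I -> leading_congr f h a I.
Proof.
move=> [norm_fg form_fg] [norm_gh form_gh]; split=> [i iI|i j iI jI ij].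
  by have := dval_geD (norm_gh i iI) (norm_fg i iI); rewrite addrA subrK.
by have := dval_geD (form_gh i j iI jI ij) (form_fg i j iI jI ij); rewrite addrA subrK.
Qed.

Lemma level_span_leading_congr h f g a I J : form_bounded h a I ->
  (forall i, i \in J -> level_span h a I (a i)%:Z (f i)) ->
  (forall i, i \in J -> level_span h a I ((a i)%:Z + 1) (g i - f i)) -> leading_congr f g a J.
Proof.
move=> bounded f_span near; have form_ge := level_span_form bounded.
split=> [i iJ|i j iJ jJ ij].
  have -> : b (g i) (g i) - b (f i) (f i) = 2 * b (f i) (g i - f i) + b (g i - f i) (g i - f i).
    by rewrite !bilinE [b (g i) (f i)]bC; ring.
  apply: dval_geD; last by apply: dval_ge_le (level_span_norm bounded (near i iJ)) _; lia.
  by apply: dval_ge_even (form_ge _ _ _ _ (f_span i iJ) (near i iJ)) _; lia.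
have -> : 2 * b (g i) (g j) - 2 * b (f i) (f j) =
    2 * b (f i) (g j - f j) + 2 * b (g i - f i) (f j) + 2 * b (g i - f i) (g j - f j).
  by rewrite !bilinE; ring.
apply: dval_geD; first apply: dval_geD.
- by apply: dval_ge_le (form_ge _ _ _ _ (f_span i iJ) (near j jJ)) _; lia.
- by apply: dval_ge_le (form_ge _ _ _ _ (near i iJ) (f_span j jJ)) _; lia.
by apply: dval_ge_le (form_ge _ _ _ _ (near i iJ) (near j jJ)) _; lia.
Qed.

(* Reduced system with exponents [a]: the indices are matched into pairs [ps] spanning planes of
   unramified discriminant, except for singles [ss] (at most two, by [reduced_parity]); everything
   else vanishes in the associated graded form. *)
Record reduced_system f a ps ss : Prop := {
  reduced_uniq : uniq (indices ps ss);
  reduced_norm : forall i, i \in indices ps ss -> dval_ge (b (f i) (f i)) (2 * (a i)%:Z);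
  reduced_pair : forall p, p \in ps ->
    dval_eq (2 * b (f p.1) (f p.2)) ((a p.1)%:Z + (a p.2)%:Z);
  reduced_unpaired : forall i j, i \in indices ps ss -> j \in indices ps ss -> i != j ->
    ~~ paired ps i j -> dval_ge (2 * b (f i) (f j)) ((a i)%:Z + (a j)%:Z + 1);
  reduced_single : forall i, i \in ss -> dval_eq (b (f i) (f i)) (2 * (a i)%:Z);
  reduced_parity : forall i j, i \in ss -> j \in ss -> i != j -> odd (a i + a j) }.

Lemma reduced_paired f a ps ss i j : reduced_system f a ps ss -> paired ps i j ->
  dval_eq (2 * b (f i) (f j)) ((a i)%:Z + (a j)%:Z).
Proof. by move=> redf /orP[] /(reduced_pair redf) //=; rewrite bC addrC. Qed.

Lemma reduced_bounded f a ps ss : reduced_system f a ps ss -> form_bounded f a (indices ps ss).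
Proof.
move=> redf; split=> [|i j iI jI ij]; first exact: reduced_norm redf.
have [/(reduced_paired redf)/dval_eqW //|not_paired] := boolP (paired ps i j).
by apply: dval_ge_le (reduced_unpaired redf iI jI ij not_paired) _; lia.
Qed.

Lemma reduced_congr f g a ps ss : reduced_system f a ps ss ->
  leading_congr f g a (indices ps ss) -> reduced_system g a ps ss.
Proof.
move=> redf [norm_fg form_fg]; have uniq_I := reduced_uniq redf; split=> //.
- by move=> i iI; apply: dval_ge_near (reduced_norm redf iI) (norm_fg i iI) _; lia.
- move=> p p_ps; have /andP[p1 p2] := mem_pair_indices p_ps.
  apply: dval_eq_near (reduced_pair redf p_ps) (form_fg _ _ _ _ _); rewrite ?indices_pair //.
  exact: pair_indices_neq (uniq_indices_pairs uniq_I) p_ps.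
- move=> i j iI jI ij not_paired.
  exact: dval_ge_near (reduced_unpaired redf iI jI ij not_paired) (form_fg i j iI jI ij) _.
- move=> i i_ss; apply: dval_eq_near (reduced_single redf i_ss) _.
  by apply: dval_ge_le (norm_fg i (indices_single ps i_ss)) _; lia.
exact: reduced_parity redf.
Qed.

Lemma reduced_behead f a p ps ss : reduced_system f a (p :: ps) ss -> reduced_system f a ps ss.
Proof.
move=> redf; have consE := perm_indices_cons ps ss p; have memE := perm_mem consE.
have := reduced_uniq redf; rewrite (perm_uniq consE) !cons_uniq inE negb_or.
case/and3P => /andP[_ p1_I] p2_I uniq_I.
have sub i : i \in indices ps ss -> i \in indices (p :: ps) ss by rewrite memE !inE => ->; rewrite !orbT.
split=> //.
- by move=> i /sub; apply: (reduced_norm redf).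
- by move=> q q_ps; apply: (reduced_pair redf); rewrite inE q_ps orbT.
- move=> i j iI jI ij not_paired.
  apply: (reduced_unpaired redf (sub i iI) (sub j jI) ij); apply: contra not_paired.
  rewrite /paired !inE => /orP[]/predU1P[pE|->]; rewrite ?orbT //.
    by rewrite -pE iI in p1_I.
  by rewrite -pE jI in p1_I.
- exact: reduced_single redf.
exact: reduced_parity redf.
Qed.

Lemma reduced_eq_in f g a a' ps ss : reduced_system f a ps ss -> {in indices ps ss, f =1 g} ->
  {in indices ps ss, a =1 a'} -> reduced_system g a' ps ss.
Proof.
move=> redf fg aa'; have mem1 p : p \in ps -> p.1 \in indices ps ss /\ p.2 \in indices ps ss.
  by move=> /mem_pair_indices /andP[p1 p2]; rewrite !mem_cat p1 p2 !orbT.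
have sI i : i \in ss -> i \in indices ps ss by apply: indices_single.
split; first exact: reduced_uniq redf.
- by move=> i iI; rewrite -fg // -aa' //; apply: (reduced_norm redf).
- by move=> p p_ps; have [p1 p2] := mem1 p p_ps; rewrite -!fg // -!aa' //; apply: (reduced_pair redf).
- by move=> i j iI jI ij; rewrite -!fg // -!aa' //; apply: (reduced_unpaired redf).
- by move=> i i_ss; rewrite -fg ?sI // -aa' ?sI //; apply: (reduced_single redf).
by move=> i j i_ss j_ss; rewrite -!aa' ?sI //; apply: (reduced_parity redf).
Qed.

Lemma reduced_perm f a ps ss ss' :
  perm_eq ss ss' -> reduced_system f a ps ss -> reduced_system f a ps ss'.
Proof.
move=> ssE redf; have memI := perm_mem (perm_indices_single ps ssE); have mem_ss := perm_mem ssE.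
split; first by rewrite -(perm_uniq (perm_indices_single ps ssE)); apply: reduced_uniq redf.
- by move=> i; rewrite -memI; apply: (reduced_norm redf).
- exact: reduced_pair redf.
- by move=> i j; rewrite -!memI; apply: (reduced_unpaired redf).
- by move=> i; rewrite -mem_ss; apply: (reduced_single redf).
by move=> i j; rewrite -!mem_ss; apply: (reduced_parity redf).
Qed.

Section PlaneProjection.

Variables p q : V.
Let D := b p p * b q q - b p q ^+ 2.

Definition plane_coef u : F * F :=
  ((b u p * b q q - b u q * b p q) / D, (b u q * b p p - b u p * b p q) / D).

Definition plane_compl u : V := u - (plane_coef u).1 *: p - (plane_coef u).2 *: q.

Lemma plane_compl_orth u : D != 0 -> b (plane_compl u) p = 0 /\ b (plane_compl u) q = 0.
Proof.
move=> D0; rewrite /plane_compl /plane_coef /= !bilinE [b q p]bC; split; move: D0; rewrite /D;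
  by move: (b u p) (b u q) (b p p) (b q q) (b p q) => up uq pp qq pq D0; field.
Qed.

Variables (A B C : int).
Hypotheses (pA : dval_ge (b p p) (2 * A)) (qB : dval_ge (b q q) (2 * B)).
Hypothesis pq_AB : dval_eq (2 * b p q) (A + B).

Lemma plane_disc4 : dval_eq (4 * D) (2 * (A + B)).
Proof.
have -> : 4 * D = - (2 * b p q) ^+ 2 + 4 * (b p p * b q q) by rewrite /D; ring.
apply: dval_eqD; first by rewrite dval_eqN; apply: dval_eq_cast (dval_eqX 2 pq_AB) _ _.
by apply: dval_geM_le (dval_eqW dval_eq4) (dval_geM pA qB) _; clear; lia.
Qed.

Lemma plane_disc_neq0 : D != 0.
Proof. by apply: contraNneq (dval_eq_neq0 plane_disc4) => ->; rewrite mulr0. Qed.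

Lemma plane_coef_ge u : dval_ge (2 * b u p) (C + A) -> dval_ge (2 * b u q) (C + B) ->
  dval_ge (plane_coef u).1 (C - A) /\ dval_ge (plane_coef u).2 (C - B).
Proof.
move=> up uq; have D0 := plane_disc_neq0; have four_neq0 := dval_eq_neq0 dval_eq4.
have pqE := dval_eqW pq_AB; rewrite /plane_coef /=; split.
  have -> : (b u p * b q q - b u q * b p q) / D =
      (2 * b u p * (2 * b q q) - 2 * b u q * (2 * b p q)) / (4 * D).
    by move: (D) D0 => E E0; field; rewrite four_neq0 E0.
  apply: (dval_ge_div (k := C + A + 2 * B) _ plane_disc4); last by clear; lia.
  apply: dval_geB; first by apply: dval_geM_le up (dval_ge2M qB (lexx _)) _; clear; lia.
  by apply: dval_geM_le uq pqE _; clear; lia.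
have -> : (b u q * b p p - b u p * b p q) / D =
    (2 * b u q * (2 * b p p) - 2 * b u p * (2 * b p q)) / (4 * D).
  by move: (D) D0 => E E0; field; rewrite four_neq0 E0.
apply: (dval_ge_div (k := C + B + 2 * A) _ plane_disc4); last by clear; lia.
apply: dval_geB; first by apply: dval_geM_le uq (dval_ge2M pA (lexx _)) _; clear; lia.
by apply: dval_geM_le up pqE _; clear; lia.
Qed.

End PlaneProjection.

(* [g] arises from [f] by projecting away from the planes of the pairs. *)
Definition cleared f g a ps ss : Prop :=
  [/\ forall i, i \in indices ps ss ->
        level_span f a (pair_indices ps) ((a i)%:Z + 1) (g i - f i),
      forall i j, i \in indices ps ss -> j \in indices ps ss -> i != j -> ~~ paired ps i j ->
        ~~ ((i \in ss) && (j \in ss)) -> b (g i) (g j) = 0 &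
      forall z, (forall i, i \in pair_indices ps -> b (g i) z = 0) ->
        forall i, i \in pair_indices ps -> b (f i) z = 0].

Lemma cleared_leading_congr f g a ps ss : reduced_system f a ps ss -> cleared f g a ps ss ->
  leading_congr f g a (indices ps ss).
Proof.
move=> redf [near _ _]; apply: (level_span_leading_congr (reduced_bounded redf)) => i iI.
  exact: level_span_mem.
by apply: level_span_le (near i iI) _ (lexx _) => j; apply: indices_pair.
Qed.

Lemma cleared_lin_span f g a ps ss i :
  cleared f g a ps ss -> i \in indices ps ss -> lin_span f (indices ps ss) (g i).
Proof.
move=> [near _ _] iI; rewrite -[g i](subrK (f i)); apply: coef_spanD; last exact: lin_span_mem.
by apply: lin_span_sub (lin_span_of (near i iI)) => j; apply: indices_pair.
Qed.

Section ClearFirstPair.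

Variables (f : nat -> V) (a : nat -> nat) (i j : nat) (ps : seq (nat * nat)) (ss : seq nat).
Hypothesis redf : reduced_system f a ((i, j) :: ps) ss.
Let I := indices ((i, j) :: ps) ss.
Let J := indices ps ss.
Let f' l := plane_compl (f i) (f j) (f l).

Let memI l : (l \in I) = [|| l == i, l == j | l \in J].
Proof. by rewrite /I (perm_mem (perm_indices_cons ps ss (i, j))) !inE. Qed.

Let iI : i \in I. Proof. by rewrite memI eqxx. Qed.
Let jI : j \in I. Proof. by rewrite memI eqxx orbT. Qed.
Let subJI : {subset J <= I}. Proof. by move=> l; rewrite memI => ->; rewrite !orbT. Qed.

Lemma first_pair_notin : i \notin J /\ j \notin J.
Proof.
have := reduced_uniq redf; rewrite (perm_uniq (perm_indices_cons ps ss (i, j))) /= inE negb_or.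
by case/and3P => /andP[_ ->] -> _.
Qed.

Lemma first_pair_unpaired l : l \in J ->
  ~~ paired ((i, j) :: ps) l i /\ ~~ paired ((i, j) :: ps) l j.
Proof.
move=> lJ; have [iJ jJ] := first_pair_notin.
have li : l != i by apply: contraNneq iJ => <-.
have lj : l != j by apply: contraNneq jJ => <-.
have unpaired k : k \notin J -> ~~ paired ps l k.
  by apply: contra => /paired_indices /andP[_]; apply: indices_pair.
rewrite /paired !inE !xpair_eqE (negPf li) (negPf lj) !andbF /=.
by split; apply: unpaired.
Qed.

Let D_neq0 : b (f i) (f i) * b (f j) (f j) - b (f i) (f j) ^+ 2 != 0.
Proof.
exact: plane_disc_neq0 (reduced_norm redf iI) (reduced_norm redf jI) (reduced_pair redf (mem_head _ _)).
Qed.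

Lemma first_pair_compl_near (K : seq nat) l : i \in K -> j \in K -> l \in J ->
  level_span f a K ((a l)%:Z + 1) (f' l - f l).
Proof.
move=> iK jK lJ; have [iJ jJ] := first_pair_notin; have [li_unp lj_unp] := first_pair_unpaired lJ.
have li : l != i by apply: contraNneq iJ => <-.
have lj : l != j by apply: contraNneq jJ => <-.
have [] := @plane_coef_ge (f i) (f j) (a i)%:Z (a j)%:Z ((a l)%:Z + 1)
  (reduced_norm redf iI) (reduced_norm redf jI) (reduced_pair redf (mem_head _ _)) (f l).
- by rewrite addrAC; apply: reduced_unpaired redf _ _ (subJI lJ) iI li li_unp.
- by rewrite addrAC; apply: reduced_unpaired redf _ _ (subJI lJ) jI lj lj_unp.
move=> coef_i coef_j; rewrite /f' /plane_compl [_ - f l]addrC !addrA addNr add0r -!scaleNr.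
by apply: coef_spanD; apply: coef_span1; rewrite // dval_geN.
Qed.

Lemma first_pair_compl_reduced : reduced_system f' a ps ss.
Proof.
apply: (reduced_congr (reduced_behead redf)).
apply: (level_span_leading_congr (reduced_bounded redf)) => l lJ.
  by apply: level_span_mem; apply: subJI.
exact: first_pair_compl_near.
Qed.

Lemma first_pair_compl_orth l : b (f' l) (f i) = 0 /\ b (f' l) (f j) = 0.
Proof. exact: plane_compl_orth D_neq0. Qed.

Lemma cleared_cons g : cleared f' g a ps ss ->
  cleared f (fun l => if l \in J then g l else f l) a ((i, j) :: ps) ss.
Proof.
move=> [near_g orth_g span_g]; have [iJ jJ] := first_pair_notin.
have orth_ij l : l \in J -> b (g l) (f i) = 0 /\ b (g l) (f j) = 0.
  move=> lJ; have orth k : (forall m, b (f' m) (f k) = 0) -> b (g l) (f k) = 0.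
    move=> orth_k; rewrite -[g l](subrK (f' l)) linearDl orth_k addr0.
    exact: coef_span_orth (near_g l lJ) _.
  by split; apply: orth => m; have [] := first_pair_compl_orth m.
split=> [l|l m|z orth_z l].
- rewrite memI => /or3P[/eqP->|/eqP->|lJ]; [rewrite (negPf iJ) | rewrite (negPf jJ) | rewrite lJ].
  + by rewrite subrr; apply: coef_span0.
  + by rewrite subrr; apply: coef_span0.
  have i_pairs : i \in pair_indices ((i, j) :: ps) by rewrite !inE eqxx.
  have j_pairs : j \in pair_indices ((i, j) :: ps) by rewrite !inE eqxx orbT.
  rewrite -(subrK (f' l) (g l)) -addrA; apply: coef_spanD; last exact: first_pair_compl_near.
  apply: level_span_trans (near_g l lJ) => m m_ps.
  apply: (level_span_near (J := [:: i; j]) (t := (a m)%:Z + 1)).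
  + by rewrite !inE m_ps !orbT.
  + by move=> k; rewrite !inE => /orP[/eqP->|/eqP->]; rewrite ?eqxx ?orbT.
  + by clear; lia.
  by apply: first_pair_compl_near; rewrite ?inE ?eqxx ?orbT // indices_pair.
- rewrite !memI => /or3P[/eqP->|/eqP->|lJ] /or3P[/eqP->|/eqP->|mJ];
    rewrite ?(negPf iJ) ?(negPf jJ) ?lJ ?mJ ?eqxx // => lm unpaired not_ss.
  + by move: unpaired; rewrite /paired mem_head.
  + by rewrite bC; case: (orth_ij m mJ).
  + by move: unpaired; rewrite /paired mem_head orbT.
  + by rewrite bC; case: (orth_ij m mJ).
  + by case: (orth_ij l lJ).
  + by case: (orth_ij l lJ).
  apply: orth_g => //; apply: contra unpaired.
  by rewrite /paired !inE => /orP[] ->; rewrite ?orbT.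
have zi : b (f i) z = 0 by have := orth_z i; rewrite (negPf iJ) mem_head => ->.
have zj : b (f j) z = 0 by have := orth_z j; rewrite (negPf jJ) !inE eqxx orbT => ->.
rewrite !inE => /or3P[/eqP->|/eqP->|l_ps] //.
have /(_ l l_ps) : forall m, m \in pair_indices ps -> b (f' m) z = 0.
  apply: span_g => m m_ps; have := orth_z m; rewrite indices_pair //.
  by apply; rewrite !inE m_ps !orbT.
by rewrite /f' /plane_compl !bilinE zi zj !mulr0 !subr0.
Qed.

End ClearFirstPair.

Lemma clear_pairs f a ps ss : reduced_system f a ps ss -> exists g, cleared f g a ps ss.
Proof.
elim: ps f => [|[i j] ps IH] f redf; last first.
  by have [g /(cleared_cons redf)] := IH _ (first_pair_compl_reduced redf); eexists; eassumption.
exists f; split=> // [i _|i j]; first by rewrite subrr; apply: coef_span0.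
by rewrite /indices !cats0 => -> ->.
Qed.

Definition diagonal_plane f i j x y : Prop :=
  [/\ lin_span f [:: i; j] x, lin_span f [:: i; j] y & b x y = 0] /\
  [/\ b x x != 0, b y y != 0 & unramified_disc (- (b x x * b y y))].

Lemma diagonal_plane_represented f i j c D : c != 0 -> unramified_disc D ->
  sq_equiv (b (f i) (f j) ^+ 2 - b (f i) (f i) * b (f j) (f j)) D ->
  represents (b (f i) (f i)) (b (f i) (f j)) (b (f j) (f j)) c ->
  exists x y, [/\ diagonal_plane f i j x y, b x x = c & b y y = - (c * D)].
Proof.
move=> c0 D_unram [s s0 discE] [p [q cE]]; have D0 := unramified_disc_neq0 D_unram.
set al := b (f i) (f i) in discE cE; set ga := b (f j) (f j) in discE cE.
set be := b (f i) (f j) in discE cE.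
pose x := p *: f i + q *: f j.
pose y := (- (p * be + q * ga) / s) *: f i + ((p * al + q * be) / s) *: f j.
have span u w : lin_span f [:: i; j] (u *: f i + w *: f j).
  by apply: coef_spanD; apply: coef_span1; rewrite // !inE eqxx ?orbT.
have xx : b x x = c by rewrite /x !bilinE [b (f j) (f i)]bC -/al -/be -/ga -cE; ring.
have yy : b y y = - (c * D).
  have -> : D = (be ^+ 2 - al * ga) / s ^+ 2 by rewrite discE mulfK // expf_neq0.
  by rewrite /y !bilinE [b (f j) (f i)]bC -/al -/be -/ga -cE; field.
exists x, y; split=> //; split; split; rewrite ?xx ?yy ?oppr_eq0 ?mulf_neq0 //; try exact: span.
  by rewrite /x /y !bilinE [b (f j) (f i)]bC -/al -/be -/ga; field.
by apply: unramified_disc_sq_equiv D_unram; exists c => //; ring.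
Qed.

Lemma common_diagonal_planes f f1 a ps ss (uniq_ps : uniq (pair_indices ps)) :
  reduced_system f a ps ss -> leading_congr f f1 a (indices ps ss) ->
  exists h h1, (forall l, l \notin pair_indices ps -> h l = f l /\ h1 l = f1 l) /\
    forall p, p \in ps ->
      [/\ diagonal_plane f p.1 p.2 (h p.1) (h p.2), diagonal_plane f1 p.1 p.2 (h1 p.1) (h1 p.2),
          b (h1 p.1) (h1 p.1) = b (h p.1) (h p.1) & b (h1 p.2) (h1 p.2) = b (h p.2) (h p.2)].
Proof.
elim: ps uniq_ps => [|[i j] ps IH] uniq_ps redf ff1; first by exists f, f1.
have memE := perm_mem (perm_indices_cons ps ss (i, j)); have [norm_near form_near] := ff1.
have [||h [h1 [h_out h_planes]]] := IH _ (reduced_behead redf).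
- by move: uniq_ps => /= /and3P[].
- split=> [l lI|l m lI mI]; [apply: norm_near | apply: form_near];
    by rewrite memE !inE ?lI ?mI !orbT.
have iI : i \in indices ((i, j) :: ps) ss by rewrite memE mem_head.
have jI : j \in indices ((i, j) :: ps) ss by rewrite memE !inE eqxx orbT.
move: (uniq_ps); rewrite /= inE negb_or => /and3P[/andP[ij i_ps] j_ps _].
have plane : unramified_plane (b (f i) (f i)) (b (f i) (f j)) (b (f j) (f j)) (a i)%:Z (a j)%:Z.
  by split; [apply: (reduced_norm redf) | apply: (reduced_norm redf) |
    apply: (reduced_pair redf (mem_head _ _))].
have near := (norm_near i iI, norm_near j jI, form_near i j iI jI ij).
have D_unram := plane_disc_unramified plane.
have [c [c0 c_f c_f1]] := plane_common_value plane near.1.1 near.1.2 near.2.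
have [x [y [xy xx yy]]] := diagonal_plane_represented c0 D_unram (sq_equiv_refl _) c_f.
have [x1 [y1 [xy1 xx1 yy1]]] :=
  diagonal_plane_represented c0 D_unram (plane_disc_near plane near.1.1 near.1.2 near.2) c_f1.
exists (update (update h i x) j y), (update (update h1 i x1) j y1); split=> [l|p].
  rewrite !inE !negb_or => /and3P[li lj /h_out[hl h1l]].
  by rewrite !update_neq.
rewrite inE => /predU1P[-> /=|p_ps].
  by rewrite !update_eq !(update_neq _ _ ij) !update_eq xx xx1 yy yy1; split.
have /andP[p1 p2] := mem_pair_indices p_ps.
have outside l k : l \in pair_indices ps -> k \notin pair_indices ps -> l != k.
  by move=> l_ps; apply: contraNneq => <-.
by rewrite !update_neq; [apply: h_planes | apply: outside ..].
Qed.

Definition almost_diagonal h a ps ss : Prop :=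
  [/\ forall i j, i \in indices ps ss -> j \in indices ps ss -> i != j ->
        ~~ ((i \in ss) && (j \in ss)) -> b (h i) (h j) = 0,
      forall p, p \in ps -> [/\ b (h p.1) (h p.1) != 0, b (h p.2) (h p.2) != 0 &
        unramified_disc (- (b (h p.1) (h p.1) * b (h p.2) (h p.2)))],
      forall i, i \in ss -> dval_eq (b (h i) (h i)) (2 * (a i)%:Z) &
      forall i j, i \in ss -> j \in ss -> i != j ->
        dval_ge (2 * b (h i) (h j)) ((a i)%:Z + (a j)%:Z + 1)].

Lemma cleared_almost_diagonal f g h a ps ss : reduced_system f a ps ss -> cleared f g a ps ss ->
  (forall l, l \notin pair_indices ps -> h l = g l) ->
  (forall p, p \in ps -> diagonal_plane g p.1 p.2 (h p.1) (h p.2)) -> almost_diagonal h a ps ss.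
Proof.
move=> redf clear_g h_out h_planes; have [_ orth_g _] := clear_g.
have redg := reduced_congr redf (cleared_leading_congr redf clear_g).
have uniq_I := reduced_uniq redf; have uniq_ps := uniq_indices_pairs uniq_I.
have h_single i : i \in ss -> h i = g i by move=> /(single_not_pair uniq_I)/h_out.
split=> [i j iI jI ij not_ss|p /h_planes[_ //]|i i_ss|i j i_ss j_ss ij]; last 2 first.
- by rewrite h_single //; apply: (reduced_single redg).
- rewrite !h_single //; apply: (reduced_unpaired redg); rewrite ?indices_single //.
  exact: single_not_paired uniq_I i_ss.
have h_span l : l \in pair_indices ps ->
    exists p, [/\ p \in ps, l \in [:: p.1; p.2] & lin_span g [:: p.1; p.2] (h l)].
  move=> /pair_indicesP[p p_ps l_p]; exists p; split=> //.
  by have [[? ? _] _] := h_planes p p_ps; move: l_p; rewrite !inE => /orP[] /eqP->.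
have in_pairs p m : p \in ps -> m \in [:: p.1; p.2] -> m \in pair_indices ps.
  by move=> p_ps m_p; apply/pair_indicesP; exists p.
have orth_single k y l : l \in ss -> k \in pair_indices ps -> y = h k -> b y (g l) = 0.
  move=> l_ss /h_span[p [p_ps _ hk_span]] ->; apply: coef_span_orth hk_span _ => m m_p.
  have m_ps := in_pairs _ _ p_ps m_p; have l_ps := single_not_pair uniq_I l_ss.
  apply: (orth_g _ _ (indices_pair ss m_ps) (indices_single ps l_ss)).
  - by apply: contraNneq l_ps => <-.
  - by rewrite pairedC; apply: single_not_paired uniq_I l_ss.
  by apply: contraTN m_ps => /andP[/(single_not_pair uniq_I)].
move: iI jI; rewrite !mem_cat => /orP[i_ss|i_ps] /orP[j_ss|j_ps].
- by rewrite i_ss j_ss in not_ss.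
- by rewrite bC (h_single i) //; apply: orth_single j_ps erefl.
- by rewrite (h_single j) //; apply: orth_single i_ps erefl.
have [p [p_ps i_p hi_span]] := h_span i i_ps; have [q [q_ps j_q hj_span]] := h_span j j_ps.
have [pq|pq] := eqVneq p q.
  move: i_p j_q ij; rewrite -pq; have [[_ _ orth] _] := h_planes p p_ps.
  by rewrite !inE => /orP[] /eqP-> /orP[] /eqP->; rewrite ?eqxx // bC.
apply: coef_span_orth hi_span _ => m m_p; rewrite bC; apply: coef_span_orth hj_span _ => l l_q.
have m_ps := in_pairs _ _ p_ps m_p; have l_ps := in_pairs _ _ q_ps l_q.
rewrite bC; apply: (orth_g _ _ (indices_pair ss m_ps) (indices_pair ss l_ps)).
- by apply: contraNneq pq => ml; rewrite (pair_indices_inj uniq_ps p_ps q_ps m_p) // ml.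
- apply: contraNN pq => /(paired_mem uniq_ps p_ps m_p) l_p.
  by apply/eqP; apply: pair_indices_inj uniq_ps p_ps q_ps l_p l_q.
by apply: contraTN m_ps => /andP[/(single_not_pair uniq_I)].
Qed.

Lemma diagonal_planes_lin_span f g h a ps ss : cleared f g a ps ss ->
  (forall l, l \notin pair_indices ps -> h l = g l) ->
  (forall p, p \in ps -> diagonal_plane g p.1 p.2 (h p.1) (h p.2)) ->
  forall i, i \in indices ps ss -> lin_span f (indices ps ss) (h i).
Proof.
move=> clear_g h_out h_planes i iI.
have [/pair_indicesP[p p_ps i_p]|i_ps] := boolP (i \in pair_indices ps); last first.
  by rewrite h_out //; apply: cleared_lin_span clear_g iI.
apply: (lin_span_trans (g := g) (J := [:: p.1; p.2])) => [m m_p|].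
  by apply: cleared_lin_span clear_g _; apply/indices_pair/pair_indicesP; exists p.
by have [[? ? _] _] := h_planes p p_ps; move: i_p; rewrite !inE => /orP[] /eqP->.
Qed.

Lemma common_diagonalization f f1 a ps ss : reduced_system f a ps ss ->
  leading_congr f f1 a (indices ps ss) ->
  exists h h1,
   [/\ forall i, i \in indices ps ss -> lin_span f (indices ps ss) (h i),
       forall i, i \in indices ps ss -> lin_span f1 (indices ps ss) (h1 i),
       almost_diagonal h a ps ss, almost_diagonal h1 a ps ss &
       forall i, i \in pair_indices ps -> b (h1 i) (h1 i) = b (h i) (h i)].
Proof.
move=> redf ff1; have redf1 := reduced_congr redf ff1.
have [g clear_g] := clear_pairs redf; have [g1 clear_g1] := clear_pairs redf1.
have fg := cleared_leading_congr redf clear_g; have f1g1 := cleared_leading_congr redf1 clear_g1.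
have gg1 := leading_congr_trans (leading_congr_sym fg) (leading_congr_trans ff1 f1g1).
have uniq_ps := uniq_indices_pairs (reduced_uniq redf).
have [h [h1 [h_out planes]]] := common_diagonal_planes uniq_ps (reduced_congr redf fg) gg1.
have [h_g h1_g1] : (forall l, l \notin pair_indices ps -> h l = g l) /\
    (forall l, l \notin pair_indices ps -> h1 l = g1 l) by split=> l /h_out[].
have [h_planes h1_planes] :
    (forall p, p \in ps -> diagonal_plane g p.1 p.2 (h p.1) (h p.2)) /\
    (forall p, p \in ps -> diagonal_plane g1 p.1 p.2 (h1 p.1) (h1 p.2)) by split=> p /planes[].
exists h, h1; split.
- exact: diagonal_planes_lin_span clear_g h_g h_planes.
- exact: diagonal_planes_lin_span clear_g1 h1_g1 h1_planes.
- exact: cleared_almost_diagonal redf clear_g h_g h_planes.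
- exact: cleared_almost_diagonal redf1 clear_g1 h1_g1 h1_planes.
by move=> i /pair_indicesP[p /planes[_ _ norm1 norm2]]; rewrite !inE => /orP[] /eqP->.
Qed.

Definition gram f k : 'M[F]_k := \matrix_(i, j) b (f i) (f j).

Definition congruent_to_gram k (M : 'M[F]_k) f : Prop := exists Y, Y^T *m M *m Y = gram f k.

Lemma gram_change_basis f h k : (forall l, (l < k)%N -> lin_span f (iota 0 k) (h l)) ->
  congruent_to_gram (gram f k) h.
Proof.
move=> h_span.
have /(fin_all_exists (P := fun (l : 'I_k) (c : nat -> F) => h l = \sum_(m <- iota 0 k) c m *: f m))[c hE] :
    forall l : 'I_k, exists c : nat -> F, h l = \sum_(m <- iota 0 k) c m *: f m.
  by move=> l; apply: coef_span_sum (iota_uniq _ _) (h_span l (ltn_ord l)).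
have {}hE (l : 'I_k) : h l = \sum_(m < k) c l m *: f m.
  by rewrite hE -(big_mkord xpredT (fun m => c l m *: f m)) /index_iota subn0.
exists (\matrix_(m, l) c l m); apply/matrixP => i j; rewrite [RHS]mxE !hE linear_sumr mxE.
apply: eq_bigr => n _; rewrite [X in _ * X]mxE linearZr_LR mulrC; congr (_ * _).
by rewrite linear_sumlz mxE; apply: eq_bigr => m _; rewrite linearZl_LR !mxE.
Qed.

Lemma congruent_to_gram_trans k (M : 'M[F]_k) f h :
  congruent_to_gram M f -> congruent_to_gram (gram f k) h -> congruent_to_gram M h.
Proof. by move=> [Y YE] [X XE]; exists (Y *m X); rewrite trmx_mul -XE -YE !mulmxA. Qed.

Lemma congruent_to_gram_span k (M : 'M[F]_k) f h ps ss : perm_eq (indices ps ss) (iota 0 k) ->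
  (forall i, i \in indices ps ss -> lin_span f (indices ps ss) (h i)) ->
  congruent_to_gram M f -> congruent_to_gram M h.
Proof.
move=> I_k h_span Mf; apply: congruent_to_gram_trans Mf (gram_change_basis _) => l.
rewrite (mem_indices_iota _ I_k) => /h_span; apply: lin_span_sub => m.
by rewrite (perm_mem I_k).
Qed.

Lemma gram_orthogonal h k :
  (forall i j, (i < k)%N -> (j < k)%N -> i != j -> b (h i) (h j) = 0) ->
  gram h k = diag_mx (\row_l b (h l) (h l)).
Proof.
move=> orth; apply/matrixP => i j; rewrite !mxE.
by have [->|ij] := eqVneq i j; [rewrite mulr1n | rewrite mulr0n orth].
Qed.

Lemma det_gram_orthogonal h k :
  (forall i j, (i < k)%N -> (j < k)%N -> i != j -> b (h i) (h j) = 0) ->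
  \det (gram h k) = \prod_(l <- iota 0 k) b (h l) (h l).
Proof.
move=> orth; rewrite (gram_orthogonal orth) det_diag -[k in iota 0 k]subn0 big_mkord.
by apply: eq_bigr => i _; rewrite mxE.
Qed.

Lemma xi_congruent k (s : nat) (M N Y : 'M[F]_k) : Y^T *m M *m Y = N -> \det N != 0 -> k = s.*2 ->
  xi v M = disc_xi v ((-1) ^+ s * \det N).
Proof.
move=> NE N0 kE; have -> : xi v M = disc_xi v ((-4) ^+ s * \det M) by rewrite /xi [in k./2]kE doubleK.
apply: disc_xi_sq_equiv.
have -> : (-4) ^+ s = (-1) ^+ s * (2 ^+ s) ^+ 2 :> F.
  by rewrite -exprM mulnC exprM -exprMn; congr (_ ^+ _); ring.
have [_ /sq_equiv_sym MN] := congruent_det_sq_equiv NE N0; apply: sq_equivM MN.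
by apply: sq_equiv_sqr; rewrite expf_neq0 ?two_neq0.
Qed.

Section AlmostDiagonal.

Variables (k : nat) (M : 'M[F]_k) (h : nat -> V) (a : nat -> nat) (ps : seq (nat * nat)).
Hypothesis Mh : congruent_to_gram M h.

Definition pairs_norm : F := \prod_(l <- pair_indices ps) b (h l) (h l).

Section PairsNorm.

Variable ss : seq nat.
Hypothesis diag_h : almost_diagonal h a ps ss.

Lemma pair_norm_neq0 l : l \in pair_indices ps -> b (h l) (h l) != 0.
Proof.
case: diag_h => _ planes _ _ /pair_indicesP[p /planes[norm1 norm2 _]].
by rewrite !inE => /orP[] /eqP->.
Qed.

Lemma pairs_norm_neq0 : pairs_norm != 0.
Proof. by rewrite prodf_seq_neq0; apply/allP => l /pair_norm_neq0. Qed.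

Lemma pairs_norm_unramified : unramified_disc ((-1) ^+ size ps * pairs_norm).
Proof.
case: diag_h => _ + _ _; rewrite /pairs_norm; elim: ps => [|p ps' IH] planes.
  by rewrite big_nil mulr1 expr0; apply: unramified_disc1.
rewrite /= !big_cons exprS; set n := \prod_(l <- _) _.
have -> : -1 * (-1) ^+ size ps' * (b (h p.1) (h p.1) * (b (h p.2) (h p.2) * n)) =
    - (b (h p.1) (h p.1) * b (h p.2) (h p.2)) * ((-1) ^+ size ps' * n) by ring.
apply: unramified_discM; first by case: (planes p (mem_head _ _)).
by apply: IH => q q_ps; apply: planes; rewrite inE q_ps orbT.
Qed.

Lemma pairs_norm_even : ~~ odd `|v pairs_norm|.
Proof.
have := unramified_disc_even pairs_norm_unramified.
rewrite vM ?pairs_norm_neq0 ?expf_neq0 ?oppr_eq0 ?oner_neq0 //.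
by rewrite vX ?oppr_eq0 ?oner_neq0 // vN v1 mulr0 add0r.
Qed.

End PairsNorm.

Lemma no_single_det : perm_eq (indices ps [::]) (iota 0 k) -> almost_diagonal h a ps [::] ->
  [/\ \det (gram h k) = pairs_norm, ~~ odd k & xi v M = disc_xi v ((-1) ^+ size ps * pairs_norm)].
Proof.
move=> I_k diag_h; have [orth _ _ _] := diag_h; have kE := size_indices I_k; rewrite add0n in kE.
have detE : \det (gram h k) = pairs_norm.
  rewrite det_gram_orthogonal -?(perm_big _ I_k) // => i j.
  by rewrite !(mem_indices_iota _ I_k) => iI jI ij; apply: orth.
have [Y YE] := Mh; split=> //; first by rewrite kE odd_double.
by rewrite (xi_congruent YE _ kE) detE // (pairs_norm_neq0 diag_h).
Qed.

Lemma one_single_det (s : nat) : perm_eq (indices ps [:: s]) (iota 0 k) -> almost_diagonal h a ps [:: s] ->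
  [/\ gram h k = diag_mx (\row_l b (h l) (h l)),
      \det (gram h k) = b (h s) (h s) * pairs_norm & \det (gram h k) != 0].
Proof.
move=> I_k diag_h; have [orth _ singles _] := diag_h.
have orth_k i j : (i < k)%N -> (j < k)%N -> i != j -> b (h i) (h j) = 0.
  rewrite !(mem_indices_iota _ I_k) => iI jI ij; apply: orth => //.
  by rewrite !inE; apply: contraNN ij => /andP[/eqP-> /eqP->].
have detE : \det (gram h k) = b (h s) (h s) * pairs_norm.
  by rewrite (det_gram_orthogonal orth_k) -(perm_big _ I_k) big_cons.
split=> //; first exact: gram_orthogonal.
by rewrite detE mulf_neq0 ?(pairs_norm_neq0 diag_h) // (dval_eq_neq0 (singles s (mem_head _ _))).
Qed.

Lemma two_singles_orthogonalize (s t : nat) : perm_eq (indices ps [:: s; t]) (iota 0 k) ->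
  odd (a s + a t) -> almost_diagonal h a ps [:: s; t] ->
  exists N, [/\ congruent_to_gram M (update h t N),
    \det (gram (update h t N) k) = b (h s) (h s) * b N N * pairs_norm &
    ramified_disc (- (b (h s) (h s) * b N N))].
Proof.
move=> I_k st_odd diag_h; have [orth planes singles singles_near] := diag_h.
have [s_ss t_ss] : s \in [:: s; t] /\ t \in [:: s; t] by rewrite !inE !eqxx orbT.
have := perm_uniq I_k; rewrite iota_uniq => uniq_I.
have st : s != t by move: uniq_I; rewrite /= !inE negb_or => /andP[/andP[]].
have s0 := dval_eq_neq0 (singles s s_ss); pose N := h t - (b (h s) (h t) / b (h s) (h s)) *: h s.
have Ns : b N (h s) = 0 by rewrite !bilinE divfK // [b (h t) _]bC subrr.
have N_orth l : l \in indices ps [:: s; t] -> l != t -> b N (h l) = 0.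
  move=> lI lt; have [->|ls] := eqVneq l s; first exact: Ns.
  have orth_l m : m \in [:: s; t] -> m != l -> b (h m) (h l) = 0.
    move=> m_ss ml; apply: orth => //; first exact: indices_single.
    by rewrite !inE (negPf lt) (negPf ls) andbF.
  by rewrite !bilinE (orth_l t) 1?eq_sym // (orth_l s) 1?eq_sym // mulr0 subr0.
have NN : b N N = b (h t) (h t) - b (h s) (h t) ^+ 2 / b (h s) (h s).
  by rewrite {2}/N linearBr linearZr_LR Ns mulr0 subr0 !bilinE mulrAC -expr2.
have orth_k i j : (i < k)%N -> (j < k)%N -> i != j -> b (update h t N i) (update h t N j) = 0.
  rewrite !(mem_indices_iota _ I_k) => iI jI ij.
  have [it|it] := eqVneq i t; first by rewrite it update_eq update_neq ?N_orth // -it eq_sym.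
  rewrite (update_neq _ _ it); have [->|jt] := eqVneq j t; first by rewrite update_eq bC N_orth.
  rewrite update_neq //; apply: orth => //; rewrite !inE (negPf it) (negPf jt) !orbF.
  by apply: contraNN ij => /andP[/eqP-> /eqP->].
exists N; split.
- apply: congruent_to_gram_span I_k _ Mh => l lI.
  have [->|lt] := eqVneq l t; last by rewrite update_neq //; apply: lin_span_mem.
  rewrite update_eq /N -scaleNr; apply: coef_spanD; first by apply/lin_span_mem/indices_single.
  by apply/lin_spanZ/lin_span_mem/indices_single.
- rewrite (det_gram_orthogonal orth_k) -(perm_big _ I_k) /= !big_cons update_eq update_neq // mulrA.
  congr (_ * _); rewrite /pairs_norm big_seq [RHS]big_seq; apply: eq_bigr => l l_ps.
  by rewrite update_neq //; apply: contraTneq l_ps => ->; apply: single_not_pair uniq_I t_ss.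
have -> : - (b (h s) (h s) * b N N) = b (h s) (h t) ^+ 2 - b (h s) (h s) * b (h t) (h t).
  by rewrite NN; field.
apply: ramified_binary_disc (singles s s_ss) (singles t t_ss) _ (singles_near s t s_ss t_ss st).
by move: st_odd; move: (a s) (a t) => m n; clear; lia.
Qed.

Lemma two_singles_xi (s t : nat) : perm_eq (indices ps [:: s; t]) (iota 0 k) ->
  odd (a s + a t) -> almost_diagonal h a ps [:: s; t] -> ~~ odd k /\ xi v M = 0.
Proof.
move=> I_k st_odd diag_h; have kE := size_indices I_k.
have [N [[Y YE] detE ram]] := two_singles_orthogonalize I_k st_odd diag_h.
have det_neq0 : \det (gram (update h t N) k) != 0.
  rewrite detE mulf_neq0 ?(pairs_norm_neq0 diag_h) //.
  by have := ramified_disc_neq0 ram; rewrite oppr_eq0.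
split; first by rewrite kE /= odd_double.
rewrite (xi_congruent (s := (size ps).+1) YE det_neq0) // disc_xi_ramified // detE.
have -> : (-1) ^+ (size ps).+1 * (b (h s) (h s) * b N N * pairs_norm) =
    (-1) ^+ size ps * pairs_norm * - (b (h s) (h s) * b N N) by rewrite exprS; ring.
exact: unramified_ramified_discM (pairs_norm_unramified diag_h) ram.
Qed.

Lemma hilb_pairs_prod (x : F) : x != 0 -> (forall l, l \in pair_indices ps -> b (h l) (h l) != 0) ->
  hilb (-1) x ^+ size ps * \prod_(l <- pair_indices ps) hilb x (b (h l) (h l)) =
  \prod_(p <- ps) hilb x (- (b (h p.1) (h p.1) * b (h p.2) (h p.2))).
Proof.
have neg1 : (-1 : F) != 0 by rewrite oppr_eq0 oner_eq0.
move=> x0; elim: ps => [|p ps' IH] norm_neq0; first by rewrite !big_nil expr0 mulr1.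
rewrite /= !big_cons -IH; last by move=> l l_ps; apply: norm_neq0; rewrite !inE l_ps !orbT.
have [n1 n2] : b (h p.1) (h p.1) != 0 /\ b (h p.2) (h p.2) != 0.
  by split; apply: norm_neq0; rewrite !inE eqxx ?orbT.
rewrite -[- (_ * _)]mulN1r (hilbMr x0 neg1) ?mulf_neq0 // (hilbMr x0 n1) // [hilb x (-1)]hilbC exprS.
by ring.
Qed.

Lemma one_single_eta (s : nat) : perm_eq (indices ps [:: s]) (iota 0 k) -> almost_diagonal h a ps [:: s] ->
  Defs.eta M = hilb (-1 : F) (-1) ^+ (k.+1 %/ 4) * hilb (-1) pairs_norm ^+ size ps *
    (\prod_(p <- ps) hilb (b (h s) (h s)) (- (b (h p.1) (h p.1) * b (h p.2) (h p.2)))) *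
    hasse [seq b (h l) (h l) | l <- pair_indices ps].
Proof.
move=> I_k diag_h; have [gramE detE det_neq0] := one_single_det I_k diag_h.
have [Y YE] := Mh; have [Y0 M_equiv] := congruent_det_sq_equiv YE det_neq0.
have s0 : b (h s) (h s) != 0 by move: det_neq0; rewrite detE mulf_eq0 negb_or => /andP[].
have neg1 : (-1 : F) != 0 by rewrite oppr_eq0 oner_eq0.
rewrite gramE in YE; rewrite (eta_diagonalized _ YE) => [||i]; last 2 first.
- by rewrite unitmxE unitfE.
- rewrite mxE; have := ltn_ord i; rewrite (mem_indices_iota _ I_k) inE.
  by case/predU1P => [->//|]; apply: pair_norm_neq0 diag_h _.
rewrite /eta_diag -hasse_row.
have -> : [seq (\row_l b (h l) (h l)) 0 i | i <- enum 'I_k] = [seq b (h l) (h l) | l <- iota 0 k].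
  by rewrite -val_enum_ord -map_comp; apply: eq_map => i; rewrite /= mxE.
rewrite -(hasse_perm (perm_map (fun l => b (h l) (h l)) I_k)).
have -> : (k.-1 %/ 2)%N = size ps by rewrite (size_indices I_k) add1n /= divn2 doubleK.
rewrite -(hilb_equivr neg1 det_neq0 M_equiv) detE (hilbMr neg1 s0) ?(pairs_norm_neq0 diag_h) //.
rewrite -(hilb_pairs_prod s0) /= ?big_map ?exprMn; last exact: pair_norm_neq0 diag_h.
by ring.
Qed.

End AlmostDiagonal.

Definition singles_invariants k (M : 'M[F]_k) a ss : Prop :=
  match ss with
  | [::] => [/\ ~~ odd k, xi v M != 0 & ~~ odd `|v (\det M)|]
  | [:: s] => [/\ odd k, \det M != 0 & odd `|v (\det M)| = odd (a s)]
  | [:: s; t] => ~~ odd k /\ xi v M = 0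
  | _ => False
  end.

Lemma reduced_singles f a ps ss : reduced_system f a ps ss -> (size ss <= 2)%N.
Proof.
move=> redf; have := reduced_uniq redf; rewrite cat_uniq => /andP[uniq_ss _].
have := reduced_parity redf; case: ss uniq_ss {redf} => [|s [|t [|u ss]]] //=.
rewrite !inE !negb_or -!andbA => /and5P[st su _ tu _] parity.
have [st_odd su_odd] : odd (a s + a t) /\ odd (a s + a u).
  by split; apply: parity; rewrite // !inE eqxx ?orbT.
have : odd (a t + a u) by apply: parity; rewrite // !inE eqxx ?orbT.
by move: st_odd su_odd; rewrite !oddD; case: (odd (a s)); case: (odd (a t)); case: (odd (a u)).
Qed.

Lemma reduced_singles_parity f a ps (s t : nat) : reduced_system f a ps [:: s; t] -> odd (a s + a t).
Proof.
move=> redf; apply: (reduced_parity redf); rewrite ?inE ?eqxx ?orbT //.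
by have := reduced_uniq redf; rewrite /= inE negb_or => /andP[/andP[]].
Qed.

Lemma reduced_invariants k (M : 'M[F]_k) f a ps ss : perm_eq (indices ps ss) (iota 0 k) ->
  reduced_system f a ps ss -> congruent_to_gram M f -> singles_invariants M a ss.
Proof.
move=> I_k redf Mf.
have [h [_ [h_span _ diag_h _ _]]] := common_diagonalization redf (leading_congr_refl f a _).
have Mh := congruent_to_gram_span I_k h_span Mf; have [Y YE] := Mh.
case: ss I_k redf (reduced_singles redf) h_span diag_h => [|s [|t [|//]]] I_k redf _ h_span diag_h.
- have [detE k_even xiE] := no_single_det Mh I_k diag_h; split; rewrite ?xiE //.
    exact: disc_xi_unramified (pairs_norm_unramified diag_h).
  have N0 : \det (gram h k) != 0 by rewrite detE (pairs_norm_neq0 diag_h).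
  have [_ /(sq_equiv_odd N0) <-] := congruent_det_sq_equiv YE N0.
  by rewrite detE (pairs_norm_even diag_h).
- have [_ detE N0] := one_single_det I_k diag_h.
  have [_ MN] := congruent_det_sq_equiv YE N0; split.
  + by rewrite (size_indices I_k) add1n /= odd_double.
  + by rewrite -(sq_equiv_neq0 MN).
  rewrite -(sq_equiv_odd N0 MN) detE; have [_ _ singles _] := diag_h.
  have /dval_eqP[s0 vs] := singles s (mem_head _ _).
  have := pairs_norm_even diag_h; rewrite vM ?(pairs_norm_neq0 diag_h) //; move: vs.
  by move: (v (b _ _)) (v (pairs_norm _ _)) (a s) => m n l; clear; lia.
have st_odd := reduced_singles_parity redf.
exact: (two_singles_xi Mh I_k st_odd diag_h).
Qed.

Lemma reduced_zeta k (M M1 : 'M[F]_k) f f1 a ps ss : perm_eq (indices ps ss) (iota 0 k) ->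
  reduced_system f a ps ss -> leading_congr f f1 a (indices ps ss) ->
  congruent_to_gram M f -> congruent_to_gram M1 f1 -> zeta v M = zeta v M1.
Proof.
move=> I_k redf ff1 Mf M1f1; have redf1 := reduced_congr redf ff1.
have [inv inv1] := (reduced_invariants I_k redf Mf, reduced_invariants I_k redf1 M1f1).
have [h [h1 [h_span h1_span diag_h diag_h1 normE]]] := common_diagonalization redf ff1.
have Mh := congruent_to_gram_span I_k h_span Mf.
have M1h1 := congruent_to_gram_span I_k h1_span M1f1.
have pairs_normE : pairs_norm h1 ps = pairs_norm h ps.
  by rewrite /pairs_norm big_seq [RHS]big_seq; apply: eq_bigr => l; apply: normE.
rewrite /zeta; case: ss I_k inv inv1 diag_h diag_h1 {redf redf1 ff1 h_span h1_span} => [|s [|t [|//]]].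
- move=> I_k [/negPf-> _ _] _ diag_h diag_h1.
  have [_ _ ->] := no_single_det Mh I_k diag_h; have [_ _ ->] := no_single_det M1h1 I_k diag_h1.
  by rewrite pairs_normE.
- move=> I_k [-> _ _] _ diag_h diag_h1.
  rewrite (one_single_eta Mh I_k diag_h) (one_single_eta M1h1 I_k diag_h1) pairs_normE.
  have [_ planes singles _] := diag_h; have [_ _ singles1 _] := diag_h1.
  have /dval_eqP[s0 vs] := singles s (mem_head _ _); have /dval_eqP[s1 vs1] := singles1 s (mem_head _ _).
  congr (_ * _ * _); last by congr hasse; apply/eq_in_map => l /normE.
  rewrite big_seq [RHS]big_seq; apply: eq_bigr => p p_ps.
  have /andP[/normE-> /normE->] := mem_pair_indices p_ps; have [_ _ D_unram] := planes p p_ps.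
  by apply: hilb_same_val => //; lia.
by move=> _ [/negPf-> ->] [_ ->].
Qed.

(* A jump of the exponents at [c] makes the terms [z i j *: g i], [c <= i], of [f j], [j < c],
   negligible. *)
Section JumpTruncation.

Variables (n c : nat) (f g : nat -> V) (a : nat -> nat) (z : nat -> nat -> F).
Hypotheses (g_bounded : form_bounded g a (iota 0 n)) (le_cn : (c <= n)%N).
Hypothesis fE : forall j, (j < n)%N -> f j = \sum_(i <- iota 0 n) z i j *: g i.
Hypothesis z_ge : forall i j, (i < n)%N -> (j < n)%N -> dval_ge (z i j) ((a j)%:Z - (a i)%:Z).
Hypothesis z_int : forall i j, (i < n)%N -> (j < n)%N -> dval_ge (z i j) 0.
Hypothesis jump : forall i j, (i < c)%N -> (c <= j)%N -> (j < n)%N -> (a i < a j)%N.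

Definition truncation j : V := \sum_(i <- iota 0 c) z i j *: g i.

Lemma truncation_near j : (j < c)%N ->
  level_span g a (iota 0 n) ((a j)%:Z + 1) (truncation j - f j).
Proof.
move=> jc; have jn := leq_trans jc le_cn.
have -> : truncation j - f j = \sum_(i <- iota c (n - c)) - z i j *: g i.
  rewrite fE // -(subnKC le_cn) iotaD big_cat /= subnKC // opprD addrA subrr sub0r -sumrN.
  by apply: eq_bigr => i _; rewrite scaleNr.
apply: coef_span_bigsum => i; rewrite mem_iota subnKC // => /andP[ci lt_in].
apply: coef_span1; first by rewrite mem_iota.
rewrite dval_geN; apply: dval_ge_le (z_int lt_in jn) _.
by move: (jump jc ci lt_in); clear; lia.
Qed.

Lemma truncation_leading_congr I : {subset I <= iota 0 c} -> leading_congr f truncation a I.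
Proof.
move=> I_c; apply: (level_span_leading_congr g_bounded) => j /I_c; rewrite mem_iota => jc.
  rewrite fE; last exact: leq_trans jc le_cn.
  apply: coef_span_bigsum => i; rewrite mem_iota => lt_in.
  by apply: coef_span1; rewrite ?mem_iota // z_ge // (leq_trans jc).
exact: truncation_near.
Qed.

Lemma zeta_gram_at_jump (M : 'M[F]_c) ps ss : perm_eq (indices ps ss) (iota 0 c) ->
  reduced_system f a ps ss -> congruent_to_gram M f -> zeta v (gram g c) = zeta v M.
Proof.
move=> I_c redf Mf; apply/esym/(reduced_zeta I_c redf _ Mf).
  by apply: truncation_leading_congr => i; rewrite (perm_mem I_c).
apply: gram_change_basis => l lc; apply: coef_span_bigsum => i i_c.
exact: coef_span1.
Qed.

End JumpTruncation.

Section GradedNonsingular.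

Variables (n : nat) (A : 'M[F]_n) (f : nat -> V) (a : nat -> nat).
Hypothesis AE : forall i j : 'I_n, A i j = b (f i) (f j).
Hypothesis bounded : form_bounded f a (iota 0 n).

Definition combination (x : 'cV[F]_n) : V := \sum_(i < n) x i 0 *: f i.

Lemma matrix_form_combination (x y : 'cV_n) : matrix_form A x y = b (combination x) (combination y).
Proof.
rewrite /matrix_form /combination linear_sumr mxE; apply: eq_bigr => j _.
rewrite linearZr_LR mulrC linear_sumlz mxE; congr (_ * _); apply: eq_bigr => i _.
by rewrite linearZl_LR mxE AE.
Qed.

Lemma combination_single (j : 'I_n) c : combination (\col_l (if l == j then c else 0)) = c *: f j.
Proof.
rewrite /combination (bigD1 j) //= mxE eqxx big1 ?addr0 // => l /negPf lj.
by rewrite mxE lj scale0r.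
Qed.

Section RadicalVector.

Variables (m k : nat) (ps : seq (nat * nat)) (ss : seq nat) (x : 'cV[F]_n).
Hypotheses (le_kn : (k <= n)%N) (kP : forall i, (i < n)%N -> (i < k)%N = (a i <= m)%N).
Hypotheses (I_k : perm_eq (indices ps ss) (iota 0 k)) (redf : reduced_system f a ps ss).
Hypotheses (x_level : forall i : 'I_n, dval_ge (x i 0) (m%:Z - (a i)%:Z)).
Hypothesis (x_int : forall i : 'I_n, dval_ge (x i 0) 0).
Hypothesis x_norm : dval_ge (b (combination x) (combination x)) (2 * m%:Z + 2).
Hypothesis x_form : forall y : 'cV_n, in_level (mkseq a n) m y ->
  dval_ge (2 * b (combination x) (combination y)) (2 * m%:Z + 2).

Let exponent_gt (i : 'I_n) : (i : nat) \notin indices ps ss -> (m < a i)%N.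
Proof. by rewrite -(mem_indices_iota _ I_k) kP // -ltnNge. Qed.

Let exponent_le j : j \in indices ps ss -> (a j <= m)%N /\ (j < n)%N.
Proof.
rewrite -(mem_indices_iota _ I_k) => lt_jk; have lt_jn := leq_trans lt_jk le_kn.
by rewrite -kP.
Qed.

Lemma radical_form_basis j : j \in indices ps ss -> ~~ odd (a j + m) ->
  dval_ge (2 * b (combination x) (f j)) (m%:Z + (a j)%:Z + 2).
Proof.
move=> /exponent_le[le_am lt_jn] parity.
have [h mE] : exists h, m = (a j + h.*2)%N.
  by exists (m - a j)./2; move: (a j) le_am parity; clear; lia.
have := x_form (y := \col_l (if l == Ordinal lt_jn then 2 ^+ h else 0)) _.
rewrite combination_single linearZr_LR /= => x_form_j.
have -> : 2 * b (combination x) (f j) = 2 * (2 ^+ h * b (combination x) (f j)) / 2 ^+ h.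
  by have := dval_eq_neq0 (dval_eq_2X h); move: (2 ^+ h) => p p0; field.
apply: (dval_ge_div (k := 2 * m%:Z + 2)) (dval_eq_2X h) _; last by move: mE; clear; lia.
apply: x_form_j => l; rewrite mxE nth_mkseq //; case: eqP => [->|_]; last by rewrite !dval_ge0.
by rewrite !(dval_eq_ge (dval_eq_2X h)) //=; move: mE; clear; lia.
Qed.

Lemma radical_other_coord (i l : 'I_n) j : paired ps i j -> l != i ->
  dval_ge (x l 0 * (2 * b (f l) (f j))) (m%:Z + (a j)%:Z + 1).
Proof.
move=> ij li; have uniq_ps := uniq_indices_pairs (reduced_uniq redf).
have jI : j \in indices ps ss by case/andP: (paired_indices ij) => _ /indices_pair.
have [le_am lt_jn] := exponent_le jI.
have [lj|lj] := eqVneq (l : nat) j.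
  rewrite lj; apply: (dval_geM_le (x_level l) (dval_ge2M (reduced_norm redf jI) (lexx _))).
  by rewrite lj; clear; lia.
have [lI|lI] := boolP ((l : nat) \in indices ps ss).
  apply: (dval_geM_le (x_level l)); first apply: (reduced_unpaired redf lI jI lj).
    by apply: contra li => lj_pair; apply/eqP/val_inj/(paired_inj uniq_ps ij lj_pair).
  by clear; lia.
apply: (dval_geM_le (x_int l)); first by apply: bounded.2; rewrite ?mem_iota ?ltn_ord.
by move: (exponent_gt lI); clear; lia.
Qed.

Lemma radical_paired_coord (i : 'I_n) j : paired ps i j -> ~~ odd (a i + m) ->
  dval_ge (x i 0) (m.+1%:Z - (a i)%:Z).
Proof.
move=> ij parity; have pairE := reduced_paired redf ij.
have jI : j \in indices ps ss by case/andP: (paired_indices ij) => _ /indices_pair.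
have parity_j : ~~ odd (a j + m) by have [z] := dval_eq_even pairE; move: parity; clear; lia.
have x_j := radical_form_basis jI parity_j.
have : dval_ge (x i 0 * (2 * b (f i) (f j))) (m%:Z + (a j)%:Z + 1).
  have -> : x i 0 * (2 * b (f i) (f j)) =
      2 * b (combination x) (f j) - \sum_(l < n | l != i) x l 0 * (2 * b (f l) (f j)).
    rewrite /combination linear_sumlz (bigD1 i) //= mulrDr mulr_sumr.
    rewrite [X in _ = _ + X - _](eq_bigr (fun l : 'I_n => x l 0 * (2 * b (f l) (f j)))).
      by rewrite addrK linearZl_LR mulrCA.
    by move=> l _; rewrite linearZl_LR mulrCA.
  apply: dval_geB; first by apply: dval_ge_le x_j _; clear; lia.
  by apply: dval_ge_sum => l; apply: radical_other_coord.
move=> /dval_ge_div/(_ pairE) x_i; rewrite -[x i 0](mulfK (dval_eq_neq0 pairE)).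
by apply: x_i; clear; lia.
Qed.

Lemma radical_coord_not_single (i : 'I_n) : ((i : nat) \notin ss) || odd (a i + m) ->
  dval_ge (x i 0) (m.+1%:Z - (a i)%:Z).
Proof.
have [parity _|parity] := boolP (odd (a i + m)).
  by apply: (dval_ge_even (x_level i)); move: (a i) parity; clear; lia.
rewrite orbF => i_ss; have [iI|iI] := boolP ((i : nat) \in indices ps ss).
  move: iI; rewrite mem_cat (negPf i_ss) => /pair_indices_paired[j ij].
  exact: radical_paired_coord ij parity.
by apply: dval_ge_le (x_int i) _; have := exponent_gt iI; clear; lia.
Qed.

(* At most one coordinate is left: the single index of the parity of [m]. *)
Lemma radical_coord_single (i : 'I_n) : (i : nat) \in ss -> ~~ odd (a i + m) ->
  dval_ge (x i 0) (m.+1%:Z - (a i)%:Z).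
Proof.
move=> i_ss parity; pose r := \sum_(l < n | l != i) x l 0 *: f l.
have xE : combination x = x i 0 *: f i + r by rewrite /combination (bigD1 i).
have r_level : level_span f a (iota 0 n) m.+1%:Z r.
  rewrite /r -big_filter; apply: coef_span_bigsum => l; rewrite mem_filter => /andP[li _].
  apply: coef_span1; first by rewrite mem_iota ltn_ord.
  apply: radical_coord_not_single.
  have [l_ss|//] := boolP ((l : nat) \in ss).
  have := reduced_parity redf l_ss i_ss li; move: parity; move: (a i) (a l); clear; lia.
have xi_level : level_span f a (iota 0 n) m%:Z (x i 0 *: f i).
  by apply: coef_span1; rewrite ?mem_iota ?ltn_ord.
have lead_ge : dval_ge (x i 0 * x i 0 * b (f i) (f i)) (2 * m%:Z + 2).
  have -> : x i 0 * x i 0 * b (f i) (f i) =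
      b (combination x) (combination x) - (2 * b (x i 0 *: f i) r + b r r).
    by rewrite xE !bilinE [b r (f i)]bC; ring.
  apply: dval_geB => //; apply: dval_geD.
    by apply: dval_ge_even (level_span_form bounded xi_level r_level) _; clear; lia.
  by apply: dval_ge_le (level_span_norm bounded r_level) _; clear; lia.
have [->|xi0] := eqVneq (x i 0) 0; first by rewrite dval_ge0.
have /dval_eqP[norm0 normE] := reduced_single redf i_ss.
move/dval_geP: lead_ge; rewrite !mulf_neq0 // => /(_ isT); rewrite !vM ?mulf_neq0 // => lead_ge.
by apply/dval_geP => _; move: lead_ge normE; move: (v _) (v _) (a i) => p q r'; clear; lia.
Qed.

End RadicalVector.

Lemma reduced_graded_nonsingular :
  (forall m : nat, exists k ps ss,
    [/\ (k <= n)%N, forall i, (i < n)%N -> (i < k)%N = (a i <= m)%N,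
        perm_eq (indices ps ss) (iota 0 k) & reduced_system f a ps ss]) ->
  graded_nonsingular A (mkseq a n).
Proof.
move=> filtered m x x_in x_norm x_form; have [k [ps [ss [le_kn kP I_k redf]]]] := filtered m.
have x_level (i : 'I_n) : dval_ge (x i 0) (m%:Z - (a i)%:Z).
  by have /andP[] := x_in i; rewrite nth_mkseq.
have x_int (i : 'I_n) : dval_ge (x i 0) 0 by have /andP[] := x_in i.
rewrite matrix_form_combination in x_norm.
have form_ge (y : 'cV_n) : in_level (mkseq a n) m y ->
    dval_ge (2 * b (combination x) (combination y)) (2 * m%:Z + 2).
  by move=> /x_form; rewrite matrix_form_combination.
move=> i; rewrite nth_mkseq // x_int andbT.
have [/andP[i_ss parity]|] := boolP (((i : nat) \in ss) && ~~ odd (a i + m)).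
  exact: (radical_coord_single le_kn kP I_k redf).
by rewrite negb_and negbK; apply: (radical_coord_not_single le_kn kP I_k redf).
Qed.

End GradedNonsingular.

Lemma reduced_update f a ps ss k x (c : nat) : reduced_system f a ps ss -> k \notin indices ps ss ->
  reduced_system (update f k x) (update a k c) ps ss.
Proof.
by move=> redf kI; apply: (reduced_eq_in redf) => l lI; rewrite update_neq // (memPn kI l lI).
Qed.

Lemma reduced_add_single f a ps ss k x (c : nat) : reduced_system f a ps ss -> k \notin indices ps ss ->
  dval_eq (b x x) (2 * c%:Z) ->
  (forall l, l \in indices ps ss -> dval_ge (2 * b (f l) x) ((a l)%:Z + c%:Z + 1)) ->
  (forall l, l \in ss -> odd (a l + c)) ->
  reduced_system (update f k x) (update a k c) ps (k :: ss).
Proof.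
move=> redf kI x_norm x_form parity; have redf' := reduced_update x c redf kI.
have neq_k l : l \in indices ps ss -> l != k := memPn kI l.
have form_k l : l \in indices ps ss ->
    dval_ge (2 * b (update f k x l) (update f k x k)) ((update a k c l)%:Z + (update a k c k)%:Z + 1).
  by move=> lI; rewrite !update_eq !update_neq ?neq_k //; apply: x_form.
have parity_k l : l \in ss -> odd (update a k c l + update a k c k).
  move=> l_ss; rewrite !update_eq !update_neq ?parity //.
  by apply/neq_k/indices_single.
split.
- by rewrite /= -/(indices _ _) kI; apply: reduced_uniq redf.
- move=> i; rewrite in_cons => /predU1P[->|]; last exact: (reduced_norm redf').
  by rewrite !update_eq; apply: dval_eqW.
- exact: reduced_pair redf'.
- move=> i j; rewrite !in_cons => /predU1P[->|iI] /predU1P[->|jI]; rewrite ?eqxx // => ij unpaired.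
  + by rewrite bC [(update a k c k)%:Z + _]addrC; apply: form_k.
  + exact: form_k.
  exact: (reduced_unpaired redf').
- move=> i; rewrite in_cons => /predU1P[->|]; last exact: (reduced_single redf').
  by rewrite !update_eq.
move=> i j; rewrite !in_cons => /predU1P[->|iI] /predU1P[->|jI]; rewrite ?eqxx // => ij.
- by rewrite addnC; apply: parity_k.
- exact: parity_k.
exact: (reduced_parity redf').
Qed.

Lemma reduced_add_partner f a ps ss ss' i k x (c : nat) : reduced_system f a ps ss -> perm_eq ss (i :: ss') ->
  k \notin indices ps ss -> dval_ge (b x x) (2 * c%:Z) ->
  dval_eq (2 * b (f i) x) ((a i)%:Z + c%:Z) ->
  (forall l, l \in indices ps ss -> l != i -> dval_ge (2 * b (f l) x) ((a l)%:Z + c%:Z + 1)) ->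
  reduced_system (update f k x) (update a k c) ((i, k) :: ps) ss'.
Proof.
move=> redf ssE kI x_norm x_pair x_form; have redf' := reduced_update x c redf kI.
have neq_k l : l \in indices ps ss -> l != k := memPn kI l.
have i_ss : i \in ss by rewrite (perm_mem ssE) mem_head.
have iI := indices_single ps i_ss.
have form_k l : l \in indices ps ss -> l != i ->
    dval_ge (2 * b (update f k x l) (update f k x k)) ((update a k c l)%:Z + (update a k c k)%:Z + 1).
  by move=> lI li; rewrite !update_eq !update_neq ?neq_k //; apply: x_form.
have I'E := perm_indices_partner ps k ssE; have memI' := perm_mem I'E.
have sub_ss l : l \in ss' -> l \in ss by rewrite (perm_mem ssE) inE => ->; rewrite orbT.
split.
- by rewrite (perm_uniq I'E) /= kI; apply: reduced_uniq redf.
- move=> l; rewrite memI' in_cons => /predU1P[->|]; last exact: (reduced_norm redf').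
  by rewrite !update_eq.
- move=> p; rewrite in_cons => /predU1P[->|]; last exact: (reduced_pair redf').
  by rewrite /= !update_eq !update_neq ?neq_k.
- move=> l j; rewrite !memI' !in_cons => /predU1P[->|lI] /predU1P[->|jI]; rewrite ?eqxx // => lj unpaired.
  + rewrite bC [(update a k c k)%:Z + _]addrC; apply: form_k => //.
    by apply: contraNneq unpaired => ->; rewrite /paired mem_head orbT.
  + by apply: form_k => //; apply: contraNneq unpaired => ->; rewrite /paired mem_head.
  apply: (reduced_unpaired redf') => //; apply: contra unpaired.
  by rewrite /paired !in_cons => /orP[] ->; rewrite !orbT.
- by move=> l /sub_ss; apply: (reduced_single redf').
by move=> l j /sub_ss l_ss /sub_ss; apply: (reduced_parity redf').
Qed.

Lemma reduced_add_pair f a ps ss k k' x x' (c : nat) : reduced_system f a ps ss -> k != k' ->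
  k \notin indices ps ss -> k' \notin indices ps ss ->
  dval_ge (b x x) (2 * c%:Z) -> dval_ge (b x' x') (2 * c%:Z) ->
  dval_eq (2 * b x x') (c%:Z + c%:Z) ->
  (forall l, l \in indices ps ss -> dval_ge (2 * b (f l) x) ((a l)%:Z + c%:Z + 1)) ->
  (forall l, l \in indices ps ss -> dval_ge (2 * b (f l) x') ((a l)%:Z + c%:Z + 1)) ->
  reduced_system (update (update f k x) k' x') (update (update a k c) k' c) ((k, k') :: ps) ss.
Proof.
move=> redf kk' kI k'I x_norm x'_norm xx' x_form x'_form.
have redf' := reduced_update x' c (reduced_update x c redf kI) k'I.
set f' := update _ _ _ in redf' *; set a' := update _ _ _ in redf' *.
have fE l : l \in indices ps ss -> f' l = f l.
  by move=> lI; rewrite /f' !update_neq ?(memPn kI l lI) ?(memPn k'I l lI).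
have aE l : l \in indices ps ss -> a' l = a l.
  by move=> lI; rewrite /a' !update_neq ?(memPn kI l lI) ?(memPn k'I l lI).
have [fk fk'] : f' k = x /\ f' k' = x' by rewrite /f' update_eq update_neq // update_eq.
have [ak ak'] : a' k = c /\ a' k' = c by rewrite /a' update_eq update_neq // update_eq.
have I'E := perm_indices_cons ps ss (k, k'); have memI' := perm_mem I'E.
split.
- by rewrite (perm_uniq I'E) /= inE negb_or kk' kI k'I; apply: reduced_uniq redf.
- move=> l; rewrite memI' !in_cons => /or3P[/eqP->|/eqP->|]; last exact: (reduced_norm redf').
    by rewrite fk ak.
  by rewrite fk' ak'.
- move=> p; rewrite in_cons => /predU1P[->|]; last exact: (reduced_pair redf').
  by rewrite /= fk fk' ak ak'.
- have kk'_pair : paired ((k, k') :: ps) k k' by rewrite /paired mem_head.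
  move=> l j; rewrite !memI' !in_cons => /or3P[/eqP->|/eqP->|lI] /or3P[/eqP->|/eqP->|jI];
    rewrite ?eqxx ?[paired _ k' k]pairedC ?kk'_pair // => lj unpaired.
  + by rewrite fk ak fE // aE // bC [c%:Z + _]addrC; apply: x_form.
  + by rewrite fk' ak' fE // aE // bC [c%:Z + _]addrC; apply: x'_form.
  + by rewrite fk ak fE // aE //; apply: x_form.
  + by rewrite fk' ak' fE // aE //; apply: x'_form.
  apply: (reduced_unpaired redf') => //; apply: contra unpaired.
  by rewrite /paired !in_cons => /orP[] ->; rewrite !orbT.
- exact: reduced_single redf'.
exact: reduced_parity redf'.
Qed.

(* The vectors [r i] are leading-order copies of the singles orthogonal to the planes. *)
Definition orthogonal_singles f a ps ss r : Prop :=
  [/\ forall i, i \in ss -> level_span f a (indices ps ss) (a i)%:Z (r i),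
      forall i l, i \in ss -> l \in pair_indices ps -> b (f l) (r i) = 0,
      forall i j, i \in ss -> j \in ss -> b (f j) (r i) = b (r j) (r i) &
      forall i, i \in ss -> dval_eq (b (r i) (r i)) (2 * (a i)%:Z)] /\
  forall i j, i \in ss -> j \in ss -> i != j -> dval_ge (2 * b (r i) (r j)) ((a i)%:Z + (a j)%:Z + 1).

Lemma exists_orthogonal_singles f a ps ss :
  reduced_system f a ps ss -> exists r, orthogonal_singles f a ps ss r.
Proof.
move=> redf; have [r r_cleared] := clear_pairs redf; exists r.
have [near orth span] := r_cleared; have uniq_I := reduced_uniq redf.
have ss_I i : i \in ss -> i \in indices ps ss := @indices_single ps ss i.
have ps_I : {subset pair_indices ps <= indices ps ss} := @indices_pair ps ss.
have f_orth i l : i \in ss -> l \in pair_indices ps -> b (f l) (r i) = 0.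
  move=> i_ss; apply: span => m m_ps.
  apply: (orth _ _ (ps_I _ m_ps) (ss_I _ i_ss)); first 1 last.
  - by rewrite pairedC (single_not_paired _ uniq_I i_ss).
  - by apply/negP => /andP[/(single_not_pair uniq_I)]; rewrite m_ps.
  by apply: contraTneq m_ps => ->; apply: single_not_pair uniq_I i_ss.
have redr := reduced_congr redf (cleared_leading_congr redf r_cleared).
split; first split=> //.
- move=> i /ss_I iI; apply: level_span_near (near i iI) => //.
  by clear; lia.
- move=> i j i_ss j_ss; apply/eqP; rewrite -subr_eq0 -linearBl -opprB linearNl oppr_eq0; apply/eqP.
  by apply: coef_span_orth (near _ (ss_I _ j_ss)) _ => m; apply: f_orth.
- exact: (reduced_single redr).
move=> i j i_ss j_ss ij; apply: (reduced_unpaired redr (ss_I i i_ss) (ss_I j j_ss) ij).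
exact: single_not_paired uniq_I i_ss.
Qed.

(* The residue field is perfect: the leading term of [p] is minus a square times that of [q]. *)
Lemma cancel_leading_norm (p q : F) (m n : nat) :
  dval_ge p (2 * m%:Z) -> dval_eq q (2 * n%:Z) -> ~~ odd (n + m) ->
  exists s : F, [/\ dval_ge s (m%:Z - n%:Z), dval_ge (p + s ^+ 2 * q) (2 * m%:Z + 2) &
                dval_eq p (2 * m%:Z) -> dval_eq s (m%:Z - n%:Z)].
Proof.
move=> p_ge q_eq parity.
have [h hE] : exists h : int, m%:Z - n%:Z = 2 * h.
  by exists ((m%:Z - n%:Z) %/ 2)%Z; move: parity; clear; lia.
have [t t0 vt] := val_surjective h; have q0 := dval_eq_neq0 q_eq.
have t_eq : dval_eq t (m%:Z - n%:Z) by apply/dval_eqP; rewrite t0 vt hE.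
have qt_eq := dval_eqM q_eq (dval_eqX 2 t_eq).
have ratio_int : - (p / (q * t ^+ 2)) \in integers.
  by rewrite integersE dval_geN; apply: (dval_ge_div p_ge qt_eq); clear; lia.
have [s s_int near] := sqrt_congr2 ratio_int; rewrite integersE in s_int.
have cancelled : dval_ge (p + (s * t) ^+ 2 * q) (2 * m%:Z + 2).
  have -> : p + (s * t) ^+ 2 * q = (s ^+ 2 - - (p / (q * t ^+ 2))) * (q * t ^+ 2).
    by field; rewrite q0 t0.
  by apply: (dval_geM_le near (dval_eqW qt_eq)); clear; lia.
exists (s * t); split=> //; first by apply: (dval_geM_le s_int (dval_eqW t_eq)); clear; lia.
move=> p_eq; apply: dval_eq_sqr; have : dval_eq ((s * t) ^+ 2 * q) (2 * m%:Z).
  rewrite -dval_eqN; have -> : - ((s * t) ^+ 2 * q) = p - (p + (s * t) ^+ 2 * q) by ring.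
  by apply: dval_eqD p_eq _; rewrite dval_geN; apply: dval_ge_le cancelled _; clear; lia.
move=> /dval_eqM/(_ (dval_eqV q_eq)) => st_eq; apply: (dval_eq_cast st_eq); last by clear; lia.
by rewrite mulfK.
Qed.

Section NewVector.

Variables (f : nat -> V) (a : nat -> nat) (ps : seq (nat * nat)) (ss : seq nat) (k K : nat).
Hypothesis redf : reduced_system f a ps ss.
Hypothesis kI : k \notin indices ps ss.

Definition new_vector e : Prop :=
  (forall l, l \in indices ps ss -> b (f l) e = 0) /\ dval_eq (b e e) (2 * K%:Z).

Local Notation K_level_span := (level_span f a (indices ps ss) K%:Z).

Variable e : V.
Hypothesis e_new : new_vector e.

Lemma new_single : (forall l, l \in ss -> odd (a l + K)) ->
  reduced_system (update f k e) (update a k K) ps (k :: ss).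
Proof.
move=> parity; apply: (reduced_add_single redf kI e_new.2) => // l lI.
by rewrite e_new.1 // mulr0 dval_ge0.
Qed.

Section Correction.

Variable r : nat -> V.
Hypothesis r_orth : orthogonal_singles f a ps ss r.

Lemma level_span_new_orth t x z : new_vector z -> level_span f a (indices ps ss) t x -> b z x = 0.
Proof. by move=> z_new x_span; rewrite bC; apply: coef_span_orth x_span z_new.1. Qed.

Lemma new_vector_correction z i : new_vector z -> i \in ss -> ~~ odd (a i + K) ->
  exists s : F, [/\ dval_eq s (K%:Z - (a i)%:Z), K_level_span (s *: r i) &
                dval_ge (b (z + s *: r i) (z + s *: r i)) (2 * K%:Z + 2)].
Proof.
move=> z_new i_ss parity; have [[r_span _ _ r_norm] _] := r_orth.
have [s [s_ge cancelled s_eq]] := cancel_leading_norm (dval_eqW z_new.2) (r_norm i i_ss) parity.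
exists s; split; first exact: s_eq z_new.2.
  by apply: level_spanZ (r_span i i_ss) s_ge _; clear; lia.
suff -> : b (z + s *: r i) (z + s *: r i) = b z z + s ^+ 2 * b (r i) (r i) by [].
have zr : b z (r i) = 0 := level_span_new_orth z_new (r_span i i_ss).
by rewrite !bilinE [b (r i) z]bC zr; ring.
Qed.

Lemma form_correction z (s : F) i l : new_vector z -> i \in ss -> l \in indices ps ss ->
  b (f l) (z + s *: r i) = if l \in ss then s * b (r l) (r i) else 0.
Proof.
move=> z_new i_ss lI; have [[_ f_orth f_r _] _] := r_orth.
rewrite linearDr linearZr_LR z_new.1 // add0r.
by case: ifP => l_ss; [rewrite f_r | rewrite f_orth ?mulr0 //; move: lI; rewrite mem_cat l_ss].
Qed.

Lemma form_correction_same z (s : F) i : new_vector z -> i \in ss -> dval_eq s (K%:Z - (a i)%:Z) ->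
  dval_eq (2 * b (f i) (z + s *: r i)) (K%:Z + (a i)%:Z + 2).
Proof.
move=> z_new i_ss s_eq; have [[_ _ _ r_norm] _] := r_orth.
rewrite form_correction ?indices_single // i_ss.
by apply: dval_eq_cast (dval_eqM dval_eq2 (dval_eqM s_eq (r_norm i i_ss))) _ _ => //; clear; lia.
Qed.

Lemma reduced_new_pair e' i : k.+1 \notin indices ps ss -> new_vector e' -> b e e' = 0 ->
  i \in ss -> ~~ odd (a i + K) ->
  (forall j, j \in ss -> j != i -> dval_ge (2 * b (r j) (r i)) ((a i)%:Z + (a j)%:Z + 3)) ->
  exists y y', [/\ K_level_span y, K_level_span y' &
    reduced_system (update (update f k (e + y)) k.+1 (e' + y'))
      (update (update a k K.+1) k.+1 K.+1) ((k, k.+1) :: ps) ss].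
Proof.
move=> k1I e'_new ee' i_ss parity r_form; have [[r_span _ _ r_norm] _] := r_orth.
have [s [s_eq y_span norm_e]] := new_vector_correction e_new i_ss parity.
have [s' [s'_eq y'_span norm_e']] := new_vector_correction e'_new i_ss parity.
exists (s *: r i), (s' *: r i); split=> //.
have form_ge z (t : F) : new_vector z -> dval_eq t (K%:Z - (a i)%:Z) ->
    forall l, l \in indices ps ss -> dval_ge (2 * b (f l) (z + t *: r i)) ((a l)%:Z + K.+1%:Z + 1).
  move=> z_new t_eq l lI; have [->|li] := eqVneq l i.
    by apply: dval_eq_ge (form_correction_same z_new i_ss t_eq) _; clear; lia.
  rewrite form_correction //; case: ifP => [l_ss|_]; last by rewrite mulr0 dval_ge0.
  by rewrite mulrCA; apply: dval_geM_le (dval_eqW t_eq) (r_form l l_ss li) _; clear; lia.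
apply: (reduced_add_pair redf) => //; last 2 first.
- exact: form_ge.
- exact: form_ge.
- by rewrite neq_ltn ltnSn.
- by apply: dval_ge_le norm_e _; clear; lia.
- by apply: dval_ge_le norm_e' _; clear; lia.
have -> : 2 * b (e + s *: r i) (e' + s' *: r i) = 2 * (s * s' * b (r i) (r i)).
  have [er e'r] := (level_span_new_orth e_new (r_span i i_ss), level_span_new_orth e'_new (r_span i i_ss)).
  by rewrite !bilinE [b (r i) e']bC er e'r ee'; ring.
apply: dval_eq_cast (dval_eqM dval_eq2 (dval_eqM (dval_eqM s_eq s'_eq) (r_norm i i_ss))) _ _ => //.
by clear; lia.
Qed.

End Correction.

Lemma new_odd i : ss = [:: i] -> ~~ odd (a i + K) ->
  exists2 y, K_level_span y &
    reduced_system (update f k (e + y)) (update a k K.+2) ((i, k) :: ps) [::] \/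
    reduced_system (update f k (e + y)) (update a k K.+1) ps [:: k; i].
Proof.
move=> ssE parity; have i_ss : i \in ss by rewrite ssE mem_head.
have [r r_orth] := exists_orthogonal_singles redf.
have [s [s_eq y_span norm_e]] := new_vector_correction r_orth e_new i_ss parity.
exists (s *: r i) => //; have form_i := form_correction_same r_orth e_new i_ss s_eq.
have form_other l : l \in indices ps ss -> l != i -> b (f l) (e + s *: r i) = 0.
  by move=> lI li; rewrite (form_correction r_orth) // ssE inE (negPf li).
have [norm_ge|norm_lt] := boolP (dval_ge (b (e + s *: r i) (e + s *: r i)) (2 * K.+2%:Z)); [left | right].
  apply: (reduced_add_partner redf _ kI norm_ge); first by rewrite ssE.
    by apply: dval_eq_cast form_i _ _ => //; clear; lia.
  by move=> l lI li; rewrite form_other // mulr0 dval_ge0.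
rewrite -ssE; apply: (reduced_add_single redf kI) => [|l lI|l].
- apply: dval_ge_eq; first by apply: dval_ge_le norm_e _; clear; lia.
  by apply: contra norm_lt => /dval_ge_le; apply; clear; lia.
- have [->|li] := eqVneq l i; last by rewrite form_other // mulr0 dval_ge0.
  by apply: dval_eq_ge form_i _; clear; lia.
by rewrite ssE inE => /eqP->; move: parity; clear; lia.
Qed.

Lemma new_odd_pair e' i : k.+1 \notin indices ps ss -> new_vector e' -> b e e' = 0 ->
  ss = [:: i] -> ~~ odd (a i + K) ->
  exists y y', [/\ K_level_span y, K_level_span y' &
    reduced_system (update (update f k (e + y)) k.+1 (e' + y'))
      (update (update a k K.+1) k.+1 K.+1) ((k, k.+1) :: ps) [:: i]].
Proof.
move=> k1I e'_new ee' ssE parity; have i_ss : i \in ss by rewrite ssE mem_head.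
have [r r_orth] := exists_orthogonal_singles redf; rewrite -ssE.
apply: (reduced_new_pair r_orth k1I e'_new ee' i_ss parity) => j.
by rewrite ssE inE => ->.
Qed.

Section TwoSingles.

Variables (i j : nat) (r : nat -> V).
Hypotheses (ssE : ss = [:: i; j]) (parity : ~~ odd (a i + K)).
Hypothesis r_orth : orthogonal_singles f a ps ss r.

Let i_ss : i \in ss. Proof. by rewrite ssE mem_head. Qed.
Let j_ss : j \in ss. Proof. by rewrite ssE !inE eqxx orbT. Qed.
Let ij : i != j.
Proof. by have := reduced_uniq redf; rewrite ssE /= inE negb_or => /andP[/andP[]]. Qed.
Let parity_ij : odd (a i + a j). Proof. exact: (reduced_parity redf i_ss j_ss ij). Qed.

Lemma new_even_linked : ~~ dval_ge (2 * b (r i) (r j)) ((a i)%:Z + (a j)%:Z + 3) ->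
  exists2 y, K_level_span y &
    reduced_system (update f k (e + y)) (update a k K.+1) ((j, k) :: ps) [:: i].
Proof.
have [_ r_form] := r_orth => not_near.
have [s [s_eq y_span norm_e]] := new_vector_correction r_orth e_new i_ss parity.
have r_ij : dval_eq (2 * b (r i) (r j)) ((a i)%:Z + (a j)%:Z + 1).
  have [z zE] : exists z : int, (a i)%:Z + (a j)%:Z + 1 = 2 * z.
    by exists (((a i)%:Z + (a j)%:Z + 1) %/ 2)%Z; move: parity_ij; clear; lia.
  rewrite zE; apply: dval_ge_eq; first by rewrite -zE; apply: r_form.
  by apply: contra not_near => /dval_ge_le; apply; move: zE; clear; lia.
exists (s *: r i) => //; apply: (reduced_add_partner redf _ kI) => [|||l lI lj].
- by rewrite ssE -[[:: i; j]]/([:: i] ++ [:: j]) perm_catC.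
- by apply: dval_ge_le norm_e _; clear; lia.
- rewrite (form_correction r_orth) ?indices_single // j_ss [b (r j) _]bC mulrCA.
  by apply: dval_eq_cast (dval_eqM s_eq r_ij) _ _ => //; clear; lia.
have [->|li] := eqVneq l i.
  by apply: dval_eq_ge (form_correction_same r_orth e_new i_ss s_eq) _; clear; lia.
by rewrite (form_correction r_orth) // ssE !inE (negPf li) (negPf lj) mulr0 dval_ge0.
Qed.

(* After the leading term of the norm is cancelled against [r i], the next one has the parity of
   [r j] and is cancelled against it. *)
Lemma new_even_unlinked : dval_ge (2 * b (r i) (r j)) ((a i)%:Z + (a j)%:Z + 3) ->
  exists2 y, K_level_span y &
    reduced_system (update f k (e + y)) (update a k K.+2) ((i, k) :: ps) [:: j].
Proof.
have [[r_span f_orth f_r r_norm] _] := r_orth => r_ij.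
have [s [s_eq y_span norm_e]] := new_vector_correction r_orth e_new i_ss parity.
have parity_j : ~~ odd (a j + K.+1) by move: parity parity_ij; clear; lia.
have norm_ge : dval_ge (b (e + s *: r i) (e + s *: r i)) (2 * K.+1%:Z).
  by apply: dval_ge_le norm_e _; clear; lia.
have [s' [s'_ge norm_ge' _]] := cancel_leading_norm norm_ge (r_norm j j_ss) parity_j.
have f_rj l : l \in indices ps ss -> b (f l) (s' *: r j) = if l \in ss then s' * b (r l) (r j) else 0.
  move=> lI; rewrite linearZr_LR; case: ifP => l_ss; first by rewrite f_r.
  by rewrite f_orth ?mulr0 //; move: lI; rewrite mem_cat l_ss.
exists (s *: r i + s' *: r j); first apply: coef_spanD y_span _.
  by apply: level_spanZ (r_span j j_ss) s'_ge _; clear; lia.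
rewrite addrA; apply: (reduced_add_partner redf _ kI) => [|||l lI li].
- by rewrite ssE.
- have -> : b (e + s *: r i + s' *: r j) (e + s *: r i + s' *: r j) =
      b (e + s *: r i) (e + s *: r i) + s' ^+ 2 * b (r j) (r j) + s * s' * (2 * b (r i) (r j)).
    have er := level_span_new_orth e_new (r_span j j_ss).
    by rewrite !bilinE [b (r i) e]bC [b (r j) e]bC [b (r j) (r i)]bC er; ring.
  apply: dval_geD; first by apply: dval_ge_le norm_ge' _; clear; lia.
  by apply: dval_geM_le (dval_geM (dval_eqW s_eq) s'_ge) r_ij _; clear; lia.
- rewrite linearDr mulrDr (f_rj i) ?indices_single // i_ss; apply: dval_eqD.
    by apply: dval_eq_cast (form_correction_same r_orth e_new i_ss s_eq) _ _ => //; clear; lia.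
  by rewrite mulrCA; apply: dval_geM_le s'_ge r_ij _; clear; lia.
rewrite linearDr mulrDr f_rj // (form_correction r_orth) // ssE !inE (negPf li).
case: eqVneq => [->|_] /=; last by rewrite mulr0 addr0 dval_ge0.
apply: dval_geD; rewrite mulrCA.
  by rewrite bC; apply: dval_geM_le (dval_eqW s_eq) r_ij _; clear; lia.
by apply: dval_geM_le s'_ge (dval_ge2M (dval_eqW (r_norm j j_ss)) (lexx _)) _; clear; lia.
Qed.

End TwoSingles.

Lemma new_even i j : ss = [:: i; j] -> ~~ odd (a i + K) ->
  (exists2 y, K_level_span y &
     reduced_system (update f k (e + y)) (update a k K.+1) ((j, k) :: ps) [:: i]) \/
  ((exists2 y, K_level_span y &
      reduced_system (update f k (e + y)) (update a k K.+2) ((i, k) :: ps) [:: j]) /\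
   forall e', k.+1 \notin indices ps ss -> new_vector e' -> b e e' = 0 ->
     exists y y', [/\ K_level_span y, K_level_span y' &
       reduced_system (update (update f k (e + y)) k.+1 (e' + y'))
         (update (update a k K.+1) k.+1 K.+1) ((k, k.+1) :: ps) [:: i; j]]).
Proof.
move=> ssE parity; have [r r_orth] := exists_orthogonal_singles redf.
have [unlinked|linked] := boolP (dval_ge (2 * b (r i) (r j)) ((a i)%:Z + (a j)%:Z + 3)); [right | left].
  split; first exact: (new_even_unlinked ssE parity r_orth unlinked).
  move=> e' k1I e'_new ee'; rewrite -ssE.
  have i_ss : i \in ss by rewrite ssE mem_head.
  apply: (reduced_new_pair r_orth k1I e'_new ee' i_ss parity) => l.
  by rewrite ssE !inE => /orP[->//|/eqP-> _]; rewrite bC.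
exact: (new_even_linked ssE parity r_orth linked).
Qed.

End NewVector.
End ReducedSystems.

(** * Pre-optimal forms *)

Section Blocks.

Implicit Types (c : blk F) (s : seq (nat * blk F)).

Lemma degs_cat s1 s2 : degs (s1 ++ s2) = (degs s1 + degs s2)%N.
Proof. by rewrite /degs map_cat sumn_cat. Qed.

Lemma blk_entryC c i j : blk_entry c i j = blk_entry c j i.
Proof.
case: c => [s|x y z] /=; first by rewrite eq_sym; case: eqP => // ->.
by rewrite [(j == 0%N) && _]andbC [(j == 1%N) && (i == 1%N)]andbC orbC [(j == 0%N) && _]andbC
  [(j == 1%N) && _]andbC.
Qed.

Lemma entC s i j : ent s i j = ent s j i.
Proof.
elim: s i j => [|[k c] s IH] i j //=.
by rewrite [(j < _)%N && _]andbC [(_ <= j)%N && _]andbC blk_entryC IH.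
Qed.

Lemma ent_catl s1 s2 i j : (i < degs s1)%N -> (j < degs s1)%N -> ent (s1 ++ s2) i j = ent s1 i j.
Proof.
elim: s1 i j => [|[k c] s1 IH] i j //=; rewrite /degs /= -/(degs s1) => lt_i lt_j.
by case: ifP => // _; case: ifP => // /andP[le_i le_j]; apply: IH; lia.
Qed.

Lemma ent_catr s1 s2 i j : ent (s1 ++ s2) (degs s1 + i) (degs s1 + j) = ent s2 i j.
Proof.
elim: s1 i j => [|[k c] s1 IH] i j //=; rewrite /degs /= -/(degs s1).
have -> : (deg c + degs s1 + i < deg c)%N = false by lia.
have -> : (deg c <= deg c + degs s1 + i)%N by lia.
have -> : (deg c <= deg c + degs s1 + j)%N by lia.
by rewrite /= -!addnA !addKn.
Qed.

Lemma ent_cat0 s1 s2 i j : (i < degs s1)%N -> (degs s1 <= j)%N -> ent (s1 ++ s2) i j = 0.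
Proof.
elim: s1 i j => [|[k c] s1 IH] i j //=; rewrite /degs /= -/(degs s1) => lt_i le_j.
have -> : (j < deg c)%N = false by lia.
by rewrite andbF; case: ifP => // /andP[le_i _]; apply: IH; lia.
Qed.

Definition std_basis n j : 'cV[F]_n := \col_i (i == j :> nat)%:R.

Lemma matrix_form_std_basis n (M : 'M[F]_n) (i j : 'I_n) :
  matrix_form M (std_basis n i) (std_basis n j) = M i j.
Proof.
have basisE (l : 'I_n) : std_basis n l = col l 1%:M by apply/colP => x; rewrite !mxE.
by rewrite !basisE matrix_form_col trmx1 mul1mx mulmx1.
Qed.

Lemma mxe_ord n (M : 'M[F]_n) (i j : 'I_n) : mxe M i j = M i j.
Proof. by rewrite /mxe !valK. Qed.

Lemma det_gram_last (V : lmodType F) (b : {biscalar V}) (f : nat -> V) k :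
  (forall l, (l < k)%N -> b (f k) (f l) = 0) ->
  \det (gram b f k.+1) = b (f k) (f k) * \det (gram b f k).
Proof.
move=> last_orth; rewrite (expand_det_row _ ord_max) (bigD1 ord_max) //= big1 ?addr0 => [|j jm].
  rewrite mxE /cofactor /= addnn -signr_odd odd_double expr0 mul1r; congr (_ * \det _).
  by apply/matrixP => i j; rewrite !mxE !lift_max.
rewrite mxE last_orth ?mul0r // ltn_neqAle -ltnS ltn_ord andbT.
by apply: contra jm => /eqP jk; apply/eqP/val_inj.
Qed.

End Blocks.

Section PreOptimalForms.

Variable bl : seq (nat * blk F).

Let no_block : nat * blk F := (0%N, BD [::]).

Local Notation offset t := (degs (take t bl)).
Local Notation n := (degs bl).
Local Notation e := (std_basis n).
Local Notation b := (matrix_form (assemble bl)).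

Lemma offsetS t : (t < size bl)%N -> offset t.+1 = (offset t + deg (Cb bl t.+1))%N.
Proof. by move=> lt_t; rewrite (take_nth no_block lt_t) -cats1 degs_cat /degs /= addn0. Qed.

Lemma offset_le_degs t : (offset t <= n)%N.
Proof. by rewrite -{2}(cat_take_drop t bl) degs_cat leq_addr. Qed.

Lemma ent_take t i j : (i < offset t)%N -> (j < offset t)%N -> ent (take t bl) i j = ent bl i j.
Proof. by move=> lt_i lt_j; rewrite -{2}(cat_take_drop t bl) ent_catl. Qed.

Lemma ent_across_offset t i j : (i < offset t)%N -> (offset t <= j)%N -> ent bl i j = 0.
Proof. by move=> lt_i le_j; rewrite -(cat_take_drop t bl) ent_cat0. Qed.

Lemma ent_block t x y :
  (t < size bl)%N -> (x < deg (Cb bl t.+1))%N -> (y < deg (Cb bl t.+1))%N ->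
  ent bl (offset t + x) (offset t + y) = 2 ^+ (kb bl t.+1) * blk_entry (Cb bl t.+1) x y.
Proof.
move=> lt_t; rewrite /Cb /kb /= -/no_block => lt_x lt_y.
rewrite -{1}(cat_take_drop t bl) ent_catr (drop_nth no_block lt_t).
by case: (nth no_block bl t) lt_x lt_y => k c /= -> ->.
Qed.

Lemma assemble_sym : (assemble bl)^T = assemble bl.
Proof. by apply/matrixP => i j; rewrite !mxE entC. Qed.

Let bC := matrix_formC assemble_sym.

Lemma form_std_basis i j : (i < n)%N -> (j < n)%N -> b (e i) (e j) = ent bl i j.
Proof.
move=> lt_i lt_j.
by have := matrix_form_std_basis (assemble bl) (Ordinal lt_i) (Ordinal lt_j); rewrite mxE.
Qed.

Lemma form_across_offset t i j : (i < offset t)%N -> (offset t <= j)%N -> b (e i) (e j) = 0.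
Proof.
move=> lt_i le_j; have [lt_jn|le_nj] := ltnP j n.
  by rewrite form_std_basis ?(ent_across_offset lt_i le_j) // (leq_trans lt_i) ?offset_le_degs.
have -> : e j = 0 by apply/colP => x; rewrite !mxE (ltn_eqF (leq_trans (ltn_ord x) le_nj)).
exact: linear0r.
Qed.

Lemma Bpre_gram t : Bpre bl t = gram b e (offset t).
Proof.
have lt_n i : (i < offset t)%N -> (i < n)%N by move/leq_trans; apply; apply: offset_le_degs.
by apply/matrixP => i j; rewrite [LHS]mxE [RHS]mxE ent_take //= form_std_basis ?lt_n.
Qed.

Lemma ulsub_assemble t : ulsub (offset t) (assemble bl) = Bpre bl t.
Proof.
have lt_n i : (i < offset t)%N -> (i < n)%N by move/leq_trans; apply; apply: offset_le_degs.
apply/matrixP => i j; rewrite !mxE ent_take //.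
have := mxe_ord (assemble bl) (Ordinal (lt_n i (ltn_ord i))) (Ordinal (lt_n j (ltn_ord j))).
by rewrite mxE.
Qed.

Local Notation reduced_system := (reduced_system b).
Local Notation integral_span I := (coef_span e I (fun _ c => dval_ge c 0)).
Local Notation unitriangular m f := (forall l, (l < m)%N -> integral_span (iota 0 l) (f l - e l)).
Local Notation exponents_le a m c := (forall l, (l < m)%N -> (a l <= c)%N).

Implicit Types (f : nat -> 'cV[F]_n) (a : nat -> nat) (ps : seq (nat * nat)) (ss : seq nat).

Lemma integral_span_le i j x : (i <= j)%N -> integral_span (iota 0 i) x -> integral_span (iota 0 j) x.
Proof.
by move=> ij /coef_span_sub; apply=> // l; rewrite !mem_iota /= => /leq_trans; apply.
Qed.

Lemma integral_span_basis l m : (l < m)%N -> integral_span (iota 0 m) (e l).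
Proof. by move=> lm; rewrite -[e l]scale1r; apply: coef_span1; rewrite ?mem_iota ?dval_ge1. Qed.

Lemma integral_spanZ m c x : dval_ge c 0 -> integral_span (iota 0 m) x -> integral_span (iota 0 m) (c *: x).
Proof. by move=> c_int x_span; apply: coef_spanZ x_span _ => i d d_int; apply: dval_geM_le c_int d_int _. Qed.

Lemma unitriangular_span m f l : unitriangular m f -> (l < m)%N -> integral_span (iota 0 m) (f l).
Proof.
move=> f_tri lm; rewrite -[f l](subrK (e l)); apply: coef_spanD; last exact: integral_span_basis.
by apply: integral_span_le (f_tri _ lm); apply: ltnW.
Qed.

Lemma unitriangular_update m f y : unitriangular m f -> integral_span (iota 0 m) y ->
  unitriangular m.+1 (update f m (e m + y)).
Proof.
move=> f_tri y_span l; rewrite ltnS leq_eqVlt => /predU1P[->|lm].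
  by rewrite update_eq addrAC subrr add0r.
by rewrite update_neq ?ltn_eqF //; apply: f_tri.
Qed.

Lemma exponents_le_update a m c M : exponents_le a m M -> (c <= M)%N -> exponents_le (update a m c) m.+1 M.
Proof.
move=> a_le cM l; rewrite ltnS leq_eqVlt => /predU1P[->|lm]; first by rewrite update_eq.
by rewrite update_neq ?ltn_eqF // a_le.
Qed.

(* The exponents exceed [K] by at most 1, so coefficients of valuation [(K - a_i) / 2] are integral. *)
Lemma level_span_integral m f a K ps ss y : unitriangular m f ->
  perm_eq (indices ps ss) (iota 0 m) -> exponents_le a m K.+1 ->
  level_span f a (indices ps ss) K%:Z y -> integral_span (iota 0 m) y.
Proof.
move=> f_tri I_m a_le; elim: y / => [|y l c _ IH lI c_ge]; first exact: coef_span0.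
have lm : (l < m)%N by rewrite (mem_indices_iota _ I_m).
apply: coef_spanD => //; apply: integral_spanZ (unitriangular_span f_tri lm).
by apply: dval_ge_even c_ge _; have := a_le l lm; clear; lia.
Qed.

Lemma integral_span_orth t x q : integral_span (iota 0 (offset t)) x -> (offset t <= q)%N -> b x (e q) = 0.
Proof.
move=> x_span le_q; apply: coef_span_orth x_span _ => m; rewrite mem_iota => lt_m.
exact: form_across_offset lt_m le_q.
Qed.

Lemma Bpre_congruent_to_gram t f : unitriangular (offset t) f -> congruent_to_gram b (Bpre bl t) f.
Proof.
move=> f_tri; rewrite /congruent_to_gram Bpre_gram; apply: gram_change_basis => l lt_l.
exact: (lin_span_of (unitriangular_span f_tri lt_l)).
Qed.

Definition reduced_prefix f a m : Prop := exists t ps ss,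
  [/\ (t <= size bl)%N, offset t = m, perm_eq (indices ps ss) (iota 0 m) & reduced_system f a ps ss].

(* After [t] blocks: the vectors [f l], [l < offset t], form a reduced system, the exponents are
   non-decreasing, and every jump of the exponents occurs at the end of a block. *)
Record stage (t : nat) f a ps ss : Prop := {
  stage_perm : perm_eq (indices ps ss) (iota 0 (offset t));
  stage_reduced : reduced_system f a ps ss;
  stage_unitriangular : unitriangular (offset t) f;
  stage_monotone : forall i j, (i <= j)%N -> (j < offset t)%N -> (a i <= a j)%N;
  stage_jumps : forall c, (c.+1 < offset t)%N -> (a c < a c.+1)%N -> reduced_prefix f a c.+1 }.

Lemma stage_perm_singles t f a ps ss ss' : perm_eq ss ss' -> stage t f a ps ss -> stage t f a ps ss'.
Proof.
move=> ssE [I_t redf f_tri a_mono jumps]; split=> //; last exact: reduced_perm ssE redf.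
by rewrite perm_sym in ssE; apply: perm_trans (perm_indices_single ps ssE) I_t.
Qed.

Lemma stage_invariants t f a ps ss : stage t f a ps ss -> singles_invariants (Bpre bl t) a ss.
Proof.
move=> [I_t redf f_tri _ _].
exact: (reduced_invariants bC I_t redf (Bpre_congruent_to_gram f_tri)).
Qed.

Lemma reduced_prefix_eq f f' a a' m : (forall l, (l < m)%N -> f' l = f l) ->
  (forall l, (l < m)%N -> a' l = a l) -> reduced_prefix f a m -> reduced_prefix f' a' m.
Proof.
move=> ff' aa' [t [ps [ss [t_le tE I_m redf]]]]; exists t, ps, ss; split=> //.
by apply: (reduced_eq_in redf) => l; rewrite -(mem_indices_iota _ I_m) => lm; rewrite ?ff' ?aa'.
Qed.

Lemma stage_extend t t' f a ps ss f' a' ps' ss' c : stage t f a ps ss ->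
  (t <= t')%N -> (t' <= size bl)%N ->
  (forall l, (l < offset t)%N -> f' l = f l) -> (forall l, (l < offset t)%N -> a' l = a l) ->
  perm_eq (indices ps' ss') (iota 0 (offset t')) -> reduced_system f' a' ps' ss' ->
  (forall l, (offset t <= l < offset t')%N -> integral_span (iota 0 l) (f' l - e l)) ->
  (forall l, (offset t <= l < offset t')%N -> a' l = c) ->
  exponents_le a (offset t) c -> stage t' f' a' ps' ss'.
Proof.
move=> [I_t redf f_tri a_mono jumps] tt' t'_le ff' aa' I_t' redf' f'_tri a'_new a_le; split=> //.
- move=> l lt'; have [lt|le_t] := ltnP l (offset t); last by apply: f'_tri; rewrite le_t.
  by rewrite ff' //; apply: f_tri.
- move=> i j ij jt'; have [jt|tj] := ltnP j (offset t).
    by rewrite !aa' ?(leq_ltn_trans ij) //; apply: a_mono.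
  rewrite (a'_new j) ?tj //; have [it|ti] := ltnP i (offset t); first by rewrite aa' // a_le.
  by rewrite a'_new // ti (leq_ltn_trans ij).
move=> i it'; have [it|] := ltnP i.+1 (offset t).
  rewrite !aa' // ?(ltnW it) // => jump_i; apply: reduced_prefix_eq (jumps i it jump_i) => l li.
    by rewrite ff' // (leq_trans li (ltnW it)).
  by rewrite aa' // (leq_trans li (ltnW it)).
rewrite leq_eqVlt => /predU1P[tE|ti] jump_i; last first.
  have new_i : a' i = c by apply: a'_new; rewrite -ltnS ti ltnW.
  have new_iS : a' i.+1 = c by apply: a'_new; rewrite it' ltnW.
  by rewrite new_i new_iS ltnn in jump_i.
rewrite -tE; apply: (reduced_prefix_eq ff' aa').
by exists t, ps, ss; split=> //; apply: leq_trans tt' t'_le.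
Qed.

Section AddToStage.

Variables (t : nat) (f : nat -> 'cV[F]_n) (a : nat -> nat) (ps : seq (nat * nat)) (ss : seq nat).
Hypothesis stage_t : stage t f a ps ss.

Local Notation k := (offset t).

Lemma stage_notin q : (k <= q)%N -> q \notin indices ps ss.
Proof. by rewrite -(mem_indices_iota _ (stage_perm stage_t)) -leqNgt. Qed.

Lemma stage_orth q l : (k <= q)%N -> l \in indices ps ss -> b (f l) (e q) = 0.
Proof.
rewrite -(mem_indices_iota _ (stage_perm stage_t)) => kq lk.
exact: integral_span_orth (unitriangular_span (stage_unitriangular stage_t) lk) kq.
Qed.

Lemma stage_add_one y c ps' ss' : (t < size bl)%N -> offset t.+1 = k.+1 ->
  integral_span (iota 0 k) y -> exponents_le a k c ->
  perm_eq (indices ps' ss') (k :: indices ps ss) ->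
  reduced_system (update f k (e k + y)) (update a k c) ps' ss' ->
  stage t.+1 (update f k (e k + y)) (update a k c) ps' ss'.
Proof.
move=> lt_t kE y_span a_le I'E redf'.
have new_k l : (k <= l < offset t.+1)%N -> l = k.
  by rewrite kE ltnS => kl; apply/eqP; rewrite eqn_leq andbC.
apply: (stage_extend stage_t (c := c)) => //.
- by move=> l lk; rewrite update_neq // ltn_eqF.
- by move=> l lk; rewrite update_neq // ltn_eqF.
- by rewrite kE; apply: perm_iotaS I'E (stage_perm stage_t).
- by move=> l /new_k ->; rewrite update_eq addrAC subrr add0r.
by move=> l /new_k ->; rewrite update_eq.
Qed.

Lemma stage_add_two t' y y' c ps' ss' : (t < t')%N -> (t' <= size bl)%N -> offset t' = k.+2 ->
  integral_span (iota 0 k) y -> integral_span (iota 0 k.+1) y' -> exponents_le a k c ->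
  perm_eq (indices ps' ss') (iota 0 k.+2) ->
  reduced_system (update (update f k (e k + y)) k.+1 (e k.+1 + y'))
    (update (update a k c) k.+1 c) ps' ss' ->
  stage t' (update (update f k (e k + y)) k.+1 (e k.+1 + y'))
    (update (update a k c) k.+1 c) ps' ss'.
Proof.
move=> tt' t'_le kE y_span y'_span a_le I'E redf'.
have new_k l : (k <= l < offset t')%N -> l = k \/ l = k.+1.
  rewrite kE; case: (ltngtP l k) => //= [kl|->]; last by left.
  by rewrite ltnS => lk; right; apply/eqP; rewrite eqn_leq lk.
have kk : k != k.+1 by rewrite neq_ltn ltnSn.
apply: (stage_extend stage_t (c := c)) => //; first exact: ltnW.
- by move=> l lk; rewrite !update_neq // ltn_eqF // ltnW.
- by move=> l lk; rewrite !update_neq // ltn_eqF // ltnW.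
- by rewrite kE.
- by move=> l /new_k[]->; rewrite ?update_eq ?(update_neq _ _ kk) ?update_eq addrAC subrr add0r.
by move=> l /new_k[]->; rewrite ?update_eq ?(update_neq _ _ kk) ?update_eq.
Qed.

End AddToStage.

Section Induction.

Hypotheses (bl_ok : all (fun p => blk_ok v p.2) bl) (bl_po : pre_optimal v bl).

Lemma blk_ok_nth t : (t < size bl)%N -> blk_ok v (Cb bl t.+1).
Proof. by move=> lt_t; have /(all_nthP no_block)/(_ t lt_t) := bl_ok. Qed.

Lemma deg_gt0 t : (t < size bl)%N -> (0 < deg (Cb bl t.+1))%N.
Proof. by move=> /blk_ok_nth; case: (Cb bl t.+1) => //= s /andP[]. Qed.

Lemma diagonal_norm t x : (t < size bl)%N -> isD (Cb bl t.+1) -> (x < deg (Cb bl t.+1))%N ->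
  dval_eq (b (e (offset t + x)) (e (offset t + x))) (2 * (kb bl t.+1)%:Z).
Proof.
move=> lt_t diag lt_x; have lt_n : (offset t + x < n)%N.
  by apply: leq_trans (offset_le_degs t.+1); rewrite offsetS // ltn_add2l.
rewrite form_std_basis // ent_block //; have := blk_ok_nth lt_t.
case: (Cb bl t.+1) diag lt_x => //= s _ lt_x /andP[_ /allP units]; rewrite eqxx.
have := units _ (mem_nth 0 lt_x); rewrite unit_oE => unit_x.
by apply: dval_eq_cast (dval_eqM (dval_eq_2X _) unit_x) _ _ => //; clear; lia.
Qed.

Lemma even_block_valuations (x y z : F) : blk_ok v (BE x y z) ->
  [/\ dval_ge x 0, dval_ge z 0 & dval_eq (2 * y) 0].
Proof.
rewrite /= !vgeE -[integral v _]/(_ \in integers) unit_oE => /and4P[x_ge z_ge _ disc_unit].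
split; [exact: dval_ge2M_inv x_ge | exact: dval_ge2M_inv z_ge |].
apply: dval_eq_sqr; have -> : (2 * y) ^+ 2 = - (2 * x * (2 * z) - (2 * y) ^+ 2) + 2 * x * (2 * z) by ring.
by apply: dval_eqD; [rewrite dval_eqN | apply: dval_geM_le x_ge z_ge _].
Qed.

Lemma nondiagonal_form t : (t < size bl)%N -> ~~ isD (Cb bl t.+1) ->
  [/\ offset t.+1 = (offset t).+2,
      dval_ge (b (e (offset t)) (e (offset t))) (2 * (kb bl t.+1)%:Z),
      dval_ge (b (e (offset t).+1) (e (offset t).+1)) (2 * (kb bl t.+1)%:Z) &
      dval_eq (2 * b (e (offset t)) (e (offset t).+1)) ((kb bl t.+1)%:Z + (kb bl t.+1)%:Z)].
Proof.
move=> lt_t nondiag; have block_ok := blk_ok_nth lt_t.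
have deg2 : deg (Cb bl t.+1) = 2%N by case: (Cb bl t.+1) nondiag.
have offE : offset t.+1 = (offset t).+2 by rewrite offsetS // deg2 addn2.
have lt_n1 : ((offset t).+1 < n)%N by rewrite -offE offset_le_degs.
have entE x y : (x < 2)%N -> (y < 2)%N ->
    ent bl (offset t + x) (offset t + y) = 2 ^+ (kb bl t.+1) * blk_entry (Cb bl t.+1) x y.
  by move=> lt_x lt_y; apply: ent_block; rewrite ?deg2.
have := (entE 0 0 isT isT, entE 1 1 isT isT, entE 0 1 isT isT)%N.
rewrite addn0 addn1 !form_std_basis ?(ltnW lt_n1) // => -[[-> ->] ->].
split=> //; move: nondiag block_ok {deg2 entE};
  case: (Cb bl t.+1) => //= x y z _ /even_block_valuations[x_ge z_ge y_eq].
- by apply: dval_geM_le (dval_eqW (dval_eq_2X _)) x_ge _; clear; lia.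
- by apply: dval_geM_le (dval_eqW (dval_eq_2X _)) z_ge _; clear; lia.
rewrite mulrCA; apply: dval_eq_cast (dval_eqM (dval_eq_2X _) y_eq) _ _ => //.
by clear; lia.
Qed.

Definition next_diagonal t K : Prop := [/\ (t < size bl)%N, isD (Cb bl t.+1) & kb bl t.+1 = K].

Lemma diagonal_degree_le2 js K : uniq js ->
  (forall j, j \in js -> (1 <= j <= size bl)%N /\ (kb bl j == K) && isD (Cb bl j)) ->
  (\sum_(j <- js) deg (Cb bl j) <= 2)%N.
Proof.
move=> uniq_js js_diag; have [po1 _] := bl_po; apply: leq_trans (po1 K).
rewrite big_seq; rewrite (eq_bigl (fun j => (j \in js) && ((kb bl j == K) && isD (Cb bl j)))); last first.
  by move=> j; case: (boolP (j \in js)) => //= /js_diag[_ ->].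
rewrite -big_seq_cond; apply: (uniq_sub_le_big leqnn (fun p q => leq_addr q p)) => // [|j /js_diag[j_le _]].
  exact: iota_uniq.
by rewrite mem_index_iota ltnS.
Qed.

Lemma diagonal_deg_le2 t : (t < size bl)%N -> isD (Cb bl t.+1) -> (deg (Cb bl t.+1) <= 2)%N.
Proof.
move=> lt_t diag; have := @diagonal_degree_le2 [:: t.+1] (kb bl t.+1).
by rewrite big_seq1; apply=> // j; rewrite inE => /eqP->; rewrite ltnS lt_t eqxx diag.
Qed.

Lemma next_diagonal_degree t : (t < size bl)%N -> isD (Cb bl t.+1) ->
  next_diagonal t.+1 (kb bl t.+1) -> (deg (Cb bl t.+1) + deg (Cb bl t.+2) <= 2)%N.
Proof.
move=> lt_t diag [lt_tS diagS scaleS]; have := @diagonal_degree_le2 [:: t.+1; t.+2] (kb bl t.+1).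
rewrite big_cons big_seq1; apply; first by rewrite /= inE neq_ltn ltnSn.
by move=> j; rewrite !inE => /orP[]/eqP->; rewrite ltnS ?lt_t ?lt_tS ?diag ?diagS ?scaleS eqxx.
Qed.

Lemma no_third_diagonal t : (t < size bl)%N -> isD (Cb bl t.+1) ->
  next_diagonal t.+1 (kb bl t.+1) -> ~ next_diagonal t.+2 (kb bl t.+1).
Proof.
move=> lt_t diag [lt_tS diagS scaleS] [lt_tSS diagSS scaleSS].
have := @diagonal_degree_le2 [:: t.+1; t.+2; t.+3] (kb bl t.+1).
have := (deg_gt0 lt_t, deg_gt0 lt_tS, deg_gt0 lt_tSS); rewrite !big_cons big_nil.
move=> [[deg1 deg2] deg3] deg_le; suff : (2 < 2)%N by [].
apply: (@leq_trans (deg (Cb bl t.+1) + (deg (Cb bl t.+2) + (deg (Cb bl t.+3) + 0)))).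
  by move: deg1 deg2 deg3; clear; lia.
apply: deg_le => [|j]; first by rewrite /= !inE; clear; lia.
by rewrite !inE => /or3P[]/eqP->;
  rewrite ltnS ?lt_t ?lt_tS ?lt_tSS ?diag ?diagS ?diagSS ?scaleS ?scaleSS eqxx.
Qed.

(* How far the exponents may exceed the scale of the last block; (PO1)-(PO6) exclude the blocks
   that would then break the monotonicity of [a]. *)
Definition exponent_bound t a ss : Prop := (0 < t)%N ->
  if isD (Cb bl t) then
    [\/ exponents_le a (offset t) (kb bl t),
        exponents_le a (offset t) (kb bl t).+1 /\
          (next_diagonal t (kb bl t) -> exists2 s, ss = [:: s] & ~~ odd (a s + kb bl t)) |
        [/\ exponents_le a (offset t) (kb bl t).+2, ~ next_diagonal t (kb bl t) &
          ss = [::] \/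
          exists s, [/\ ss = [:: s], odd (a s + kb bl t), xi v (Bpre bl t.-1) = 0 & (2 <= t)%N]]]
  else exponents_le a (offset t) (kb bl t).

Lemma exponent_bound_perm t a ss ss' : perm_eq ss ss' -> exponent_bound t a ss -> exponent_bound t a ss'.
Proof.
move=> ssE bound; suff small : (size ss <= 1)%N -> ss = ss'.
  move=> /bound; case: ifP => // _ [a_le|[a_le single]|[a_le last_diag single]].
  - exact: Or31.
  - apply: Or32; split=> // /single[s sE parity]; exists s => //.
    by rewrite -small // sE.
  - apply: Or33; split=> //; case: single => [sE|[s [sE parity xi0 t2]]].
      by left; rewrite -small sE.
    by right; exists s; rewrite -small ?sE.
by rewrite (perm_size ssE) => /perm_small_eq; apply.
Qed.

Section Bounds.

Variables (t : nat) (f : nat -> 'cV[F]_n) (a : nat -> nat) (ps : seq (nat * nat)) (ss : seq nat).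
Hypotheses (stage_t : stage t f a ps ss) (bound_t : exponent_bound t a ss) (lt_t : (t < size bl)%N).

Local Notation k := (offset t).
Local Notation K := (kb bl t.+1).
Local Notation singles_odd := (forall s, s \in ss -> odd (a s + K)).

Lemma offset_gt0 l : (l < k)%N -> (0 < t)%N.
Proof. by case: t => //; rewrite take0. Qed.

Lemma scale_growth : (0 < t)%N ->
  [/\ isD (Cb bl t) -> isD (Cb bl t.+1) -> (kb bl t <= K)%N,
      ~~ isD (Cb bl t) -> ~~ isD (Cb bl t.+1) -> (kb bl t <= K)%N,
      isD (Cb bl t) -> ~~ isD (Cb bl t.+1) -> (kb bl t < K)%N &
      ~~ isD (Cb bl t) -> isD (Cb bl t.+1) -> (kb bl t <= K.+1)%N].
Proof. by move=> t0; have [_ [_ [po2 _]]] := bl_po; have := po2 t t.+1 t0 (ltnSn t) lt_t; rewrite !addn1. Qed.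

Lemma diagonal_scale_lt : isD (Cb bl t) -> isD (Cb bl t.+1) -> (0 < t)%N ->
  ~ next_diagonal t (kb bl t) -> (kb bl t < K)%N.
Proof.
move=> diag_t diag t0 last_diag; have [le_K _ _ _] := scale_growth t0.
by rewrite ltn_neqAle le_K // andbT; apply/eqP => kE; apply: last_diag.
Qed.

Lemma exponents_le_diagonal : isD (Cb bl t.+1) -> exponents_le a k K.+1.
Proof.
move=> diag l lk; have t0 := offset_gt0 lk; have [le_K _ _ le_KS] := scale_growth t0.
have := bound_t t0; case: ifP => [diag_t|/negbT diag_t] a_le; last exact: leq_trans (a_le _ lk) (le_KS _ _).
case: a_le => [a_le|[a_le _]|[a_le last_diag _]]; apply: leq_trans (a_le _ lk) _.
- exact: leqW (le_K _ _).
- by rewrite ltnS le_K.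
by rewrite ltnS diagonal_scale_lt.
Qed.

Lemma exponents_le_nondiagonal : ~~ isD (Cb bl t.+1) -> exponents_le a k K.
Proof.
move=> nondiag l lk; have t0 := offset_gt0 lk; have [_ le_K lt_K _] := scale_growth t0.
have := bound_t t0; case: ifP => [diag_t|/negbT diag_t] a_le; last exact: leq_trans (a_le _ lk) (le_K _ _).
case: a_le => [a_le|[a_le _]|[a_le last_diag single]]; apply: leq_trans (a_le _ lk) _.
- exact: ltnW (lt_K _ _).
- exact: lt_K.
rewrite ltn_neqAle lt_K // andbT; apply/eqP => kE.
have [_ [_ [_ [_ [_ [po5 _]]]]]] := bl_po.
have [] := po5 t t0 lt_t diag_t nondiag _; first by rewrite addn1.
move=> _; have := stage_invariants stage_t; case: single => [->|[s [-> _ xi0 t2]]] /=.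
  move=> [k_even _ det_even] [[_ det_odd]|[k_odd _]]; last by rewrite k_odd in k_even.
  by move: det_odd; rewrite /ord_det_odd (negPf det_even).
move=> [k_odd _ _] [[k_even _]|[_ xi_neq0]]; first by rewrite k_odd in k_even.
by have := xi_neq0 t2; rewrite xi0 eqxx.
Qed.

Lemma diagonal_scale_not_succ : isD (Cb bl t) -> isD (Cb bl t.+1) -> (0 < t)%N -> ss = [::] ->
  K != (kb bl t).+1.
Proof.
move=> diag_t diag t0 ss0; have [_ [_ [_ [_ [_ [_ po6]]]]]] := bl_po.
have := stage_invariants stage_t; rewrite ss0 /= => -[k_even xi_neq0 _]; apply: contraNneq xi_neq0 => kE.
by rewrite (po6 t t0 lt_t k_even diag_t diag) // addn1.
Qed.

Lemma exponents_le_after_diagonal : isD (Cb bl t) -> isD (Cb bl t.+1) -> singles_odd -> exponents_le a k K.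
Proof.
move=> diag_t diag s_odd l lk; have t0 := offset_gt0 lk; have [le_K _ _ _] := scale_growth t0.
have := bound_t t0; rewrite diag_t => -[a_le|[a_le single]|[a_le last_diag single]].
- by apply: leq_trans (a_le _ lk) (le_K _ _).
- apply: leq_trans (a_le _ lk) _; rewrite ltn_neqAle le_K // andbT; apply/eqP => kE.
  have [//|s ssE] := single; have := s_odd s; rewrite ssE mem_head -kE => /(_ isT)->.
  by [].
apply: leq_trans (a_le _ lk) _; rewrite ltn_neqAle diagonal_scale_lt // andbT eq_sym.
case: single => [ss0|[s [ssE s_odd_t _ _]]]; first exact: diagonal_scale_not_succ.
apply/eqP => kE; have := s_odd s; rewrite ssE mem_head kE addnS /= s_odd_t.
by move/(_ isT).
Qed.

Lemma det_Bpre_next : isD (Cb bl t.+1) -> deg (Cb bl t.+1) = 1%N ->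
  \det (Bpre bl t.+1) = b (e k) (e k) * \det (Bpre bl t).
Proof.
move=> diag deg1; have offE : offset t.+1 = k.+1 by rewrite offsetS // deg1 addn1.
rewrite !Bpre_gram offE det_gram_last // => l lk.
by rewrite /= bC (form_across_offset lk).
Qed.

Lemma nondiagonal_scale_le : ~~ isD (Cb bl t) -> isD (Cb bl t.+1) -> deg (Cb bl t.+1) = 1%N ->
  (0 < t)%N -> singles_odd -> (kb bl t <= K)%N.
Proof.
move=> nondiag_t diag deg1 t0 s_odd; have [_ _ _ le_KS] := scale_growth t0.
rewrite leqNgt; apply/negP => lt_K.
have kE : (K + 1 = kb bl t)%N by apply/eqP; rewrite eqn_leq addn1 lt_K le_KS.
have [_ [_ [_ [_ [po4 _]]]]] := bl_po.
have [|deg2|[_]] := po4 t.+1 _ kE diag nondiag_t; [by rewrite !ltnS t0 | by rewrite deg1 in deg2 |].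
have oddE : odd (offset t.+1) = ~~ odd k by rewrite offsetS // deg1 addn1.
rewrite oddE /ord_det_odd det_Bpre_next //.
have /dval_eqP[norm0 normE] : dval_eq (b (e k) (e k)) (2 * K%:Z).
  by have := diagonal_norm lt_t diag (deg_gt0 lt_t); rewrite addn0.
have := stage_invariants stage_t.
case: ss s_odd (stage_reduced stage_t) => [|s [|s' [|//]]] s_odd redf /=.
- by move=> [k_even xi_neq0 _] [[k_odd _]|[_ xi0]]; [rewrite k_even in k_odd | rewrite xi0 eqxx in xi_neq0].
- move=> [k_odd det_neq0 detE] [[_ det_odd]|[k_even _]]; last by rewrite k_odd in k_even.
  move: det_odd detE (s_odd s (mem_head _ _)); rewrite vM //; move: normE.
  by move: (v _) (v (\det _)) (a s) (kb _ _) => p q r w; clear; lia.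
have s_parity := s_odd s (mem_head _ _); have s'_parity : odd (a s' + K).
  by apply: s_odd; rewrite !inE eqxx orbT.
by move: (reduced_singles_parity redf) s_parity s'_parity; clear; lia.
Qed.

Lemma exponents_le_singles_odd : isD (Cb bl t.+1) -> deg (Cb bl t.+1) = 1%N -> singles_odd ->
  exponents_le a k K.
Proof.
move=> diag deg1 s_odd l lk; have t0 := offset_gt0 lk.
have [diag_t|nondiag_t] := boolP (isD (Cb bl t)); first exact: exponents_le_after_diagonal.
have := bound_t t0; rewrite (negPf nondiag_t) => /(_ l lk) /leq_trans; apply.
exact: nondiagonal_scale_le.
Qed.

End Bounds.

Definition progress t : Prop := exists t' f a ps ss,
  [/\ (t < t')%N, (t' <= size bl)%N, stage t' f a ps ss & exponent_bound t' a ss].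

Section Step.

Variables (t : nat) (f : nat -> 'cV[F]_n) (a : nat -> nat) (ps : seq (nat * nat)) (ss : seq nat).
Hypotheses (stage_t : stage t f a ps ss) (bound_t : exponent_bound t a ss) (lt_t : (t < size bl)%N).

Local Notation k := (offset t).
Local Notation K := (kb bl t.+1).
Local Notation K_level_span := (level_span f a (indices ps ss) K%:Z).

Let I_k := stage_perm stage_t.
Let redf := stage_reduced stage_t.
Let f_tri := stage_unitriangular stage_t.
Let kI : k \notin indices ps ss. Proof. exact: stage_notin stage_t _ (leqnn k). Qed.
Let k1I : k.+1 \notin indices ps ss. Proof. exact: stage_notin stage_t _ (leqnSn k). Qed.

Lemma perm_new_pair : perm_eq (indices ((k, k.+1) :: ps) ss) (iota 0 k.+2).
Proof.
apply: (perm_iotaS (I := k :: indices ps ss)); last exact: (perm_iotaS (I := indices ps ss)).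
apply: perm_trans (perm_indices_cons _ _ _) _.
by apply/permPl; apply: (perm_catCA [:: k] [:: k.+1]).
Qed.

Lemma step_nondiagonal : ~~ isD (Cb bl t.+1) -> progress t.
Proof.
move=> nondiag; have [offE norm1 norm2 form12] := nondiagonal_form lt_t nondiag.
have a_le := exponents_le_nondiagonal stage_t bound_t lt_t nondiag.
have kk : k != k.+1 by rewrite neq_ltn ltnSn.
exists t.+1, (update (update f k (e k + 0)) k.+1 (e k.+1 + 0)), (update (update a k K) k.+1 K),
  ((k, k.+1) :: ps), ss; split=> //.
  apply: (stage_add_two stage_t) => //; try exact: coef_span0; first exact: perm_new_pair.
  rewrite !addr0; apply: (reduced_add_pair bC redf kk kI k1I) => // l lI.
    by rewrite /= (stage_orth stage_t) // mulr0 dval_ge0.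
  by rewrite /= (stage_orth stage_t) // mulr0 dval_ge0.
move=> _; rewrite (negPf nondiag) offE.
by apply: exponents_le_update => //; apply: exponents_le_update.
Qed.

Hypothesis diag : isD (Cb bl t.+1).

Let a_le : exponents_le a k K.+1. Proof. exact: exponents_le_diagonal bound_t lt_t diag. Qed.

Lemma level_span_stage y : K_level_span y -> integral_span (iota 0 k) y.
Proof. exact: level_span_integral f_tri I_k a_le. Qed.

Lemma diagonal_basis_norm t' : (t' < size bl)%N -> isD (Cb bl t'.+1) -> kb bl t'.+1 = K ->
  dval_eq (b (e (offset t')) (e (offset t'))) (2 * K%:Z).
Proof.
move=> lt_t' diag' <-; have := diagonal_norm lt_t' diag' (deg_gt0 lt_t').
by rewrite addn0.
Qed.

Lemma stage_new_vector q : (k <= q)%N -> dval_eq (b (e q) (e q)) (2 * K%:Z) -> new_vector b f ps ss K (e q).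
Proof. by move=> kq q_norm; split=> // l lI; apply: (stage_orth stage_t). Qed.

Lemma first_new_vector : new_vector b f ps ss K (e k).
Proof. exact: stage_new_vector (leqnn k) (diagonal_basis_norm lt_t diag erefl). Qed.

Lemma progress_one y c ps' ss' : deg (Cb bl t.+1) = 1%N -> integral_span (iota 0 k) y ->
  exponents_le a k c -> perm_eq (indices ps' ss') (k :: indices ps ss) ->
  reduced_system (update f k (e k + y)) (update a k c) ps' ss' ->
  exponent_bound t.+1 (update a k c) ss' -> progress t.
Proof.
move=> deg1 y_span le_c I'E redf' bound'; exists t.+1, (update f k (e k + y)), (update a k c), ps', ss'.
by split=> //; apply: (stage_add_one stage_t) => //; rewrite offsetS // deg1 addn1.
Qed.

Lemma progress_pair t' y y' : (t < t')%N -> (t' <= size bl)%N -> offset t' = k.+2 ->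
  isD (Cb bl t') -> kb bl t' = K -> ~ next_diagonal t' K -> K_level_span y -> K_level_span y' ->
  reduced_system (update (update f k (e k + y)) k.+1 (e k.+1 + y'))
    (update (update a k K.+1) k.+1 K.+1) ((k, k.+1) :: ps) ss -> progress t.
Proof.
move=> tt' t'_le offE diag' scale' last_diag /level_span_stage y_span /level_span_stage y'_span redf'.
exists t', (update (update f k (e k + y)) k.+1 (e k.+1 + y')), (update (update a k K.+1) k.+1 K.+1),
  ((k, k.+1) :: ps), ss; split=> //.
  apply: (stage_add_two stage_t) => //; last exact: perm_new_pair.
  exact: integral_span_le (leqnSn k) y'_span.
move=> _; rewrite diag' offE scale'; apply: Or32; split=> //.
by apply: exponents_le_update => //; apply: exponents_le_update.
Qed.

Section DegreeOne.

Hypothesis deg1 : deg (Cb bl t.+1) = 1%N.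

Let offE : offset t.+1 = k.+1. Proof. by rewrite offsetS // deg1 addn1. Qed.

Lemma step_singles_odd : (forall s, s \in ss -> odd (a s + K)) -> progress t.
Proof.
move=> s_odd; have le_K := exponents_le_singles_odd stage_t bound_t lt_t diag deg1 s_odd.
apply: (progress_one (y := 0) (c := K) (ps' := ps) (ss' := k :: ss) deg1) => //.
- exact: coef_span0.
- by rewrite addr0; apply: (new_single bC redf kI first_new_vector).
by move=> _; rewrite diag offE; apply: Or31; apply: exponents_le_update.
Qed.

Lemma next_diagonal_twin : next_diagonal t.+1 K ->
  [/\ (t.+2 <= size bl)%N, offset t.+2 = k.+2, isD (Cb bl t.+2), kb bl t.+2 = K &
   [/\ ~ next_diagonal t.+2 K, new_vector b f ps ss K (e k.+1) & b (e k) (e k.+1) = 0]].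
Proof.
move=> next; have [lt_tS diagS scaleS] := next.
have degS : deg (Cb bl t.+2) = 1%N.
  have := next_diagonal_degree lt_t diag next; rewrite deg1.
  by move: (deg_gt0 lt_tS); move: (deg _); clear; lia.
split=> //; first by rewrite offsetS // degS offE addn1.
split; first exact: no_third_diagonal lt_t diag next.
  by apply: stage_new_vector (leqnSn k) _; rewrite -offE; apply: diagonal_basis_norm.
by apply: (form_across_offset (t := t.+1)); rewrite offE.
Qed.

Lemma step_degree1_odd i : ss = [:: i] -> ~~ odd (a i + K) -> progress t.
Proof.
move=> ssE parity; have [next|last_diag] := EM (next_diagonal t.+1 K).
  have [t2_le offE2 diag2 scale2 [last2 new2 orth]] := next_diagonal_twin next.
  have [y [y' [y_span y'_span redf']]] := new_odd_pair bC redf kI first_new_vector k1I new2 orth ssE parity.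
  apply: (progress_pair (t' := t.+2) (y := y) (y' := y')) => //.
  by rewrite ssE.
have [y /level_span_stage y_span [] redf'] := new_odd bC redf kI first_new_vector ssE parity.
  have le_K2 : exponents_le a k K.+2 by move=> l lk; apply: leqW (a_le lk).
  apply: (progress_one deg1 y_span le_K2 _ redf'); first by apply: perm_indices_partner; rewrite ssE.
  move=> _; rewrite diag offE; apply: Or33; split=> //; last by left.
  exact: exponents_le_update.
apply: (progress_one deg1 y_span a_le _ redf'); first by rewrite ssE.
by move=> _; rewrite diag offE; apply: Or32; split=> //; apply: exponents_le_update.
Qed.

Lemma step_degree1_even i j : ss = [:: i; j] -> ~~ odd (a i + K) -> progress t.
Proof.
move=> ssE parity; have ij_odd : odd (a i + a j).
  by have := redf; rewrite ssE => /reduced_singles_parity.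
have ijE : perm_eq ss [:: j; i] by rewrite ssE; apply/permPl; apply: (perm_catC [:: i] [:: j]).
have single_neq s : s \in ss -> s != k by move=> s_ss; apply: (memPn kI); apply: indices_single.
case: (new_even bC redf kI first_new_vector ssE parity) => [[y /level_span_stage y_span redf']|].
  apply: (progress_one deg1 y_span a_le (perm_indices_partner _ _ ijE) redf').
  move=> _; rewrite diag offE; apply: Or32; split; first exact: exponents_le_update.
  by exists i => //; rewrite update_neq // single_neq // ssE mem_head.
move=> [[y /level_span_stage y_span redf'] add_pair]; have [next|last_diag] := EM (next_diagonal t.+1 K).
  have [t2_le offE2 diag2 scale2 [last2 new2 orth]] := next_diagonal_twin next.
  have [z [z' [z_span z'_span redf2]]] := add_pair _ k1I new2 orth.
  by apply: (progress_pair (t' := t.+2) (y := z) (y' := z')) => //; rewrite ssE.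
have le_K2 : exponents_le a k K.+2 by move=> l lk; apply: leqW (a_le lk).
apply: (progress_one deg1 y_span le_K2 _ redf'); first by apply: perm_indices_partner; rewrite ssE.
move=> _; rewrite diag offE; apply: Or33; split=> //; first exact: exponents_le_update.
right; exists j; split=> //.
- rewrite update_neq ?single_neq ?ssE ?inE ?eqxx ?orbT //.
  by move: parity ij_odd; clear; lia.
- by have := stage_invariants stage_t; rewrite ssE => -[].
by rewrite ltnS (offset_gt0 (l := i)) // (mem_indices_iota _ I_k) indices_single // ssE mem_head.
Qed.

End DegreeOne.

Section DegreeTwo.

Hypothesis deg2 : deg (Cb bl t.+1) = 2%N.

Let offE : offset t.+1 = k.+2. Proof. by rewrite offsetS // deg2 addn2. Qed.

Lemma second_new_vector : new_vector b f ps ss K (e k.+1).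
Proof.
apply: stage_new_vector (leqnSn k) _; have := diagonal_norm (x := 1%N) lt_t diag.
by rewrite deg2 addn1; apply.
Qed.

Lemma diagonal_block_orth : b (e k) (e k.+1) = 0.
Proof.
have lt_n : (k.+1 < n)%N by rewrite -offE offset_le_degs.
have := @ent_block t 0%N 1%N lt_t; rewrite deg2 addn0 addn1 => /(_ isT isT).
rewrite form_std_basis ?(ltnW lt_n) // => ->.
by case: (Cb bl t.+1) diag => //= s _; rewrite mulr0.
Qed.

Lemma degree2_last_diagonal : ~ next_diagonal t.+1 K.
Proof.
move=> next; have := next_diagonal_degree lt_t diag next; rewrite deg2.
by have [/deg_gt0] := next; move: (deg _); clear; lia.
Qed.

Lemma degree2_invariants :
  (~~ odd k /\ xi v (Bpre bl t) = 0 /\ xi v (Bpre bl t.+1) = 0) \/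
  (odd k /\ ~~ odd (`|v (\det (Bpre bl t))| + K)).
Proof.
have [_ [_ [_ [po3 _]]]] := bl_po; have [|_] := po3 t.+1 _ diag deg2; first by rewrite ltnS lt_t.
by have -> : odd (offset t.+1) = odd k by rewrite offE /= negbK.
Qed.

Lemma step_degree2_odd i : ss = [:: i] -> progress t.
Proof.
move=> ssE; have parity : ~~ odd (a i + K).
  have := stage_invariants stage_t; rewrite ssE /= => -[k_odd _ detE].
  by case: degree2_invariants => [[k_even _]|[_]]; [rewrite k_odd in k_even | rewrite !oddD detE].
have [y [y' [y_span y'_span redf']]] :=
  new_odd_pair bC redf kI first_new_vector k1I second_new_vector diagonal_block_orth ssE parity.
apply: (progress_pair (t' := t.+1) (y := y) (y' := y')) => //; first exact: degree2_last_diagonal.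
by rewrite ssE.
Qed.

Section LinkedSingles.

Variables (i j : nat) (y : 'cV[F]_n).
Hypotheses (ssE : ss = [:: i; j]) (parity : ~~ odd (a i + K)) (y_span : integral_span (iota 0 k) y).

Local Notation f1 := (update f k (e k + y)).
Local Notation a1 := (update a k K.+1).

Hypothesis redf1 : reduced_system f1 a1 ((j, k) :: ps) [:: i].

Let I_k1 : perm_eq (indices ((j, k) :: ps) [:: i]) (iota 0 k.+1).
Proof.
apply: perm_iotaS I_k; apply: perm_indices_partner.
by rewrite ssE; apply/permPl; apply: (perm_catC [:: i] [:: j]).
Qed.

Lemma linked_new_vector : new_vector b f1 ((j, k) :: ps) [:: i] K (e k.+1).
Proof.
split; last exact: second_new_vector.2.
move=> l; rewrite -(mem_indices_iota _ I_k1) ltnS leq_eqVlt => /predU1P[->|lk].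
  by rewrite update_eq linearDl /= diagonal_block_orth add0r (integral_span_orth y_span).
by rewrite update_neq ?ltn_eqF // second_new_vector.1 // -(mem_indices_iota _ I_k).
Qed.

(* The pair [(i, k + 1)] would complete a system without singles, contradicting [xi = 0] (PO3). *)
Lemma step_degree2_linked : xi v (Bpre bl t.+1) = 0 -> progress t.
Proof.
move=> xi0; have k1I' : k.+1 \notin indices ((j, k) :: ps) [:: i] by rewrite -(mem_indices_iota _ I_k1) ltnn.
have i_neq : i != k.
  by apply: (memPn kI); rewrite indices_single // ssE mem_head.
have parity1 : ~~ odd (a1 i + K) by rewrite update_neq.
have [y' y'_level redf2] := new_odd bC redf1 k1I' linked_new_vector erefl parity1.
have f1_tri := unitriangular_update f_tri y_span.
have a1_le : exponents_le a1 k.+1 K.+1 by apply: exponents_le_update.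
have y'_span := level_span_integral f1_tri I_k1 a1_le y'_level.
case: redf2 => redf2.
  have I_k2 : perm_eq (indices [:: (i, k.+1), (j, k) & ps] [::]) (iota 0 (offset t.+1)).
    by rewrite offE; apply: perm_iotaS I_k1; apply: perm_indices_partner.
  have f2_tri := unitriangular_update f1_tri y'_span; rewrite -offE in f2_tri.
  have := reduced_invariants bC I_k2 redf2 (Bpre_congruent_to_gram f2_tri).
  by rewrite /= xi0 eqxx => -[].
exists t.+1, (update f1 k.+1 (e k.+1 + y')), (update a1 k.+1 K.+1), ((j, k) :: ps), [:: k.+1; i].
split=> //; first by apply: (stage_add_two stage_t) => //; apply: perm_iotaS I_k1.
move=> _; rewrite diag offE; apply: Or32; split; last by move/degree2_last_diagonal.
exact: exponents_le_update.
Qed.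

End LinkedSingles.

Lemma step_degree2_even i j : ss = [:: i; j] -> ~~ odd (a i + K) -> progress t.
Proof.
move=> ssE parity; have xi0 : xi v (Bpre bl t.+1) = 0.
  have := stage_invariants stage_t; rewrite ssE => -[k_even _].
  by case: degree2_invariants => [[_ []]//|[k_odd _]]; rewrite k_odd in k_even.
case: (new_even bC redf kI first_new_vector ssE parity) => [[y /level_span_stage y_span redf1]|[_ add_pair]].
  exact: step_degree2_linked ssE parity y_span redf1 xi0.
have [y [y' [y_span y'_span redf']]] := add_pair _ k1I second_new_vector diagonal_block_orth.
by apply: (progress_pair (t' := t.+1) (y := y) (y' := y')) => //;
  [apply: degree2_last_diagonal | rewrite ssE].
Qed.

Lemma degree2_singles : ss != [::].
Proof.
apply/eqP => ss0; have := stage_invariants stage_t; rewrite ss0 /= => -[k_even xi_neq0 _].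
case: degree2_invariants => [[_ [xi0 _]]|[k_odd _]]; first by rewrite xi0 eqxx in xi_neq0.
by rewrite k_odd in k_even.
Qed.

End DegreeTwo.

End Step.

Lemma singles_by_parity f a ps ss K : reduced_system f a ps ss ->
  [\/ ss = [::], exists i, ss = [:: i] |
      exists i j, perm_eq ss [:: i; j] /\ ~~ odd (a i + K)].
Proof.
move=> redf; case: ss redf (reduced_singles redf) => [|i [|j [|//]]] redf _; first exact: Or31.
  by apply: Or32; exists i.
apply: Or33; have [i_odd|i_even] := boolP (odd (a i + K)); last by exists i, j.
exists j, i; split; first by apply/permPl; apply: (perm_catC [:: i] [:: j]).
by move: (reduced_singles_parity redf) i_odd; clear; lia.
Qed.

Lemma step_diagonal t f a ps ss : stage t f a ps ss -> exponent_bound t a ss -> (t < size bl)%N ->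
  isD (Cb bl t.+1) -> progress t.
Proof.
move=> stage_t bound_t lt_t diag; have deg_le := diagonal_deg_le2 lt_t diag.
have [deg1|deg2] : deg (Cb bl t.+1) = 1%N \/ deg (Cb bl t.+1) = 2%N.
  by move: (deg_gt0 lt_t) deg_le; move: (deg _); clear; lia.
- case: (singles_by_parity (kb bl t.+1) (stage_reduced stage_t)) => [ss0|[i ssE]|[i [j [ssE parity]]]].
  + by apply: (step_singles_odd stage_t bound_t lt_t diag deg1); rewrite ss0.
  + have [s_odd|s_even] := boolP (odd (a i + kb bl t.+1)).
      by apply: (step_singles_odd stage_t bound_t lt_t diag deg1) => s; rewrite ssE inE => /eqP->.
    exact: (step_degree1_odd stage_t bound_t lt_t diag deg1 ssE s_even).
  have stage' := stage_perm_singles ssE stage_t; have bound' := exponent_bound_perm ssE bound_t.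
  exact: (step_degree1_even stage' bound' lt_t diag deg1 erefl parity).
case: (singles_by_parity (kb bl t.+1) (stage_reduced stage_t)) => [ss0|[i ssE]|[i [j [ssE parity]]]].
- by have := degree2_singles stage_t lt_t diag deg2; rewrite ss0.
- exact: (step_degree2_odd stage_t bound_t lt_t diag deg2 ssE).
have stage' := stage_perm_singles ssE stage_t; have bound' := exponent_bound_perm ssE bound_t.
exact: (step_degree2_even stage' bound' lt_t diag deg2 erefl parity).
Qed.

Lemma exists_full_stage : exists f a ps ss, stage (size bl) f a ps ss.
Proof.
suff from_stage d t f a ps ss : (size bl - t <= d)%N -> (t <= size bl)%N -> stage t f a ps ss ->
    exponent_bound t a ss -> exists f a ps ss, stage (size bl) f a ps ss.
  apply: (from_stage (size bl) 0%N (fun=> 0) (fun=> 0%N) [::] [::]); rewrite ?subn0 //.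
  by split; rewrite ?take0.
elim: d t f a ps ss => [|d IH] t f a ps ss le_d t_le stage_t bound_t.
  have -> : size bl = t by apply/eqP; rewrite eqn_leq t_le -subn_eq0 andbT -leqn0.
  by exists f, a, ps, ss.
move: t_le; rewrite leq_eqVlt => /predU1P[tE|lt_t]; first by rewrite -tE; exists f, a, ps, ss.
have [t' [f' [a' [ps' [ss' [tt' t'_le stage' bound']]]]]] : progress t.
  have [diag|nondiag] := boolP (isD (Cb bl t.+1)); first exact: step_diagonal stage_t bound_t lt_t diag.
  exact: step_nondiagonal stage_t bound_t lt_t nondiag.
by apply: (IH t') stage' bound' => //; move: le_d tt' lt_t; clear; lia.
Qed.

End Induction.

Section FullStage.

Variables (f : nat -> 'cV[F]_n) (a : nat -> nat) (ps : seq (nat * nat)) (ss : seq nat).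
Hypothesis stage_bl : stage (size bl) f a ps ss.

Let I_n : perm_eq (indices ps ss) (iota 0 n).
Proof. by have := stage_perm stage_bl; rewrite take_size. Qed.

Let f_tri : unitriangular n f.
Proof. by have := stage_unitriangular stage_bl; rewrite take_size. Qed.

Definition stage_mx : 'M[F]_n := \matrix_(i, j) f j i 0.
Definition stage_form : 'M[F]_n := stage_mx^T *m assemble bl *m stage_mx.

Lemma integral_span_coord l x : integral_span (iota 0 l) x -> forall i : 'I_n,
  ((l <= i)%N -> x i 0 = 0) /\ dval_ge (x i 0) 0.
Proof.
move=> x_span i; elim: x / x_span => [|x m c _ [x_out x_int] m_l c_int]; first by rewrite mxE dval_ge0.
rewrite !mxE; split=> [li|].
  rewrite x_out // add0r (_ : (i == m :> nat) = false) ?mulr0 //.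
  by move: m_l; rewrite mem_iota /= => ml; rewrite gtn_eqF // (leq_trans ml).
apply: dval_geD => //; apply: (dval_geM_le c_int (l := 0)) => //.
by case: (_ == _); rewrite ?dval_ge1 ?dval_ge0.
Qed.

Lemma stage_mx_coord (i j : 'I_n) :
  [/\ (j < i)%N -> stage_mx i j = 0, stage_mx j j = 1 & dval_ge (stage_mx i j) 0].
Proof.
have coordE (l : 'I_n) : stage_mx l j = (f j - e j) l 0 + (l == j :> nat)%:R by rewrite !mxE subrK.
have coord := integral_span_coord (f_tri (ltn_ord j)); split.
- by move=> ji; rewrite coordE; have [out _] := coord i; rewrite out ?(ltnW ji) // add0r gtn_eqF.
- by rewrite coordE eqxx; have [out _] := coord j; rewrite out // add0r.
rewrite coordE; apply: dval_geD; first by have [] := coord i.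
by case: (_ == _); rewrite ?dval_ge1 ?dval_ge0.
Qed.

Lemma GLo_stage_mx : GLo v stage_mx.
Proof.
apply/GLoP; split=> [|i j]; last by have [] := stage_mx_coord i j.
rewrite -det_tr det_trig; last first.
  by apply/is_trig_mxP => i j ij; rewrite mxE; have [out _ _] := stage_mx_coord j i; rewrite out.
rewrite big1 ?dval_eq1 // => i _; rewrite mxE.
by have [_ -> _] := stage_mx_coord i i.
Qed.

Lemma sim_stage_form : sim v (assemble bl) stage_form.
Proof. by exists stage_mx; split=> //; apply: GLo_stage_mx. Qed.

Lemma stage_formE (i j : 'I_n) : stage_form i j = b (f i) (f j).
Proof.
have colE (l : 'I_n) : col l stage_mx = f l by apply/colP => m; rewrite !mxE.
by rewrite -matrix_form_col !colE.
Qed.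

Lemma stage_form_sym : stage_form^T = stage_form.
Proof. by rewrite /stage_form !trmx_mul trmxK assemble_sym mulmxA. Qed.

Lemma stage_bounded : form_bounded b f a (iota 0 n).
Proof.
have [norm_ge form_ge] := reduced_bounded bC (stage_reduced stage_bl); have memI := perm_mem I_n.
by split=> [i|i j]; rewrite -!memI; [apply: norm_ge | apply: form_ge].
Qed.

Lemma exponents_monotone i j : (i <= j)%N -> (j < n)%N -> (a i <= a j)%N.
Proof. by move=> ij jn; apply: (stage_monotone stage_bl ij); rewrite take_size. Qed.

Lemma inS_stage_form : inS v stage_form (mkseq a n).
Proof.
have [norm_ge form_ge] := stage_bounded.
have mem_n (i : 'I_n) : (i : nat) \in iota 0 n by rewrite mem_iota ltn_ord.
split; first by rewrite size_mkseq.
- apply/(sortedP 0%N) => i; rewrite size_mkseq => lt_i.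
  by rewrite !nth_mkseq // ?exponents_monotone // ltnW.
- by move=> i; rewrite stage_formE nth_mkseq // vgeE; apply: norm_ge.
move=> i j ij; rewrite stage_formE !nth_mkseq // PoszD.
have [->|ij_neq] := eqVneq i j; last exact: form_ge.
by apply: dval_ge2M (norm_ge j (mem_n j)) _; clear; lia.
Qed.

Lemma reduced_prefix_at_jump c : (0 < c <= n)%N -> ((c < n)%N -> (a c.-1 < a c)%N) ->
  reduced_prefix f a c.
Proof.
move=> /andP[c0]; rewrite leq_eqVlt => /predU1P[-> _|cn /(_ cn) jump_c].
  by exists (size bl), ps, ss; split; rewrite ?take_size //; apply: stage_reduced stage_bl.
by case: c c0 cn jump_c => // c _ cn; apply: (stage_jumps stage_bl); rewrite take_size.
Qed.

Lemma stage_form_nonsingular : graded_nonsingular stage_form (mkseq a n).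
Proof.
apply: (reduced_graded_nonsingular bC stage_formE stage_bounded) => m.
pose c := find (fun i => (m < a i)%N) (iota 0 n).
have le_cn : (c <= n)%N by have := find_size (fun i => (m < a i)%N) (iota 0 n); rewrite size_iota.
have a_le i : (i < c)%N -> (a i <= m)%N.
  move=> ic; have := before_find 0%N ic; rewrite nth_iota ?add0n ?(leq_trans ic) //.
  by move/negbT; rewrite -leqNgt.
have a_gt : (c < n)%N -> (m < a c)%N.
  move=> cn; have has_gt : has (fun i => (m < a i)%N) (iota 0 n) by rewrite has_find size_iota.
  by have := nth_find 0%N has_gt; rewrite nth_iota.
have cP i : (i < n)%N -> (i < c)%N = (a i <= m)%N.
  move=> lt_in; have [ic|ci] := ltnP i c; first by rewrite a_le.
  apply/esym/negbTE; rewrite -ltnNge; apply: leq_trans (a_gt (leq_ltn_trans ci lt_in)) _.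
  exact: exponents_monotone.
have [c0|c_gt0] := posnP c; first by exists 0%N, [::], [::]; split=> // i /cP; rewrite c0.
have [||t [ps' [ss' [_ _ I_c redf']]]] := @reduced_prefix_at_jump c; first by rewrite c_gt0.
  by move=> cn; apply: leq_ltn_trans (a_gt cn); apply: a_le; rewrite prednK.
by exists c, ps', ss'.
Qed.

Lemma GK_stage_form : GK v stage_form = mkseq a n.
Proof. exact: GK_eq stage_form_sym inS_stage_form stage_form_nonsingular. Qed.

Lemma optimal_stage_form : optimal v stage_form.
Proof. by rewrite /optimal GK_stage_form; apply: inS_stage_form. Qed.

Lemma GK_assemble : GK v (assemble bl) = mkseq a n.
Proof. by rewrite (GK_sim sim_stage_form) GK_stage_form. Qed.

Section OptimalForm.

Variable U : 'M[F]_n.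
Hypotheses (U_GL : GLo v U) (U_opt : optimal v (U^T *m assemble bl *m U)).

Local Notation M := (U^T *m assemble bl *m U).

Definition optimal_basis (i : nat) : 'cV[F]_n := if insub i is Some j then col j U else 0.

Definition optimal_transition : 'M[F]_n := invmx U *m stage_mx.

Lemma form_optimal_basis (i j : 'I_n) : b (optimal_basis i) (optimal_basis j) = M i j.
Proof. by rewrite /optimal_basis !valK matrix_form_col. Qed.

Lemma inS_optimal : inS v M (mkseq a n).
Proof. by move: U_opt; rewrite /optimal -(GK_sim (M := assemble bl)) ?GK_assemble //; exists U. Qed.

Lemma optimal_basis_bounded : form_bounded b optimal_basis a (iota 0 n).
Proof.
have [_ _ diag_ge _] := inS_optimal; have symM : M^T = M by rewrite !trmx_mul trmxK assemble_sym mulmxA.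
split=> [i|i j]; rewrite !mem_iota /= => i_n.
  by have := diag_ge (Ordinal i_n); rewrite nth_mkseq // vgeE -form_optimal_basis.
move=> j_n ij; have := inS_offdiag (Ordinal i_n) (Ordinal j_n) symM inS_optimal.
by rewrite !nth_mkseq // -form_optimal_basis.
Qed.

Lemma optimal_transition_ge (i j : 'I_n) :
  dval_ge (optimal_transition i j) ((a j)%:Z - (a i)%:Z) /\ dval_ge (optimal_transition i j) 0.
Proof.
have T_GL := GLo_stage_mx; have T_unit := GLo_unitmx T_GL; have U_unit := GLo_unitmx U_GL.
pose W := invmx stage_mx *m U.
have W_GL : GLo v W by apply: GLo_mul (GLo_inv T_GL) U_GL.
have ZE : invmx W = optimal_transition.
  apply: (can_inj (mulKmx (GLo_unitmx W_GL))).
  by rewrite mulmxV ?(GLo_unitmx W_GL) // /W /optimal_transition mulmxA mulmxK // mulVmx.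
have ME : W^T *m stage_form *m W = M.
  rewrite /W /stage_form trmx_mul trmx_inv !mulmxA mulmxKV ?unitmx_tr //.
  by rewrite -!mulmxA (mulmxA stage_mx) mulmxV // mul1mx.
have W_a : inS v (W^T *m stage_form *m W) (mkseq a n) by rewrite ME; apply: inS_optimal.
have Z_ge := dval_ge_invmx_inS stage_form_sym stage_form_nonsingular W_GL W_a (size_mkseq _ _) erefl.
have /GLoP[_ Z_int] := GLo_inv W_GL; rewrite -ZE; split; last exact: Z_int.
by have := Z_ge i j; rewrite !nth_mkseq.
Qed.

Lemma stage_vector_optimal_basis j : (j < n)%N ->
  f j = \sum_(i <- iota 0 n) mxe optimal_transition i j *: optimal_basis i.
Proof.
move=> lt_j; have -> : f j = col (Ordinal lt_j) stage_mx by apply/colP => i; rewrite !mxE.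
have TE : stage_mx = U *m optimal_transition by rewrite mulKVmx // GLo_unitmx.
rewrite -[n in iota 0 n]subn0 -/(index_iota 0 n) big_mkord; apply/colP => x.
rewrite TE mxE [LHS]mxE summxE; apply: eq_bigr => i _.
by rewrite [RHS]mxE /optimal_basis valK [col i U x 0]mxE mulrC -(mxe_ord optimal_transition).
Qed.

Lemma zeta_optimal_at_jump c : (c <= n)%N ->
  (forall i l, (i < c)%N -> (c <= l)%N -> (l < n)%N -> (a i < a l)%N) ->
  forall t ps' ss', offset t = c -> perm_eq (indices ps' ss') (iota 0 c) ->
    reduced_system f a ps' ss' -> zeta v (ulsub c M) = zeta v (Bpre bl t).
Proof.
move=> le_cn jump t ps' ss' tE; subst c => I_c redf'.
have -> : ulsub (offset t) M = gram b optimal_basis (offset t).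
  apply/matrixP => i j; rewrite [LHS]mxE [RHS]mxE.
  have [i_n j_n] := (leq_trans (ltn_ord i) le_cn, leq_trans (ltn_ord j) le_cn).
  rewrite -[RHS]/(b (optimal_basis (Ordinal i_n)) (optimal_basis (Ordinal j_n))) form_optimal_basis.
  exact: (mxe_ord M (Ordinal i_n) (Ordinal j_n)).
have coordE i j (i_n : (i < n)%N) (j_n : (j < n)%N) :
    mxe optimal_transition i j = optimal_transition (Ordinal i_n) (Ordinal j_n).
  exact: (mxe_ord _ (Ordinal i_n) (Ordinal j_n)).
apply: (zeta_gram_at_jump bC optimal_basis_bounded le_cn stage_vector_optimal_basis _ _ jump I_c redf').
- by move=> i j i_n j_n; rewrite coordE; have [] := optimal_transition_ge (Ordinal i_n) (Ordinal j_n).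
- by move=> i j i_n j_n; rewrite coordE; have [] := optimal_transition_ge (Ordinal i_n) (Ordinal j_n).
apply: Bpre_congruent_to_gram => l lt_l; apply: f_tri.
exact: leq_trans lt_l le_cn.
Qed.

End OptimalForm.

Lemma block_boundary c : (0 < c <= n)%N ->
  (forall i l, (i < c)%N -> (c <= l)%N -> (l < n)%N -> (a i < a l)%N) ->
  exists t, [/\ (1 <= t <= size bl)%N, c = offset t &
    forall M, sim v (assemble bl) M -> optimal v M -> zeta v (ulsub c M) = zeta v (Bpre bl t)].
Proof.
move=> c_range jump; have /andP[c0 le_cn] := c_range.
have [|t [ps' [ss' [t_le tE I_c redf']]]] := reduced_prefix_at_jump c_range.
  by move=> cn; apply: jump; rewrite ?prednK.
exists t; split=> // [|M [U [U_GL ->]] U_opt]; first by rewrite t_le andbT (offset_gt0 (l := 0)) // tE.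
exact: (zeta_optimal_at_jump U_GL U_opt le_cn jump tE I_c redf').
Qed.

End FullStage.

End PreOptimalForms.

Lemma EGK_eq n (M : 'M[F]_n) ns ms zs : GK v M = expand_runs ns ms -> size ns = size ms ->
  all (fun x => 0 < x)%N ns -> sorted ltn ms -> (exists N, sim v M N /\ optimal v N) ->
  (forall N, sim v M N -> optimal v N ->
     [seq zeta v (ulsub (sumn (take j ns)) N) | j <- iota 1 (size ns)] = zs) ->
  EGK v M = (ns, ms, zs).
Proof.
move=> GK_M sz ns_gt0 ms_sorted [N [MN N_opt]] zetaE; rewrite /EGK.
have := @classical_sets.xgetPex _ M (fun N => sim v M N /\ optimal v N); set N' := classical_sets.xget _ _.
case=> [|MN' N'_opt]; first by exists N.
rewrite -(GK_sim MN') GK_M runs_expand_runs // -/(unzip1 _) -/(unzip2 _) unzip1_zip ?unzip2_zip ?sz //.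
by rewrite -sz zetaE.
Qed.

End DyadicField.

Theorem theorem4p2 (F : fieldType) (v : F -> int) (HF : unram2 v)
    (bl : seq (nat * blk F)) (ns ms : seq nat) :
  all (fun p => blk_ok v p.2) bl ->
  in_Hn v (assemble bl) ->
  pre_optimal v bl ->
  size ns = size ms -> all (fun x => 0 < x)%N ns -> sorted ltn ms ->
  GK v (assemble bl) = flatten [seq nseq p.1 p.2 | p <- zip ns ms] ->
  exists l : nat -> nat,
    (forall j : nat, (1 <= j <= size ns)%N ->
       [/\ (1 <= l j <= size bl)%N,
           sumn (take j ns) = degs (take (l j) bl) &
           forall a b : nat,
             mxe (ulsub (sumn (take j ns)) (assemble bl)) a b =
             mxe (Bpre bl (l j)) a b]) /\
    EGK v (assemble bl) =
      (ns, ms, [seq zeta v (Bpre bl (l j)) | j <- iota 1 (size ns)]).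
Proof.
move=> bl_ok _ bl_po sz ns_gt0 ms_sorted GK_expand.
have [f [a [ps [ss stage_bl]]]] := exists_full_stage HF bl_ok bl_po.
have aE : mkseq a (degs bl) = expand_runs ns ms by rewrite -(GK_assemble HF stage_bl).
have nE : degs bl = sumn ns by rewrite -(size_expand_runs sz) -aE size_mkseq.
have nth_a i : (i < degs bl)%N -> nth 0%N (expand_runs ns ms) i = a i by rewrite -aE; apply: nth_mkseq.
have boundary j : exists t, (1 <= j <= size ns)%N ->
    [/\ (1 <= t <= size bl)%N, sumn (take j ns) = degs (take t bl) &
        forall M, sim v (assemble bl) M -> optimal v M ->
          zeta v (ulsub (sumn (take j ns)) M) = zeta v (Bpre bl t)].
  have [j_range|_] := boolP (1 <= j <= size ns)%N; last by exists 0%N.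
  have c_range := sumn_take_gt0 ns_gt0 j_range; rewrite -nE in c_range.
  have [|t tP] := block_boundary HF stage_bl c_range; last by exists t.
  move=> i l ic cl ln; rewrite -!nth_a //; last by apply: leq_trans ic (leq_trans cl (ltnW ln)).
  by apply: (expand_runs_jump sz ms_sorted ic cl); rewrite size_expand_runs // -nE.
have [l lP] := choice boundary; exists l; split=> [j /lP[l_range cE _]|].
  by split=> // x y; rewrite cE ulsub_assemble.
apply: EGK_eq => //; first exists (stage_form f).
  by split; [apply: (sim_stage_form HF stage_bl) | apply: (optimal_stage_form HF stage_bl)].
move=> M BM M_opt; apply/eq_in_map => j; rewrite mem_iota add1n ltnS => /lP[_ _ zetaE].
exact: zetaE.
Qed.
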